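(* Given a nonzero Hermitian matrix $\mathbf{A}\in\mathbb{C}^{n\times n}$ and $\epsilon\in(0,1/2)$, there exists a randomized floating point algorithm $\widetilde\sigma\leftarrow\mathsf{NORM}(\mathbf{A},\epsilon)$ such that: (i) on success it returns $\widetilde\sigma$ with $|\widetilde\sigma-\|\mathbf{A}\||\le\epsilon\|\mathbf{A}\|$; (ii) it executes $O\big(T_{\mathsf{MM}}(n)\log^2(\tfrac{n}{\epsilon\|\mathbf{A}\|})\log(\tfrac{1}{\epsilon\|\mathbf{A}\|})\big)$ floating point operations; (iii) its success probability is at least $1-O\big(\log(1/(\epsilon\|\mathbf{A}\|))/n\big)$; (iv) it requires $O\big(\log^4(n/(\epsilon\|\mathbf{A}\|))\log n\big)$ bits of precision, and if the available bits are not sufficient, the algorithm can identify this and halt with an error message.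
   Context: Floating point model with unit roundoff $\mathbf{u}$: $\mathrm{fl}(a\odot b)=(1+\delta)(a\odot b)$, $|\delta|\le\mathbf{u}$, for $\odot\in\{+,-,\times,/\}$. $T_{\mathsf{MM}}(n)=O(n^{\omega+\eta})$ is the arithmetic cost of a numerically stable fast matrix multiplication algorithm (any fixed $\eta>0$, $\omega$ the matrix multiplication exponent). $\|\cdot\|$ is the spectral norm.
   Formalization: In all the logarithms ‖A‖ is replaced by min(1,‖A‖): the bounds are literal for ‖A‖≤1, while for ‖A‖>1 they read log(n/ε) and log(1/ε), since the stated bounds fail there (e.g. ε‖A‖=1 would allow zero operations with success probability 1). *)

(* Defs.v *)
From HB Require Import structures.
From mathcomp Require Import all_boot all_order all_algebra.
From mathcomp Require Import all_classical all_reals all_analysis.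
From mathcomp Require Import complex.

Set Implicit Arguments.
Unset Strict Implicit.
Unset Printing Implicit Defensive.

Import Order.TTheory GRing.Theory Num.Theory.

Local Open Scope ring_scope.

Section SpectralNorm.
Context {R : realType}.

Definition l2norm n (x : 'cV[R[i]]_n) : R :=
  Num.sqrt (\sum_i (complex.Re (x i 0) ^+ 2 + complex.Im (x i 0) ^+ 2)).

Definition spectral_norm n (A : 'M[R[i]]_n) : R :=
  sup [set l2norm (A *m x) | x in [set x | l2norm x <= 1]]%classic.

End SpectralNorm.

(* [bilinear_rank_le F n r]: the rank of the n x n x n matrix multiplication
   tensor over F is at most r, i.e. r bilinear multiplications suffice. *)
Definition bilinear_rank_le (F : fieldType) (n r : nat) : Prop :=
  exists u v w : 'I_r -> 'M[F]_n, forall A B : 'M[F]_n,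
    A *m B = \sum_(l < r)
      ((\sum_i \sum_j u l i j * A i j) * (\sum_i \sum_j v l i j * B i j))
        *: w l.

(* inf {tau | rank <n,n,n> = O(n^tau)}, over the complex numbers *)
Definition mm_exponent (R : realType) : R :=
  inf [set tau : R | exists K : R, forall n : nat, (0 < n)%N ->
    exists2 r : nat, bilinear_rank_le R[i] n r & r%:R <= K * n%:R `^ tau]%classic.

Definition T_MM {R : realType} (eta : R) (n : nat) : R :=
  n%:R `^ (mm_exponent R + eta).

Variant flop := FAdd | FSub | FMul | FDiv.

Section FloatingPoint.
Context {R : realType}.

Definition flop_exact (o : flop) (a b : R) : R :=
  match o with
  | FAdd => a + b | FSub => a - b | FMul => a * b | FDiv => a / b
  end.

(* [fl_cst c] is the floating point number used for a constant c occurring in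
   the text of a program. *)
Record fp_arith := FPArith { fl : flop -> R -> R -> R ; fl_cst : R -> R }.

(* The result of a division by 0 is left unconstrained. *)
Definition fp_model (u : R) (F : fp_arith) : Prop :=
  (forall o a b, (o = FDiv -> b != 0) ->
     exists2 delta : R, `|delta| <= u & fl F o a b = (1 + delta) * flop_exact o a b)
  /\ (forall c, exists2 delta : R, `|delta| <= u & fl_cst F c = (1 + delta) * c).

End FloatingPoint.
Arguments fp_arith : clear implicits.

(* Randomized floating point programs: while programs over finitely many
   word-size integer registers and an unbounded memory of reals addressed by
   integers. The integers carry control and addresses. The arithmetic on reals
   goes through [fl], and reals influence control only through the comparison
   [CLe]. *)
Inductive iexpr :=
  | IConst of nat
  | IReg of nat
  | IAdd of iexpr & iexpr
  | ISub of iexpr & iexpr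
  | IMul of iexpr & iexpr
  | IDiv of iexpr & iexpr
  | IMod of iexpr & iexpr
  | ILe of iexpr & iexpr.

Inductive cmd (R : Type) :=
  | CSkip
  | CSeq of cmd R & cmd R
  | CIf of iexpr & cmd R & cmd R
  | CWhile of iexpr & cmd R
  | CSet of nat & iexpr
  | CFlip of nat
  | CLe of nat & iexpr & iexpr
  | CCopy of iexpr & iexpr
  | CConst of iexpr & R
  | COp of flop & iexpr & iexpr & iexpr.
Arguments CSkip {R}.

(* On input size n and precision p, integers are words modulo
   (n + p + 2) ^ word_exp, that is, words of O(log (n + p)) bits. *)
Record program (R : Type) := Program { word_exp : nat ; code : cmd R }.

Section Semantics.
Context {R : realType}.

Record state := State {
  regs : nat -> nat ;
  cells : nat -> R ;
  flips : nat ;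
  flops : nat
}.

Definition upd {T : Type} (f : nat -> T) (a : nat) (v : T) : nat -> T :=
  fun b => if b == a then v else f b.

Variables (F : fp_arith R) (W : nat) (tape : nat -> bool).

Fixpoint ieval (r : nat -> nat) (e : iexpr) : nat :=
  (match e with
  | IConst k => k %% W
  | IReg x => r x
  | IAdd a b => (ieval r a + ieval r b) %% W
  | ISub a b => ieval r a - ieval r b
  | IMul a b => (ieval r a * ieval r b) %% W
  | IDiv a b => ieval r a %/ ieval r b
  | IMod a b => ieval r a %% ieval r b
  | ILe a b => ieval r a <= ieval r b
  end)%N.

(* [flops] counts arithmetic operations and comparisons on reals, and also coin
   flips; [None] means that the fuel is exhausted. *)
Fixpoint exec (fuel : nat) (c : cmd R) (s : state) : option state :=
  if fuel is f.+1 then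
    let: State r m k t := s in
    match c with
    | CSkip => Some s
    | CSeq c1 c2 => obind (exec f c2) (exec f c1 s)
    | CIf e c1 c2 => exec f (if ieval r e != 0%N then c1 else c2) s
    | CWhile e c1 =>
        if ieval r e != 0%N then obind (exec f c) (exec f c1 s) else Some s
    | CSet x e => Some (State (upd r x (ieval r e)) m k t)
    | CFlip x => Some (State (upd r x (nat_of_bool (tape k))) m k.+1 t.+1)
    | CLe x a b =>
        Some (State (upd r x (nat_of_bool (m (ieval r a) <= m (ieval r b))))
                m k t.+1)
    | CCopy d a => Some (State r (upd m (ieval r d) (m (ieval r a))) k t)
    | CConst d x => Some (State r (upd m (ieval r d) (fl_cst F x)) k t)
    | COp o d a b =>
        Some (State r (upd m (ieval r d) (fl F o (m (ieval r a)) (m (ieval r b))))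
                k t.+1)
    end
  else None.

End Semantics.
Arguments state : clear implicits.

Section Runs.
Context {R : realType}.

(* Cell 0 holds eps; cells 1 + 2 * (i * n + j) and 2 + 2 * (i * n + j) hold the
   real and imaginary parts of A i j. *)
Definition input_mem n (A : 'M[R[i]]_n) (eps : R) (a : nat) : R :=
  if a is k.+1 then
    match (insub (k./2 %/ n)%N : option 'I_n), (insub (k./2 %% n)%N : option 'I_n) with
    | Some i, Some j => if odd k then complex.Im (A i j) else complex.Re (A i j)
    | _, _ => 0
    end
  else eps.

Definition input_state n (A : 'M[R[i]]_n) (eps : R) (p : nat) : state R :=
  State (upd (upd (fun=> 0%N) 1 n) 2 p) (input_mem A eps) 0 0.

Definition unit_roundoff (p : nat) : R := 2 ^- p.

(* [halts P F A eps p t s]: with the N coin tosses t, p bits of precision and the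
   arithmetic F, the program P on input (A, eps) stops in the state s, after
   at most N coin tosses. *)
Definition halts (P : program R) (F : fp_arith R) n (A : 'M[R[i]]_n) (eps : R)
    (p : nat) N (t : N.-tuple bool) (s : state R) : Prop :=
  (exists fuel, exec F ((n + p + 2) ^ word_exp P) (nth false t) fuel (code P)
                  (input_state A eps p) = Some s)
  /\ (flips s <= N)%N.

(* Register 0 is the status on exit: 0 when a result is returned (in cell 0),
   nonzero for the error message, rendered by None. *)
Definition outcome (s : state R) : option R :=
  if regs s 0 == 0%N then Some (cells s 0) else None.

Definition coin_prob N (E : N.-tuple bool -> Prop) : R :=
  #|[set t : N.-tuple bool | `[< E t >]]%SET|%:R / 2 ^+ N.

(* The logarithms of n / (eps ‖A‖) and 1 / (eps ‖A‖) are meaningful as bounds for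
   ‖A‖ <= 1; for ‖A‖ > 1 the factor ‖A‖ in them is replaced by 1. *)
Definition eps_norm n (A : 'M[R[i]]_n) (eps : R) : R :=
  eps * Num.min 1 (spectral_norm A).

End Runs.

(* Main.v *)
Require Import Defs.
From HB Require Import structures.
From mathcomp Require Import all_boot all_order all_algebra.
From mathcomp Require Import all_classical all_reals all_analysis.
From mathcomp Require Import complex.
From mathcomp Require Import zify ring lra.


Set Implicit Arguments.
Unset Strict Implicit.
Unset Printing Implicit Defensive.

Import Order.TTheory GRing.Theory Num.Theory.

Local Open Scope ring_scope.

(** The algorithm is deterministic and tosses no coin. A Hermitian matrix X + iY
    has the same norm sigma as the real symmetric matrix S = [[X, Y^T], [Y, X]].
    If M = 2 ^ (kappa + 1) is at least of order log n / eps, then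
    tr (S ^ M), the squared Frobenius norm of S ^ (M / 2), lies between sigma ^ M
    and dim S * sigma ^ M, so any x with x ^ M equal to the trace up to a factor
    polynomial in n approximates sigma within eps; x is found by bisection. Since
    exponents are unbounded, no normalization is needed between squarings.

    The squarings use a fixed bilinear algorithm of size n0 and rank
    r <= n0 ^ (omega + eta) with real coefficients. On matrices of size n0 ^ L,
    stored with interleaved row and column digits, its L-th Kronecker power is
    evaluated without recursion, one digit at a time, as in a fast Fourier
    transform: each stage replaces the leading digit by a new last digit.
    Entrywise rounding errors grow by a factor polynomial in n per squaring, so
    O(log n log (n / eps)) bits suffice; the program estimates log (1 / eps) by
    doubling eps and reports an error when the precision is below this bound. *)

(** * Total correctness of while programs *)

(** No logarithm is lost to the recursion. The exponent is an infimum, so some tau below omega + eta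
    admits rank O(n ^ tau); at one fixed large size n0 the gap between the two absorbs both the
    implied constant and a factor 4 due to real coefficients. The inequality r <= n0 ^ (omega + eta)
    carries no constant, hence survives Kronecker powers, and padding to n0 ^ L <= 2 n0 ^ 2 n costs
    a constant factor.

    Eigenvalues never appear: for symmetric P, Cauchy-Schwarz shows that the operator norm of P ^ 2
    is the square of that of P, and the Frobenius norm lies between the operator norm and sqrt (dim
    P) times it.

    One integer test decides between answer and error. With j doublings of eps and kappa = j + L +
    O(1), each error is u times a power of 2 with exponent O(kappa L). Passing c3 (kappa + 1) (L +
    1) <= p thus gives accuracy, and failing it puts p below the promised bound. At n = 1 that bound
    vanishes with ln n; K is chosen so that the probability claim is trivial there. *)

Fixpoint mods {R : Type} (c : cmd R) : seq nat :=
  match c with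
  | CSeq c1 c2 | CIf _ c1 c2 => mods c1 ++ mods c2
  | CWhile _ c1 => mods c1
  | CSet x _ | CFlip x | CLe x _ _ => [:: x]
  | _ => [::]
  end.

Fixpoint noflip {R : Type} (c : cmd R) : bool :=
  match c with
  | CSeq c1 c2 | CIf _ c1 c2 => noflip c1 && noflip c2
  | CWhile _ c1 => noflip c1
  | CFlip _ => false
  | _ => true
  end.

(** Subtraction is truncated, so the guard is nonzero exactly while the counter is below [e]. The
    bound [e] is evaluated again at each pass. *)
Definition cfor {R : Type} (x : nat) (e : iexpr) (body : cmd R) : cmd R :=
  CSeq (CSet _ x (IConst 0))
    (CWhile (ISub e (IReg x))
       (CSeq body (CSet _ x (IAdd (IReg x) (IConst 1))))).

Section Wp.
Context {R : realType} (F : fp_arith R) (W : nat) (tape : nat -> bool).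
Local Open Scope nat_scope.
Implicit Types (c : cmd R) (s : state R) (Q : state R -> Prop).

Definition runs c s s' := exists fuel, exec F W tape fuel c s = Some s'.

Lemma exec_mono f f' c s s' : f <= f' ->
  exec F W tape f c s = Some s' -> exec F W tape f' c s = Some s'.
Proof.
elim: f f' c s s' => [|f IH] [|f'] // c [r m k t] s' /= ff'.
case: c => //= [c1 c2|e c1 c2|e c1].
- case E: (exec _ _ _ f c1 _) => [s1|] //= E2.
  by rewrite (IH _ _ _ _ ff' E) /=; exact: IH E2.
- by move=> E; exact: IH E.
- case: ifP => // _; case E: (exec _ _ _ f c1 _) => [s1|] //= E2.
  by rewrite (IH _ _ _ _ ff' E) /=; exact: IH E2.
Qed.

(** Turns the single run exhibited by [wp] below into a fact about every halting run, as the error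
    alternative of the theorem requires. *)
Lemma runs_det c s s1 s2 : runs c s s1 -> runs c s s2 -> s1 = s2.
Proof.
move=> [f1 E1] [f2 E2].
have := exec_mono (leq_maxl f1 f2) E1.
by rewrite (exec_mono (leq_maxr f1 f2) E2) => -[].
Qed.

Lemma runs_noflip c s s' : noflip c -> runs c s s' -> flips s' = flips s.
Proof.
move=> nf [f]; elim: f c s s' nf => [|f IH] // c [r m k t] s'.
case: c => //=.
- by move=> _ [<-].
- move=> c1 c2 /andP[n1 n2].
  case E: (exec _ _ _ f c1 _) => [s1|] //= E2.
  by rewrite (IH _ _ _ n2 E2) (IH _ _ _ n1 E).
- by move=> e c1 c2 /andP[n1 n2]; case: ifP => _ E; rewrite (IH _ _ _ _ E).
- move=> e c1 n1; case: ifP => _; last by move=> [<-].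
  case E: (exec _ _ _ f c1 _) => [s1|] //= E2.
  by rewrite (IH _ _ _ _ E2)// (IH _ _ _ n1 E).
- by move=> x e _ [<-].
- by move=> x e e' _ [<-].
- by move=> x e _ [<-].
- by move=> x e _ [<-].
- by move=> o x e e' _ [<-].
Qed.

Lemma runs_mods c s s' x : x \notin mods c -> runs c s s' ->
  regs s' x = regs s x.
Proof.
move=> nx [f]; elim: f c s s' nx => [|f IH] // c [r m k t] s'.
have updx (z : nat) v : x \notin [:: z] -> upd r z v x = r x.
  by rewrite inE /upd => /negbTE->.
case: c => //=.
- by move=> _ [<-].
- move=> c1 c2; rewrite mem_cat negb_or => /andP[n1 n2].
  case E: (exec _ _ _ f c1 _) => [s1|] //= E2.
  by rewrite (IH _ _ _ n2 E2) (IH _ _ _ n1 E).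
- move=> e c1 c2; rewrite mem_cat negb_or => /andP[n1 n2].
  by case: ifP => _ E; rewrite (IH _ _ _ _ E).
- move=> e c1 n1; case: ifP => _; last by move=> [<-].
  case E: (exec _ _ _ f c1 _) => [s1|] //= E2.
  by rewrite (IH _ _ _ _ E2)// (IH _ _ _ n1 E).
- by move=> z e /updx H [<-] /=.
- by move=> z /updx H [<-] /=.
- by move=> z e e' /updx H [<-] /=.
- by move=> z e _ [<-].
- by move=> z e _ [<-].
- by move=> o z e e' _ [<-].
Qed.

Definition wp c s Q := exists2 s', runs c s s' & Q s'.

Definition setr s x v := State (upd (regs s) x v) (cells s) (flips s) (flops s).

Definition setc s a v d :=
  State (regs s) (upd (cells s) a v) (flips s) (flops s + d).

Definition frame (l : seq nat) s s' :=
  forall y, y \notin l -> regs s' y = regs s y.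

Lemma notin_sub (l l' : seq nat) y :
  all (mem l') l -> y \notin l' -> y \notin l.
Proof. by move=> /allP ll'; apply: contra => /ll'. Qed.

(** The frame is read off the syntax, so specifications and invariants need not carry the unmodified
    registers. *)
Lemma wp_conseq c s Q Q' :
  (forall s', frame (mods c) s s' -> Q s' -> Q' s') -> wp c s Q -> wp c s Q'.
Proof.
move=> H [s' rs' Qs']; exists s' => //; apply: H => // y ny.
exact: runs_mods ny rs'.
Qed.

Lemma wp_seq c1 c2 s Q : wp c1 s (fun s1 => wp c2 s1 Q) -> wp (CSeq c1 c2) s Q.
Proof.
move=> [s1 [f1 E1] [s2 [f2 E2] Q2]]; exists s2 => //.
exists (maxn f1 f2).+1; case: s E1 => r m k t E1 /=.
rewrite (exec_mono (leq_maxl f1 f2) E1) /=.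
exact: exec_mono (leq_maxr f1 f2) E2.
Qed.

Lemma wp_skip s Q : Q s -> wp CSkip s Q.
Proof. by move=> Qs; exists s => //; exists 1; case: (s). Qed.

Lemma wp_if e c1 c2 s Q :
  wp (if ieval W (regs s) e != 0 then c1 else c2) s Q -> wp (CIf e c1 c2) s Q.
Proof. by case: s => r m k t [s' [f E] Qs']; exists s' => //; exists f.+1. Qed.

Lemma wp_set x e s Q :
  Q (setr s x (ieval W (regs s) e)) -> wp (CSet R x e) s Q.
Proof. by case: s => r m k t H; eexists; [exists 1|exact: H]. Qed.

Lemma wp_le x a b s Q :
  Q (State (upd (regs s) x (cells s (ieval W (regs s) a)
                            <= cells s (ieval W (regs s) b))%R)
       (cells s) (flips s) (flops s + 1)) ->
  wp (CLe R x a b) s Q.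
Proof.
by rewrite addn1; case: s => r m k t H; eexists; [exists 1|exact: H].
Qed.

Lemma wp_copy d a s Q :
  Q (setc s (ieval W (regs s) d) (cells s (ieval W (regs s) a)) 0) ->
  wp (CCopy R d a) s Q.
Proof.
by rewrite /setc addn0; case: s => r m k t H; eexists; [exists 1|exact: H].
Qed.

Lemma wp_const d v s Q :
  Q (setc s (ieval W (regs s) d) (fl_cst F v) 0) -> wp (CConst d v) s Q.
Proof.
by rewrite /setc addn0; case: s => r m k t H; eexists; [exists 1|exact: H].
Qed.

Lemma wp_op o d a b s Q :
  Q (setc s (ieval W (regs s) d)
       (fl F o (cells s (ieval W (regs s) a)) (cells s (ieval W (regs s) b))) 1) ->
  wp (COp R o d a b) s Q.
Proof.
by rewrite /setc addn1; case: s => r m k t H; eexists; [exists 1|exact: H].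
Qed.

Lemma wp_while e c (I : state R -> Prop) (mu : state R -> nat) s Q :
  I s ->
  (forall s', frame (mods c) s s' -> I s' -> ieval W (regs s') e != 0 ->
     wp c s' (fun s2 => I s2 /\ mu s2 < mu s')) ->
  (forall s', frame (mods c) s s' -> I s' -> ieval W (regs s') e = 0 -> Q s') ->
  wp (CWhile e c) s Q.
Proof.
move=> Is Hc HQ.
suff H m : forall s', frame (mods c) s s' -> I s' -> mu s' < m ->
    wp (CWhile e c) s' Q by exact: (H (mu s).+1).
elim: m => // m IH s' fs' Is' mus'.
have [e0|e1] := eqVneq (ieval W (regs s') e) 0.
  exists s'; last exact: HQ.
  by exists 1; case: s' e0 {Is' fs' mus'} => r mm k t /= ->.
have [s2 rs2 [Is2 mu2]] := Hc _ fs' Is' e1.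
have fs2 : frame (mods c) s s2.
  by move=> y ny; rewrite (runs_mods ny rs2) fs'.
have [s3 [f3 E3] Q3] := IH _ fs2 Is2 (leq_trans mu2 mus').
case: rs2 => f2 E2; exists s3 => //; exists (maxn f2 f3).+1.
case: s' e1 E2 {fs' Is' mus' mu2} => r mm k t /= -> E2.
rewrite (exec_mono (leq_maxl f2 f3) E2) /=.
exact: exec_mono (leq_maxr f2 f3) E3.
Qed.

(** [N < W] keeps the counter from wrapping around. The invariant must be insensitive to the counter
    register because the increment happens after the body has established it. *)
Lemma wp_for (x : nat) e N (I : nat -> state R -> Prop) body s Q :
  x \notin mods body -> N < W ->
  (forall s', frame (x :: mods body) s s' -> ieval W (regs s') e = N) ->
  (forall i s' v, I i s' -> I i (setr s' x v)) ->
  I 0 s ->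
  (forall i s', i < N -> frame (x :: mods body) s s' -> regs s' x = i ->
     I i s' -> wp body s' (I i.+1)) ->
  (forall s', frame (x :: mods body) s s' -> I N s' -> Q s') ->
  wp (cfor x e body) s Q.
Proof.
move=> nx NW He Hx I0 Hb HQ.
apply: wp_seq; apply: wp_set; rewrite /= mod0n.
pose J s' := [/\ frame (x :: mods body) s s', regs s' x <= N
               & I (regs s' x) s'].
apply: (@wp_while _ _ J (fun s' => N - regs s' x)).
- have E : regs (setr s x 0) x = 0 by rewrite /= /upd eqxx.
  split; rewrite ?E //; last exact: Hx.
  by move=> y; rewrite inE negb_or /= /upd => /andP[/negbTE->].
- move=> s' _ [fs' xN Is'] /=; rewrite He// subn_eq0 -ltnNge => xlt.
  apply: wp_seq; apply: (wp_conseq _ (Hb _ _ xlt fs' erefl Is')) => s2 fs2 I2.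
  apply: wp_set => /=; rewrite modnDmr fs2// modn_small ?addn1; last lia.
  have E v : regs (setr s2 x v) x = v by rewrite /= /upd eqxx.
  rewrite /J !E; split; last by rewrite /upd eqxx; lia.
  split=> //; last exact: Hx.
  move=> y ny; rewrite /= /upd; case: eqP => [yx|_].
    by move: ny; rewrite inE yx eqxx.
  by rewrite fs2 ?fs'//; move: ny; rewrite inE negb_or => /andP[].
- move=> s' _ [fs' xN Is'] /=; rewrite He// => /eqP xN0.
  have xe : regs s' x = N by lia.
  by rewrite xe in Is'; exact: HQ.
Qed.

End Wp.

(** * Memory split into regions *)

(* Register 6 holds the region size [G]; region [c] occupies the cells
   [c * G, ..., c * G + G - 1], and region 0 contains the input. *)
Definition adr (c : nat) (e : iexpr) : iexpr :=
  IAdd (IMul (IConst c) (IReg 6)) e.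

Definition ccopy {R : Type} (dst src : nat) (e : iexpr) : cmd R :=
  cfor 24 e (CCopy R (adr dst (IReg 24)) (adr src (IReg 24))).

Section Regions.
Context {R : realType} (F : fp_arith R) (W : nat) (tape : nat -> bool).
Local Open Scope nat_scope.
Variable G : nat.
Hypotheses (G_gt0 : 0 < G) (GW : 32 * G <= W).
Implicit Types (s : state R) (Q : state R -> Prop).
Notation wp := (wp F W tape).

Definition rd s c i := cells s (c * G + i).
Definition wr s c i v d := setc s (c * G + i) v d.

(** Regions do not overlap: Euclidean division by [G] recovers [c] and [i] from the address. *)
Lemma rd_wr s c i v d c' i' : i < G -> i' < G ->
  rd (wr s c i v d) c' i' = if (c' == c) && (i' == i) then v else rd s c' i'.
Proof.
move=> iG i'G; rewrite /rd /= /upd; congr (if _ then _ else _).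
apply/eqP/andP => [E|[/eqP-> /eqP->]//].
have H a b : b < G -> ((a * G + b) %/ G = a) * ((a * G + b) %% G = b).
  by move=> bG; rewrite divnMDl// divn_small// addn0 modnMDl modn_small.
split; apply/eqP; first by rewrite -(H c i iG).1 -(H c' i' i'G).1 E.
by rewrite -(H c i iG).2 -(H c' i' i'G).2 E.
Qed.

Lemma rd_setr s x v c i : rd (setr s x v) c i = rd s c i.
Proof. by []. Qed.

(** With at most 32 regions, [c * G + i] stays below [32 * G <= W], so the address arithmetic never
    wraps. *)
Lemma ieval_adr r c e i : r 6 = G -> c < 32 -> ieval W r e = i -> i < G ->
  ieval W r (adr c e) = c * G + i.
Proof.
move=> r6 c32 /= -> iG; rewrite r6 modnMml modnDml modn_small//.
have : c.+1 * G <= 32 * G by rewrite leq_mul2r c32 orbT.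
by rewrite mulSn; lia.
Qed.

Lemma wpr_op o c1 e1 i1 c2 e2 i2 c3 e3 i3 s Q :
  regs s 6 = G -> [&& c1 < 32, c2 < 32 & c3 < 32] ->
  ieval W (regs s) e1 = i1 -> ieval W (regs s) e2 = i2 ->
  ieval W (regs s) e3 = i3 -> i1 < G -> i2 < G -> i3 < G ->
  Q (wr s c1 i1 (fl F o (rd s c2 i2) (rd s c3 i3)) 1) ->
  wp (COp R o (adr c1 e1) (adr c2 e2) (adr c3 e3)) s Q.
Proof.
move=> s6 /and3P[h1 h2 h3] E1 E2 E3 l1 l2 l3 H; apply: wp_op.
by rewrite (ieval_adr s6 h1 E1)// (ieval_adr s6 h2 E2)// (ieval_adr s6 h3 E3).
Qed.

Lemma wpr_copy c1 e1 i1 c2 e2 i2 s Q :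
  regs s 6 = G -> (c1 < 32) && (c2 < 32) ->
  ieval W (regs s) e1 = i1 -> ieval W (regs s) e2 = i2 -> i1 < G -> i2 < G ->
  Q (wr s c1 i1 (rd s c2 i2) 0) ->
  wp (CCopy R (adr c1 e1) (adr c2 e2)) s Q.
Proof.
move=> s6 /andP[h1 h2] E1 E2 l1 l2 H; apply: wp_copy.
by rewrite (ieval_adr s6 h1 E1)// (ieval_adr s6 h2 E2).
Qed.

Lemma wpr_const c1 e1 i1 v s Q :
  regs s 6 = G -> c1 < 32 -> ieval W (regs s) e1 = i1 -> i1 < G ->
  Q (wr s c1 i1 (fl_cst F v) 0) -> wp (CConst (adr c1 e1) v) s Q.
Proof.
by move=> s6 h1 E1 l1 H; apply: wp_const; rewrite (ieval_adr s6 h1 E1).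
Qed.

Lemma wpr_le x c1 e1 i1 c2 e2 i2 s Q :
  regs s 6 = G -> (c1 < 32) && (c2 < 32) ->
  ieval W (regs s) e1 = i1 -> ieval W (regs s) e2 = i2 -> i1 < G -> i2 < G ->
  Q (State (upd (regs s) x (rd s c1 i1 <= rd s c2 i2)%R)
       (cells s) (flips s) (flops s + 1)) ->
  wp (CLe R x (adr c1 e1) (adr c2 e2)) s Q.
Proof.
move=> s6 /andP[h1 h2] E1 E2 l1 l2 H; apply: wp_le.
by rewrite (ieval_adr s6 h1 E1)// (ieval_adr s6 h2 E2).
Qed.

Lemma ieval_reg r x : ieval W r (IReg x) = r x. Proof. by []. Qed.

Lemma ieval0 r : ieval W r (IConst 0) = 0. Proof. exact: mod0n. Qed.

Lemma ltn_word n : n <= 31 * G -> n < W.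
Proof. by move: G_gt0 GW; lia. Qed.

Lemma ieval_cst r n : n <= 31 * G -> ieval W r (IConst n) = n.
Proof. by move=> /ltn_word nW; rewrite /= modn_small. Qed.

Definition same (l : seq nat) s s' :=
  forall c i, i < G -> c \notin l -> rd s' c i = rd s c i.

Lemma wp_ccopy dst src y N s Q :
  regs s 6 = G -> (dst < 32) && (src < 32) && (dst != src) -> y != 24 ->
  regs s y = N -> N <= G ->
  (forall s', frame [:: 24] s s' -> same [:: dst] s s' ->
     (forall i, i < N -> rd s' dst i = rd s src i) -> flops s' = flops s ->
     Q s') ->
  wp (ccopy dst src (IReg y)) s Q.
Proof.
move=> s6 /andP[/andP[hd hs] dns] y24 sy NG HQ.
pose I i s' := [/\ same [:: dst] s s',
  forall k, k < i -> rd s' dst k = rd s src k & flops s' = flops s].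
apply: (@wp_for _ _ _ _ _ _ N I) => //.
- by apply: ltn_word; lia.
- by move=> s' fs'; rewrite ieval_reg fs' ?inE.
- move=> i s' iN fs' s'x [sm vs fl].
  have iG : i < G by lia.
  have s6' : regs s' 6 = G by rewrite fs'.
  apply: (@wpr_copy _ _ i _ _ i); rewrite ?ieval_reg ?hd//.
  split=> [c k kG|k ki|].
  + by move=> cd; rewrite rd_wr//; move: (cd); rewrite inE => /negbTE->; exact: sm.
  + rewrite rd_wr ?eqxx//=; last lia.
    case: eqP => [->|ne]; last by apply: vs; lia.
    by rewrite sm// inE eq_sym.
  + by rewrite /= addn0.
- by move=> s' fs' [sm vs fl]; exact: HQ.
Qed.

End Regions.

(** * Floating point sums, Kronecker stages and bisection *)

Section FloatFunctions.
Context {R : realType} (F : fp_arith R).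
Local Open Scope nat_scope.

(** The functions of this section repeat the programs operation by operation, in the same order.
    They separate the rounding analysis from the reasoning on machine states. *)
Fixpoint fdot (a b : nat -> R) (D : nat) : R :=
  if D is d.+1 then fl F FAdd (fdot a b d) (fl F FMul (a d) (b d))
  else fl_cst F 0.

(** The input index is [d * I + x], with [d] the leading digit in base [D]; the output index is
    [x * D' + d']. The leading digit is contracted against row [d'] of the table, and the new digit
    becomes the last one. *)
Definition fstage (tab : nat -> R) (D D' I : nat) (v : nat -> R) (k : nat) : R :=
  fdot (fun d => tab ((k %% D') * D + d)) (fun d => v (d * I + k %/ D')) D.

Fixpoint fstages (tab : nat -> R) (D D' L t : nat) (v : nat -> R) : nat -> R :=
  if t is t'.+1 then
    fstage tab D D' (D ^ (L - t'.+1) * D' ^ t') (fstages tab D D' L t' v)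
  else v.

Lemma eq_fdot a a' b b' D : (forall d, d < D -> a d = a' d) ->
  (forall d, d < D -> b d = b' d) -> fdot a b D = fdot a' b' D.
Proof.
elim: D => //= D IH Ha Hb; rewrite Ha// Hb// IH// => d dD.
  by apply: Ha; lia.
by apply: Hb; lia.
Qed.

Lemma stage_index d D D' I k : 0 < D' -> d < D -> k < I * D' ->
  d * I + k %/ D' < D * I.
Proof.
move=> D'0 dD kI; have : k %/ D' < I by rewrite ltn_divLR.
have : d.+1 * I <= D * I by rewrite leq_mul2r dD orbT.
by rewrite mulSn; lia.
Qed.

Lemma tab_index d D D' k : 0 < D' -> d < D -> k %% D' * D + d < D * D'.
Proof.
move=> D'0 dD; have H := ltn_pmod k D'0.
have : (k %% D').+1 * D <= D' * D by rewrite leq_mul2r H orbT.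
by rewrite mulSn (mulnC D D'); lia.
Qed.

Lemma eq_fstage tab tab' D D' I v v' k : 0 < D' ->
  (forall x, x < D * D' -> tab x = tab' x) ->
  (forall x, x < D * I -> v x = v' x) -> k < I * D' ->
  fstage tab D D' I v k = fstage tab' D D' I v' k.
Proof.
move=> D'0 Ht Hv kI; apply: eq_fdot => d dD.
  exact/Ht/tab_index.
exact/Hv/stage_index.
Qed.

Lemma stage_size (D D' L t : nat) : t < L ->
  D * (D ^ (L - t.+1) * D' ^ t) = D ^ (L - t) * D' ^ t.
Proof. by move=> tL; rewrite mulnA -expnS subnSK. Qed.

Lemma eq_fstages tab tab' D D' L t v v' k : 0 < D' -> t <= L ->
  (forall x, x < D * D' -> tab x = tab' x) ->
  (forall x, x < D ^ L -> v x = v' x) -> k < D ^ (L - t) * D' ^ t ->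
  fstages tab D D' L t v k = fstages tab' D D' L t v' k.
Proof.
move=> D'0 + Ht Hv; elim: t k => [|t IH] k tL.
  by rewrite subn0 muln1; exact: Hv.
move=> kI; apply: eq_fstage => //; last by rewrite -mulnA -expnSr.
by move=> x; rewrite stage_size// => xI; apply: IH => //; lia.
Qed.

Definition fmm (tU tV tW : nat -> R) (q r L : nat) (a : nat -> R) : nat -> R :=
  fstages tW r q L L
    (fun l => fl F FMul (fstages tU q r L L a l) (fstages tV q r L L a l)).

(** A comparison with the stored zero chooses between addition and subtraction, since the machine
    has no absolute value. *)
Fixpoint fabs (a : nat -> R) (D : nat) : R :=
  if D is d.+1 then
    fl F (if (fl_cst F 0 <= a d)%R then FAdd else FSub) (fabs a d) (a d)
  else fl_cst F 0.

Definition fsq (k : nat) (x : R) : R := iter k (fun y => fl F FMul y y) x.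

(** The pair consists of the last accepted point and the current step. The sought value stays, up to
    errors, below the accepted point plus twice the step. *)
Definition fbis (k : nat) (T half d0 : R) (i : nat) : R * R :=
  iter i (fun ld => let x := fl F FAdd ld.1 ld.2 in
    (if (fsq k x <= T)%R then x else ld.1, fl F FMul ld.2 half))
    (fl_cst F 0, d0).

Lemma eq_fmm tU tU' tV tV' tW tW' q r L a a' z : 0 < q -> 0 < r ->
  (forall x, x < q * r -> tU x = tU' x) ->
  (forall x, x < q * r -> tV x = tV' x) ->
  (forall x, x < q * r -> tW x = tW' x) ->
  (forall x, x < q ^ L -> a x = a' x) -> z < q ^ L ->
  fmm tU tV tW q r L a z = fmm tU' tV' tW' q r L a' z.
Proof.
move=> q0 r0 HU HV HW Ha zq; apply: eq_fstages => //.
- by move=> x; rewrite mulnC; exact: HW.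
- move=> l lr; congr (fl _ _ _ _);
    by apply: eq_fstages => //; rewrite subnn mul1n.
- by rewrite subnn mul1n.
Qed.

Lemma eq_fabs a a' D : (forall d, d < D -> a d = a' d) ->
  fabs a D = fabs a' D.
Proof.
by elim: D => //= D IH Ha; rewrite Ha// IH// => d dD; apply: Ha; lia.
Qed.

End FloatFunctions.

(** * Programs for the Kronecker stages and for squaring a matrix *)

(** Register 12 is the output index, 13 the contracted digit and 14 the block size [I]. Region 12
    collects the output, and cell 0 of region 13 holds the current product. *)
Definition cdot {R : realType} (P tab D D' : nat) : cmd R :=
  CSeq (CConst (adr 12 (IReg 12)) 0)
    (cfor 13 (IConst D)
      (CSeq (COp R FMul (adr 13 (IConst 0))
               (adr tab (IAdd (IMul (IMod (IReg 12) (IConst D')) (IConst D)) (IReg 13)))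
               (adr P (IAdd (IMul (IReg 13) (IReg 14)) (IDiv (IReg 12) (IConst D')))))
            (COp R FAdd (adr 12 (IReg 12)) (adr 12 (IReg 12)) (adr 13 (IConst 0))))).

(** Register 15 holds the length of the vector: [D * I] on entry, [I * D'] on exit. *)
Definition cstage {R : realType} (P tab D D' : nat) : cmd R :=
  CSeq (CSet R 14 (IDiv (IReg 15) (IConst D)))
    (CSeq (CSet R 15 (IMul (IReg 14) (IConst D')))
      (CSeq (cfor 12 (IReg 15) (cdot P tab D D'))
        (ccopy P 12 (IReg 15)))).

Definition cstages {R : realType} (P tab D D' : nat) (size : nat) : cmd R :=
  CSeq (CSet R 15 (IReg size)) (cfor 11 (IReg 3) (cstage P tab D D')).

(** Register 6 serves both as region size and as the number [r ^ L] of pointwise products; register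
    5 is the number of matrix entries. *)
Definition cmm {R : realType} (q r : nat) : cmd R :=
  CSeq (ccopy 10 7 (IReg 5))
  (CSeq (ccopy 11 7 (IReg 5))
  (CSeq (cstages 10 3 q r 5)
  (CSeq (cstages 11 4 q r 5)
  (CSeq (cfor 16 (IReg 6)
           (COp R FMul (adr 10 (IReg 16)) (adr 10 (IReg 16)) (adr 11 (IReg 16))))
  (CSeq (cstages 10 5 r q 6)
        (ccopy 7 10 (IReg 5))))))).

Section StageSpecs.
Context {R : realType} (F : fp_arith R) (W : nat) (tape : nat -> bool).
Local Open Scope nat_scope.
Variable G : nat.
Hypotheses (G_gt0 : 0 < G) (GW : 32 * G <= W).
Implicit Types (s : state R) (Q : state R -> Prop).
Notation wp := (wp F W tape).
Notation rd := (rd G).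
Notation same := (same G).

Lemma same_trans l1 l2 l s s' s'' : same l1 s s' -> same l2 s' s'' ->
  {subset l1 <= l} -> {subset l2 <= l} -> same l s s''.
Proof.
move=> h1 h2 s1 s2 c i iG cl; rewrite h2// ?h1//.
  by apply: contra cl; exact: s1.
by apply: contra cl; exact: s2.
Qed.

Lemma wp_cdot P tab D D' I k s Q :
  regs s 6 = G -> (P < 32) && (tab < 32) -> [&& P != tab, P != 12, P != 13, tab != 12 & tab != 13] ->
  0 < D -> 0 < D' -> regs s 14 = I -> regs s 12 = k -> k < I * D' ->
  D * I <= G -> I * D' <= G -> D * D' <= G ->
  (forall s', frame [:: 13] s s' ->
     (forall c i, i < G -> c != 13 -> (c != 12) || (i != k) ->
        rd s' c i = rd s c i) ->
     rd s' 12 k = fstage F (rd s tab) D D' I (rd s P) k ->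
     flops s' = flops s + D * 2 -> Q s') ->
  wp (cdot P tab D D') s Q.
Proof.
move=> s6 /andP[hP ht] un D0 D'0 s14 s12 kI DI ID' DD' HQ.
have kG : k < G by lia.
apply: wp_seq; apply: (wpr_const _ G_gt0 GW (i1 := k)) => //.
set s1 := wr _ _ _ _ _ _.
pose J d s' := [/\ forall c i, i < G -> c != 13 -> (c != 12) || (i != k) ->
    rd s' c i = rd s c i,
  rd s' 12 k = fdot F (fun d => rd s tab ((k %% D') * D + d))
                 (fun d => rd s P (d * I + k %/ D')) d
  & flops s' = flops s + d * 2].
have DG : D <= G by rewrite (leq_trans _ DD')// leq_pmulr.
have D'G : D' <= G by rewrite (leq_trans _ DD')// leq_pmull.
apply: (@wp_for _ _ _ _ _ _ D J) => //.
- by apply: (ltn_word G_gt0 GW); lia.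
- by move=> s' _; rewrite (ieval_cst G_gt0 GW)//; lia.
- split; last by rewrite /= addn0.
    move=> c i iG c13 h; rewrite (rd_wr G_gt0)//.
    by case: ifP => // /andP[/eqP c12 /eqP ik]; rewrite c12 ik !eqxx in h.
  by rewrite (rd_wr G_gt0)// !eqxx.
- move=> d s' dD fs' s'13 [sm vs fls].
  have s6' : regs s' 6 = G by rewrite fs'.
  have s12' : regs s' 12 = k by rewrite fs'.
  have s14' : regs s' 14 = I by rewrite fs'.
  have i1 : k %% D' * D + d < G by apply: leq_trans (tab_index _ _ _) DD'.
  have i2 : d * I + k %/ D' < G by apply: leq_trans (stage_index _ _ _) DI.
  have bigW x : x < G -> x < W by move=> xG; apply: (ltn_word G_gt0 GW); lia.
  apply: wp_seq; apply: (wpr_op _ G_gt0 GW (i1 := 0) (i2 := k %% D' * D + d)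
    (i3 := d * I + k %/ D')) => //.
  + by rewrite hP ht.
  + exact: ieval0.
  + rewrite /= s12' s'13 !(@modn_small D' W) ?(@modn_small D W)//.
    * by rewrite modnDml modn_small// bigW.
    * by apply: (ltn_word G_gt0 GW); lia.
    * by apply: (ltn_word G_gt0 GW); lia.
  + rewrite /= s12' s'13 s14' !(@modn_small D' W)//.
      by rewrite modnDml modn_small// bigW.
    by apply: (ltn_word G_gt0 GW); lia.
  move: un => /and5P[Pt P12 P13 t12 t13].
  set v := fl F FMul _ _.
  apply: (wpr_op _ G_gt0 GW (i1 := k) (i2 := k) (i3 := 0)) => //.
    exact: ieval0.
  have E1 : rd (wr G s' 13 0 v 1) 12 k = rd s' 12 k by rewrite (rd_wr G_gt0).
  have E2 : rd (wr G s' 13 0 v 1) 13 0 = v by rewrite (rd_wr G_gt0)// !eqxx.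
  rewrite E1 E2; split.
  + move=> c i iG c13 h; rewrite (rd_wr G_gt0)//; case: ifP => [/andP[/eqP c12 /eqP ik]|_].
      by rewrite c12 ik !eqxx in h.
    by rewrite (rd_wr G_gt0)// (negbTE c13); exact: sm.
  + by rewrite (rd_wr G_gt0)// !eqxx /= vs /v !sm ?t12 ?P12.
  + by rewrite /= fls; lia.
- by move=> s' fs' [sm vs fls]; exact: HQ.
Qed.

Lemma wp_cstage P tab D D' I s Q :
  regs s 6 = G -> (P < 32) && (tab < 32) -> [&& P != tab, P != 12, P != 13, tab != 12 & tab != 13] ->
  0 < D -> 0 < D' -> regs s 15 = D * I ->
  D * I <= G -> I * D' <= G -> D * D' <= G ->
  (forall s', frame [:: 14; 15; 12; 13; 24] s s' ->
     regs s' 15 = I * D' -> same [:: P; 12; 13] s s' ->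
     (forall k, k < I * D' ->
        rd s' P k = fstage F (rd s tab) D D' I (rd s P) k) ->
     flops s' = flops s + I * D' * (D * 2) -> Q s') ->
  wp (cstage P tab D D') s Q.
Proof.
move=> s6 hPt un D0 D'0 s15 DI ID' DD' HQ.
have DG : D <= G by rewrite (leq_trans _ DD')// leq_pmulr.
have D'G : D' <= G by rewrite (leq_trans _ DD')// leq_pmull.
have smW x : x <= G -> x %% W = x.
  by move=> xG; rewrite modn_small//; apply: (ltn_word G_gt0 GW); lia.
apply: wp_seq; apply: wp_set; rewrite /= smW// s15 mulKn//.
apply: wp_seq; apply: wp_set; rewrite [ieval _ _ _]/= !smW//.
set s1 := setr (setr _ _ _) _ _.
have s1r x : x != 14 -> x != 15 -> regs s1 x = regs s x.
  by move=> /negbTE h1 /negbTE h2; rewrite /= /upd h2 h1.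
have E15 : regs s1 15 = I * D' by [].
have E14 : regs s1 14 = I by [].
move: (un) => /and5P[Pt P12 P13 t12 t13].
pose J k s' := [/\ same [:: 12; 13] s s',
  forall k', k' < k -> rd s' 12 k' = fstage F (rd s tab) D D' I (rd s P) k'
  & flops s' = flops s + k * (D * 2)].
apply: wp_seq; apply: (@wp_for _ _ _ _ _ _ (I * D') J) => //.
- by apply: (ltn_word G_gt0 GW); lia.
- by move=> s' fs'; rewrite ieval_reg fs'.
- by split=> //=; rewrite addn0.
- move=> k s' kI fs' s'12 [sm vs fls].
  apply: (@wp_cdot P tab D D' I k) => //; rewrite ?fs'//.
  move=> s2 fs2 sm2 v2 fl2.
  split=> [c i iG|k' kk'|]; last by rewrite fl2 fls; lia.
    rewrite !inE !negb_or => /andP[c12 c13].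
    by rewrite sm2 ?c12// sm// !inE negb_or c12.
  have [->|kk] := eqVneq k' k.
    rewrite v2; apply: eq_fstage => // x xlt; apply: sm; rewrite ?inE ?negb_or ?t12 ?P12//; lia.
  rewrite sm2 ?kk ?orbT//; last lia.
  by apply: vs; lia.
- move=> s' fs' [sm vs fls].
  apply: (wp_ccopy _ _ G_gt0 GW (N := I * D')) => //; rewrite ?fs'//.
    by move: hPt => /andP[-> _].
  move=> s2 fs2 sm2 v2 fl2; apply: HQ.
  + move=> y ny; rewrite fs2 ?(notin_sub _ ny)// fs' ?(notin_sub _ ny)//.
    by rewrite s1r//; apply: contra ny => /eqP->.
  + by rewrite fs2 ?fs'.
  + apply: same_trans sm sm2 _ _ => x; rewrite !inE.
      by move=> /orP[]->; rewrite !orbT.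
    by move=> ->.
  + by move=> k kI; rewrite v2// vs.
  + by rewrite fl2 fls.
Qed.

Lemma wp_cstages P tab D D' L size s Q :
  regs s 6 = G -> (P < 32) && (tab < 32) -> [&& P != tab, P != 12, P != 13, tab != 12 & tab != 13] ->
  0 < D -> 0 < D' -> L <= G -> regs s 3 = L -> regs s size = D ^ L ->
  D * D' <= G -> (forall t, t <= L -> D ^ (L - t) * D' ^ t <= G) ->
  (forall s', frame [:: 11; 14; 15; 12; 13; 24] s s' ->
     same [:: P; 12; 13] s s' ->
     (forall k, k < D' ^ L ->
        rd s' P k = fstages F (rd s tab) D D' L L (rd s P) k) ->
     flops s' <= flops s + L * (G * (D * 2)) -> Q s') ->
  wp (cstages P tab D D' size) s Q.
Proof.
move=> s6 hPt un D0 D'0 LG s3 ssz DD' szG HQ.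
apply: wp_seq; apply: wp_set; rewrite ieval_reg ssz.
set s1 := setr _ _ _.
have s1r x : x != 15 -> regs s1 x = regs s x.
  by move=> /negbTE h2; rewrite /= /upd h2.
move: (un) => /and5P[Pt P12 P13 t12 t13].
pose J t s' := [/\ same [:: P; 12; 13] s s',
  forall k, k < D ^ (L - t) * D' ^ t ->
    rd s' P k = fstages F (rd s tab) D D' L t (rd s P) k,
  regs s' 15 = D ^ (L - t) * D' ^ t
  & flops s' <= flops s + t * (G * (D * 2))].
apply: (@wp_for _ _ _ _ _ _ L J) => //.
- by apply: (ltn_word G_gt0 GW); lia.
- by move=> s' fs'; rewrite ieval_reg fs'.
- by split=> //=; rewrite ?subn0 ?muln1 // addn0.
- move=> t s' tL fs' s'11 [sm vs sz fls].
  have Ht1 : D ^ (L - t.+1) * D' ^ t * D' = D ^ (L - t.+1) * D' ^ t.+1.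
    by rewrite -mulnA -expnSr.
  apply: (@wp_cstage P tab D D' (D ^ (L - t.+1) * D' ^ t)) => //.
  + by rewrite fs'.
  + by rewrite sz stage_size.
  + by rewrite stage_size// szG// ltnW.
  + by rewrite Ht1 szG.
  move=> s2 fs2 s2sz sm2 v2 fl2; rewrite Ht1 in s2sz v2 fl2; split=> //.
  + exact: (same_trans sm sm2).
  + move=> k kI; rewrite v2//; apply: eq_fstage => //.
    * by move=> x xlt; apply: sm; [lia|rewrite !inE !negb_or eq_sym Pt t12].
    * by move=> x; rewrite stage_size//; exact: vs.
    * by rewrite Ht1.
  + rewrite fl2 mulSn; have := szG _ tL.
    by rewrite -(leq_pmul2r (_ : 0 < D * 2)) ?muln_gt0 ?D0//; lia.
- move=> s' fs' [sm vs sz fls]; apply: HQ => //.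
  + move=> y ny; rewrite fs' ?(notin_sub _ ny)// s1r//.
    by apply: contra ny => /eqP->.
  + by rewrite subnn mul1n in vs.
Qed.

Lemma wp_cmm q r L s Q :
  regs s 6 = G -> 0 < q -> q <= r -> 1 < L -> L <= G -> regs s 3 = L ->
  regs s 5 = q ^ L -> G = r ^ L ->
  (forall s', frame (mods (@cmm R q r)) s s' ->
     same [:: 7; 10; 11; 12; 13] s s' ->
     (forall z, z < q ^ L ->
        rd s' 7 z = fmm F (rd s 3) (rd s 4) (rd s 5) q r L (rd s 7) z) ->
     flops s' <= flops s + 7 * (L * (r * G)) -> Q s') ->
  wp (cmm q r) s Q.
Proof.
move=> s6 q0 qr L1 LG s3 s5 Gr HQ.
have r0 : 0 < r by lia.
have qG : q ^ L <= G by rewrite Gr leq_exp2r//; lia.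
(* The coefficient tables have [q * r] cells; they fit into a region of size [r ^ L] because
   [1 < L]. *)
have qrG : q * r <= G.
  rewrite Gr (leq_trans (_ : _ <= r ^ 2))//; first by rewrite expnS leq_mul.
  exact: leq_pexp2l.
have sz1 t : t <= L -> q ^ (L - t) * r ^ t <= G.
  move=> tL; rewrite Gr -[in leqRHS](subnK tL) expnD leq_mul2r.
  by case: (L - t) => [|m]; rewrite ?orbT// leq_exp2r// qr orbT.
have sz2 t : t <= L -> r ^ (L - t) * q ^ t <= G.
  move=> tL; rewrite Gr -[in leqRHS](subnK tL) expnD leq_mul2l.
  by case: t {tL} => [|t]; rewrite ?orbT// leq_exp2r// qr orbT.
(* Postponing the frame to the end lets [wp_conseq] supply it once for the whole program. *)
set Q' := (fun s' : state R => frame (mods (@cmm R q r)) s s' -> Q s').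
suff H : wp (cmm q r) s Q' by apply: (wp_conseq _ H) => s' fs'; exact.
apply: wp_seq; apply: (wp_ccopy _ _ G_gt0 GW (N := q ^ L)) => // s1 f1 m1 v1 l1.
apply: wp_seq; apply: (wp_ccopy _ _ G_gt0 GW (N := q ^ L)); rewrite ?f1//.
move=> s2 f2 m2 v2 l2.
have {}f2 : frame [:: 24] s s2 by move=> y ny; rewrite f2// f1.
apply: wp_seq; apply: (@wp_cstages 10 3 q r L); rewrite ?f2//.
move=> s3' f3 m3 v3 l3.
have {}f3 : frame [:: 11; 14; 15; 12; 13; 24] s s3'.
  by move=> y ny; rewrite f3// f2// (notin_sub _ ny).
apply: wp_seq; apply: (@wp_cstages 11 4 q r L); rewrite ?f3//.
move=> s4 f4 m4 v4 l4.
have {}f4 : frame [:: 11; 14; 15; 12; 13; 24] s s4.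
  by move=> y ny; rewrite f4// f3.
have E10 l : l < G -> rd s4 10 l = fstages F (rd s 3) q r L L (rd s 7) l.
  move=> lG; rewrite m4// v3 -?Gr//; apply: eq_fstages => //.
  - by move=> x xq; rewrite m2 ?m1//; lia.
  - by move=> x xq; rewrite m2 ?v1//; lia.
  - by rewrite subnn mul1n -Gr.
have E11 l : l < G -> rd s4 11 l = fstages F (rd s 4) q r L L (rd s 7) l.
  move=> lG; rewrite v4 -?Gr//; apply: eq_fstages => //.
  - by move=> x xq; rewrite m3 ?m2 ?m1//; lia.
  - by move=> x xq; rewrite m3 ?v2 ?m1//; lia.
  - by rewrite subnn mul1n -Gr.
pose J k s' := [/\ same [:: 10] s4 s',
  forall l, l < G -> rd s' 10 l =
    if l < k then fl F FMul (rd s4 10 l) (rd s4 11 l) else rd s4 10 l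
  & flops s' = flops s4 + k].
apply: wp_seq; apply: (@wp_for _ _ _ _ _ _ G J) => //.
- by apply: (ltn_word G_gt0 GW); lia.
- by move=> s' fs'; rewrite ieval_reg fs' ?f4.
- by split; rewrite ?addn0.
- move=> k s' kG fs' s'16 [sm vs fls].
  have s6' : regs s' 6 = G by rewrite fs' ?f4.
  apply: (wpr_op _ G_gt0 GW (i1 := k) (i2 := k) (i3 := k)) => //.
  split=> [c i iG ci|l lG|].
  + by rewrite (rd_wr G_gt0)//; move: (ci); rewrite inE => /negbTE->; exact: sm.
  + rewrite (rd_wr G_gt0)// eqxx /=; case: eqP => [->|/eqP lk].
      by rewrite ltnSn vs// ltnn sm.
    by rewrite vs// [(l < k.+1)%N]ltnS [(l <= k)%N]leq_eqVlt (negbTE lk).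
  + by rewrite /= fls addn1 addnS.
move=> s5' f5 [m5 v5 l5].
have {}f5 y : y \notin [:: 16; 11; 14; 15; 12; 13; 24] -> regs s5' y = regs s y.
  by move=> ny; rewrite f5 ?f4// ?(notin_sub _ ny).
apply: wp_seq; apply: (@wp_cstages 10 5 r q L); rewrite ?f5//.
- by rewrite s6.
- by rewrite mulnC.
move=> s6' f6 m6 v6 l6.
apply: (wp_ccopy _ _ G_gt0 GW (N := q ^ L)); rewrite ?f6 ?f5//.
move=> s7 f7 m7 v7 l7 fr; apply: HQ => //.
- move=> c i iG; rewrite !inE !negb_or => /and5P[c7 c10 c11 c12 c13].
  rewrite m7 ?inE// m6 ?inE ?negb_or ?c10 ?c12//.
  rewrite m5 ?inE// m4 ?inE ?negb_or ?c11 ?c12//.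
  rewrite m3 ?inE ?negb_or ?c10 ?c12// m2 ?inE// m1 ?inE//.
- move=> z zq; rewrite v7// v6//; apply: eq_fstages => //.
  + move=> x xq; have xG : x < G by rewrite (leq_trans xq)// mulnC.
    by rewrite m5// m4// m3// m2// m1.
  + by move=> l; rewrite -Gr => lG; rewrite v5// lG E10// E11.
  + by rewrite subnn mul1n.
(* The three transforms cost at most [2 * (L * (r * G))] each and the pointwise products [G], whence
   the factor 7. *)
- rewrite l7; apply: (leq_trans l6); rewrite l5.
  have h1 : L * (G * (q * 2)) <= 2 * (L * (r * G)).
    rewrite (_ : L * (G * (q * 2)) = 2 * (L * (q * G))); last lia.
    by rewrite leq_mul2l leq_mul2l leq_mul2r qr !orbT.
  have h2 : L * (G * (r * 2)) = 2 * (L * (r * G)) by lia.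
  have h3 : G <= L * (r * G) by rewrite mulnA leq_pmull// muln_gt0 r0; lia.
  by rewrite h2; lia.
Qed.

End StageSpecs.

(** * The program *)

Fixpoint cload {R : Type} (c i : nat) (t : seq R) : cmd R :=
  if t is x :: t' then CSeq (CConst (adr c (IConst i)) x) (cload c i.+1 t')
  else CSkip.

(* The digits of [z] in base [n0 ^ 2] are pairs of digits in base [n0]: those of
   the row and those of the column of the entry stored at [z]. *)
Fixpoint zrow (n0 t z : nat) : nat :=
  if t is t'.+1 then
    (zrow n0 t' z + (z %/ (n0 * n0) ^ t' %% (n0 * n0)) %/ n0 * n0 ^ t')%N
  else 0%N.

Fixpoint zcol (n0 t z : nat) : nat :=
  if t is t'.+1 then
    (zcol n0 t' z + (z %/ (n0 * n0) ^ t' %% (n0 * n0)) %% n0 * n0 ^ t')%N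
  else 0%N.

(* The cell holding the entry [(i, j)] of the real symmetric matrix
   [[X, Y^T], [Y, X]], where X + iY is the input matrix. *)
Definition symadr (n i j : nat) : nat :=
  (if n <= i then
     if n <= j then 1 + 2 * ((i - n) * n + (j - n)) else 2 + 2 * ((i - n) * n + j)
   else
     if n <= j then 2 + 2 * ((j - n) * n + i) else 1 + 2 * (i * n + j))%N.

Definition cdecode {R : Type} (n0 : nat) : cmd R :=
  let dig := IMod (IReg 21) (IConst (n0 * n0)) in
  CSeq (CSet R 18 (IConst 0))
  (CSeq (CSet R 19 (IConst 0))
  (CSeq (CSet R 20 (IConst 1))
  (CSeq (CSet R 21 (IReg 16))
    (cfor 17 (IReg 3)
      (CSeq (CSet R 18 (IAdd (IReg 18) (IMul (IDiv dig (IConst n0)) (IReg 20))))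
      (CSeq (CSet R 19 (IAdd (IReg 19) (IMul (IMod dig (IConst n0)) (IReg 20))))
      (CSeq (CSet R 20 (IMul (IReg 20) (IConst n0)))
            (CSet R 21 (IDiv (IReg 21) (IConst (n0 * n0))))))))))).

Definition csymadr {R : Type} : cmd R :=
  let pos k x y := CSet R 25 (IAdd (IConst k)
                     (IMul (IConst 2) (IAdd (IMul x (IReg 1)) y))) in
  let i := IReg 18 in let j := IReg 19 in let n := IReg 1 in
  CIf (ILe n i)
    (CIf (ILe n j) (pos 1 (ISub i n) (ISub j n)) (pos 2 (ISub i n) j))
    (CIf (ILe n j) (pos 2 (ISub j n) i) (pos 1 i j)).

(** The product of two truncated differences is nonzero exactly when row and column are both below
    [2 * n]; outside this square the matrix is padded with zeros. *)
Definition cinput {R : realType} (n0 : nat) : cmd R :=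
  let twice := IMul (IConst 2) (IReg 1) in
  cfor 16 (IReg 5)
    (CSeq (cdecode n0)
      (CIf (IMul (ISub twice (IReg 18)) (ISub twice (IReg 19)))
        (CSeq csymadr (CCopy R (adr 7 (IReg 16)) (adr 0 (IReg 25))))
        (CConst (adr 7 (IReg 16)) 0))).

Definition cabs {R : realType} : cmd R :=
  let acc := adr 8 (IConst 0) in let x := adr 7 (IReg 16) in
  CSeq (CConst acc 0)
  (CSeq (CConst (adr 9 (IConst 0)) 0)
    (cfor 16 (IReg 5)
      (CSeq (CLe R 9 (adr 9 (IConst 0)) x)
            (CIf (IReg 9) (COp R FAdd acc acc x) (COp R FSub acc acc x))))).

Definition csumsq {R : realType} : cmd R :=
  let acc := adr 14 (IConst 0) in let x := adr 7 (IReg 16) in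
  let tmp := adr 13 (IConst 0) in
  CSeq (CConst acc 0)
    (cfor 16 (IReg 5) (CSeq (COp R FMul tmp x x) (COp R FAdd acc acc tmp))).

(** Register 26 is the number of bisection steps and 27 the number of scalar squarings. Cell 0 holds
    the trace in region 14, the step in region 8, the constant 1/2 in region 6 and the accepted
    point in region 15. *)
Definition cbis {R : realType} : cmd R :=
  let lo := adr 15 (IConst 0) in let d := adr 8 (IConst 0) in
  let x := adr 2 (IConst 0) in let y := adr 13 (IConst 0) in
  CSeq (CConst lo 0)
    (cfor 22 (IReg 26)
      (CSeq (COp R FAdd x lo d)
      (CSeq (CCopy R y x)
      (CSeq (cfor 23 (IReg 27) (COp R FMul y y y))
      (CSeq (CLe R 9 y (adr 14 (IConst 0)))
      (CSeq (CIf (IReg 9) (CCopy R lo x) CSkip)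
            (COp R FMul d d (adr 6 (IConst 0))))))))).

(** Regions 3, 4 and 5 store the coefficient tables and region 7 the current matrix. The sum of
    absolute values, left in region 8 by [cabs], is an upper estimate of the norm and serves as
    initial bisection step. *)
Definition cmain {R : realType} (n0 r : nat) (tU tV tW : seq R) : cmd R :=
  CSeq (cload 3 0 tU)
  (CSeq (cload 4 0 tV)
  (CSeq (cload 5 0 tW)
  (CSeq (CConst (adr 6 (IConst 0)) (1 / 2))
  (CSeq (cinput n0)
  (CSeq cabs
  (CSeq (cfor 10 (IReg 8) (cmm (n0 * n0) r))
  (CSeq csumsq
  (CSeq cbis
        (CCopy R (adr 0 (IConst 0)) (adr 15 (IConst 0))))))))))).

(** Registers 3 to 6 hold [L], [n0 ^ L], [(n0 * n0) ^ L] and [r ^ L]. Starting at [L = 2] leaves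
    room for the tables. *)
Definition csetup {R : Type} (n0 r : nat) : cmd R :=
  CSeq (CSet R 3 (IConst 2))
  (CSeq (CSet R 4 (IConst (n0 ^ 2)))
  (CSeq (CSet R 5 (IConst ((n0 * n0) ^ 2)))
  (CSeq (CSet R 6 (IConst (r ^ 2)))
    (CWhile (ISub (IMul (IConst 2) (IReg 1)) (IReg 4))
      (CSeq (CSet R 3 (IAdd (IReg 3) (IConst 1)))
      (CSeq (CSet R 4 (IMul (IReg 4) (IConst n0)))
      (CSeq (CSet R 5 (IMul (IReg 5) (IConst (n0 * n0))))
            (CSet R 6 (IMul (IReg 6) (IConst r)))))))))).

(** The second factor of the guard caps the doublings at [p], so the loop ends within word range
    even for tiny eps. If the cap is reached, the test in [cnorm] fails as soon as [c3] is
    positive. *)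
Definition clog {R : realType} : cmd R :=
  let one := adr 1 (IConst 0) in let x := adr 2 (IConst 0) in
  CSeq (CConst one 1)
  (CSeq (CCopy R x (adr 0 (IConst 0)))
  (CSeq (CSet R 7 (IConst 0))
  (CSeq (CLe R 9 one x)
    (CWhile (IMul (ISub (IConst 1) (IReg 9)) (ISub (IReg 2) (IReg 7)))
      (CSeq (COp R FAdd x x x)
      (CSeq (CSet R 7 (IAdd (IReg 7) (IConst 1)))
            (CLe R 9 one x))))))).

(** Register 7 is the number j of doublings, 8 is kappa, and 27 is kappa + 1: the squared Frobenius
    norm adds one squaring to the kappa matrix squarings. *)
Definition cnorm {R : realType} (n0 r : nat) (tU tV tW : seq R) (c1 c2 c3 : nat) :
    cmd R :=
  CSeq (csetup n0 r)
  (CSeq clog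
  (CSeq (CSet R 8 (IAdd (IAdd (IReg 7) (IReg 3)) (IConst c1)))
  (CSeq (CSet R 26 (IAdd (IReg 7) (IMul (IConst c2) (IAdd (IReg 3) (IConst 1)))))
  (CSeq (CSet R 27 (IAdd (IReg 8) (IConst 1)))
    (CIf (ILe (IMul (IConst c3) (IMul (IReg 27) (IAdd (IReg 3) (IConst 1))))
              (IReg 2))
      (cmain n0 r tU tV tW) (CSet R 0 (IConst 1))))))).

Lemma zrow_lt n0 t z : (0 < n0)%N -> (zrow n0 t z < n0 ^ t)%N.
Proof.
move=> n00; elim: t => //= t IH; rewrite expnS.
set a := (_ %/ n0)%N; have : (a < n0)%N by rewrite ltn_divLR// ltn_pmod// muln_gt0 n00.
rewrite -(leq_pmul2r (_ : 0 < n0 ^ t)%N) ?expn_gt0 ?n00//.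
by rewrite mulSn; lia.
Qed.

Lemma zcol_lt n0 t z : (0 < n0)%N -> (zcol n0 t z < n0 ^ t)%N.
Proof.
move=> n00; elim: t => //= t IH; rewrite expnS.
set a := (_ %% n0)%N; have : (a < n0)%N by rewrite ltn_pmod.
rewrite -(leq_pmul2r (_ : 0 < n0 ^ t)%N) ?expn_gt0 ?n00//.
by rewrite mulSn; lia.
Qed.

Lemma symadr_lt n i j : (i < 2 * n)%N -> (j < 2 * n)%N ->
  (symadr n i j < 4 * n ^ 2)%N.
Proof.
move=> hi hj; rewrite /symadr.
have H a b c : (a < n)%N -> (b < n)%N -> (c <= 2)%N ->
    (c + 2 * (a * n + b) < 4 * n ^ 2)%N.
  move=> ha hb hc; have : (a.+1 * n <= n * n)%N by rewrite leq_mul2r ha orbT.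
  rewrite mulSn expnS expn1; have : (n <= n * n)%N by rewrite leq_pmulr//; lia.
  by lia.
by have [h1|h1] := leqP n i; have [h2|h2] := leqP n j; apply: H => //; lia.
Qed.

(** * Specifications of the components of the program *)

Section MainSpecs.
Context {R : realType} (F : fp_arith R) (W : nat) (tape : nat -> bool).
Local Open Scope nat_scope.
Variable G : nat.
Hypotheses (G_gt0 : 0 < G) (GW : 32 * G <= W).
Implicit Types (s : state R) (Q : state R -> Prop).
Notation wp := (wp F W tape).
Notation rd := (rd G).
Notation same := (same G).

Lemma wp_cload c i t s Q :
  regs s 6 = G -> c < 32 -> i + size t <= G ->
  (forall s', frame [::] s s' -> flops s' = flops s -> same [:: c] s s' ->
     (forall k, k < i -> rd s' c k = rd s c k) ->
     (forall k, k < size t -> rd s' c (i + k) = fl_cst F (nth 0%R t k)) ->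
     Q s') ->
  wp (cload c i t) s Q.
Proof.
elim: t i s Q => [|x t IH] i s Q s6 c32 szG HQ.
  by apply: wp_skip; exact: HQ.
rewrite /= addnS in szG.
have iG : i < G by lia.
apply: wp_seq; apply: (wpr_const _ G_gt0 GW (i1 := i)) => //.
  by rewrite (ieval_cst G_gt0 GW)//; lia.
apply: IH => // s' f' l' m' v1 v2; apply: HQ => //.
- by rewrite l' /= addn0.
- move=> c' k kG; rewrite inE => cc; rewrite m' ?inE// (rd_wr G_gt0)//.
  by rewrite (negbTE cc).
- move=> k ki; rewrite v1; last lia.
  rewrite (rd_wr G_gt0)//; last lia.
  by rewrite eqxx (ltn_eqF ki).
- move=> [|k] kt; last by rewrite -v2// addSnnS.
  by rewrite addn0 v1// (rd_wr G_gt0)// !eqxx.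
Qed.

Lemma wp_cdecode n0 L z s Q :
  0 < n0 -> L <= G -> (n0 * n0) ^ L <= G -> n0 * n0 <= G ->
  regs s 3 = L -> regs s 16 = z -> z < (n0 * n0) ^ L ->
  (forall s', frame [:: 17; 18; 19; 20; 21] s s' ->
     cells s' = cells s -> flops s' = flops s ->
     regs s' 18 = zrow n0 L z -> regs s' 19 = zcol n0 L z -> Q s') ->
  wp (cdecode n0) s Q.
Proof.
move=> n00 LG qLG qG s3 s16 zq HQ.
set q := n0 * n0 in zq qLG qG *.
have q0 : 0 < q by rewrite muln_gt0 n00.
have n0q : n0 <= q by rewrite leq_pmulr.
have smW x : x <= G -> x %% W = x.
  by move=> xG; rewrite modn_small//; apply: (ltn_word G_gt0 GW); lia.
do 4 (apply: wp_seq; apply: wp_set).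
set s1 := setr _ 21 _.
pose J t s' := [/\ cells s' = cells s, flops s' = flops s,
  regs s' 18 = zrow n0 t z, regs s' 19 = zcol n0 t z
  & regs s' 20 = n0 ^ t /\ regs s' 21 = z %/ q ^ t].
have nL t : t <= L -> n0 ^ t <= G.
  move=> tL; rewrite (leq_trans _ qLG)// (leq_trans (leq_pexp2l n00 tL))//.
  by rewrite /q expnMn leq_pmull// expn_gt0 n00.
have rowlt t := zrow_lt t z n00; have collt t := zcol_lt t z n00.
apply: (@wp_for _ _ _ _ _ _ L J) => //.
- by apply: (ltn_word G_gt0 GW); lia.
- by move=> s' fs'; rewrite ieval_reg fs'.
- have zW : 1 %% W = 1 by apply: smW.
  by split; rewrite // /s1 /= /upd /= ?mod0n// ?zW s16 divn1.
- move=> t s' tL fs' s'17 [cs fls r18 r19 [r20 r21]].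
  have rl := rowlt t.+1; have cl := collt t.+1; rewrite /= in rl cl.
  have nLt := nL _ tL; have h18 := leq_trans rl nLt; have h19 := leq_trans cl nLt.
  apply: wp_seq; apply: wp_set; apply: wp_seq; apply: wp_set.
  apply: wp_seq; apply: wp_set; apply: wp_set.
  rewrite /J /= /upd /= -/q.
  rewrite !(@smW q)// !(@smW n0) ?r18 ?r19 ?r20 ?r21; last lia.
  rewrite !modnDmr (smW _ (ltnW h18)) (smW _ (ltnW h19)) -expnSr (smW _ nLt).
  by split=> //; split=> //; rewrite -divnMA -expnSr.
- move=> s' fs' [cs fls r18 r19 _]; apply: HQ => //.
  move=> y ny; rewrite fs' ?(notin_sub _ ny)//.
  move: ny; rewrite /= /upd !inE !negb_or => /and5P[_ h1 h2 h3 h4].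
  by rewrite (negbTE h1) (negbTE h2) (negbTE h3) (negbTE h4).
Qed.

Lemma wp_csymadr n i j s Q :
  regs s 1 = n -> regs s 18 = i -> regs s 19 = j -> i < 2 * n -> j < 2 * n ->
  4 * n ^ 2 <= G ->
  Q (setr s 25 (symadr n i j)) -> wp csymadr s Q.
Proof.
move=> s1 s18 s19 hi hj nG HQ.
have hlt : symadr n i j < W.
  by apply: (ltn_word G_gt0 GW); have := symadr_lt hi hj; lia.
have n0 : 0 < n by lia.
have nn : n <= n ^ 2 by rewrite expnS expn1 leq_pmulr.
have cW x : x <= 2 -> x %% W = x.
  by move=> hx; rewrite modn_small//; apply: (ltn_word G_gt0 GW); lia.
move: HQ hlt; rewrite /symadr /csymadr => HQ hlt.
apply: wp_if; rewrite /= s1 s18; move: HQ hlt; case: (leqP n i) => h1 HQ hlt;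
  apply: wp_if; rewrite /= s1 s19; move: HQ hlt; case: (leqP n j) => h2 HQ hlt;
  apply: wp_set; rewrite /= s1 s18 s19 ?(cW 1)// ?(cW 2)// modnDml modnMmr modnDmr;
  by rewrite modn_small.
Qed.

Lemma wp_cinput n0 n L s Q :
  regs s 6 = G -> regs s 1 = n -> regs s 3 = L ->
  regs s 5 = (n0 * n0) ^ L -> 0 < n0 ->
  L <= G -> (n0 * n0) ^ L <= G -> n0 * n0 <= G -> 4 * n ^ 2 <= G ->
  (forall s', frame (mods (@cinput R n0)) s s' -> same [:: 7] s s' ->
     (forall z, z < (n0 * n0) ^ L ->
        rd s' 7 z = if (zrow n0 L z < 2 * n) && (zcol n0 L z < 2 * n)
          then rd s 0 (symadr n (zrow n0 L z) (zcol n0 L z)) else fl_cst F 0%R) ->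
     flops s' = flops s -> Q s') ->
  wp (cinput n0) s Q.
Proof.
move=> s6 s1 s3 s5 n00 LG qLG qG nG HQ.
have twnW : 2 * n * (2 * n) < W.
  rewrite -mulnn in nG; apply: (ltn_word G_gt0 GW); lia.
have twW : 2 * n < W by apply: leq_ltn_trans twnW; case: (n) => // m; rewrite leq_pmull.
have two : 2 %% W = 2 by rewrite modn_small//; apply: leq_trans GW; lia.
pose val z := if (zrow n0 L z < 2 * n) && (zcol n0 L z < 2 * n)
          then rd s 0 (symadr n (zrow n0 L z) (zcol n0 L z)) else fl_cst F 0%R.
pose J k s' := [/\ same [:: 7] s s', forall z, z < k -> rd s' 7 z = val z
  & flops s' = flops s].
apply: (@wp_for _ _ _ _ _ _ ((n0 * n0) ^ L) J) => //.
- by apply: (ltn_word G_gt0 GW); lia.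
- by move=> s' fs'; rewrite ieval_reg fs'.
- move=> z s' zq fs' s'16 [sm vs fls].
  have s3' : regs s' 3 = L by rewrite fs'.
  apply: wp_seq; apply: (@wp_cdecode n0 L z) => //.
  move=> s2 f2 c2 l2 r18 r19.
  have s2x x : x \notin [:: 16, 17, 18, 19, 20, 21, 25 & nil] -> regs s2 x = regs s x.
    by move=> nx; rewrite f2 ?(notin_sub _ nx)// fs' // ?(notin_sub _ nx).
  have s16' : regs s2 16 = z by rewrite f2.
  have s2rd c i : rd s2 c i = rd s' c i by rewrite /rd c2.
  have zG : z < G by lia.
  have fin v : v = val z -> J z.+1 (wr G s2 7 z v 0).
    move=> ->; split=> [c i iG ci|k kz|].
    - rewrite (rd_wr G_gt0)//; move: (ci); rewrite inE => /negbTE->.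
      by rewrite s2rd sm.
    - rewrite (rd_wr G_gt0)// ?eqxx /=; last lia.
      by case: eqP => [->//|ne]; rewrite s2rd vs//; lia.
    - by rewrite /= addn0 l2.
  apply: wp_if.
  have -> : (ieval W (regs s2) (IMul (ISub (IMul (IConst 2) (IReg 1)) (IReg 18))
      (ISub (IMul (IConst 2) (IReg 1)) (IReg 19))) != 0)
      = (zrow n0 L z < 2 * n) && (zcol n0 L z < 2 * n).
    rewrite /= r18 r19 s2x// s1 two !(@modn_small (2 * n))// modn_small.
      by rewrite muln_eq0 negb_or !subn_eq0 -!ltnNge.
    by apply: leq_ltn_trans twnW; rewrite leq_mul// leq_subr.
  case: ifP => zz; last first.
    apply: (wpr_const _ G_gt0 GW (i1 := z)) => //; first by rewrite s2x.
    by apply: fin; rewrite /val zz.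
  have /andP[hi hj] := zz.
  apply: wp_seq; apply: (@wp_csymadr n _ _ _ _ _ r18 r19) => //; first by rewrite s2x.
  have hG := leq_trans (symadr_lt hi hj) nG.
  apply: (wpr_copy _ _ G_gt0 GW (i1 := z) (i2 := symadr n (zrow n0 L z) (zcol n0 L z))) => //.
    by rewrite /= /upd /= s2x.
  have H : J z.+1 (wr G s2 7 z (rd s2 0 (symadr n (zrow n0 L z) (zcol n0 L z))) 0).
    by apply: fin; rewrite /val zz s2rd sm.
  by case: H => h1 h2 h3; split.
- move=> s' fs' [sm vs fls]; apply: HQ => // y ny.
  by rewrite fs' ?(notin_sub _ ny).
Qed.

Lemma wp_cabs Qn s Q :
  regs s 6 = G -> regs s 5 = Qn -> Qn <= G ->
  (forall s', frame [:: 9; 16] s s' -> same [:: 8; 9] s s' ->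
     rd s' 8 0 = fabs F (rd s 7) Qn -> flops s' = flops s + 2 * Qn -> Q s') ->
  wp cabs s Q.
Proof.
move=> s6 s5 QG HQ.
apply: wp_seq; apply: (wpr_const _ G_gt0 GW (i1 := 0)); rewrite ?ieval0//.
apply: wp_seq; apply: (wpr_const _ G_gt0 GW (i1 := 0)); rewrite ?ieval0//.
set s1 := wr _ _ _ _ _ _.
pose J k s' := [/\ same [:: 8; 9] s s', rd s' 9 0 = fl_cst F 0%R,
  rd s' 8 0 = fabs F (rd s 7) k & flops s' = flops s + 2 * k].
apply: (@wp_for _ _ _ _ _ _ Qn J) => //.
- by apply: (ltn_word G_gt0 GW); lia.
- by move=> s' fs'; rewrite ieval_reg fs'.
- split; last by rewrite /= !addn0.
  + move=> c i iG; rewrite !inE negb_or => /andP[c8 c9].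
    by rewrite !(rd_wr G_gt0)// (negbTE c8) (negbTE c9).
  + by rewrite (rd_wr G_gt0)// !eqxx.
  + by rewrite !(rd_wr G_gt0)// !eqxx.
- move=> k s' kQ fs' s'16 [sm v9 v8 fls].
  have s6' : regs s' 6 = G by rewrite fs'.
  have kG : k < G by lia.
  apply: wp_seq; apply: (wpr_le _ _ G_gt0 GW (i1 := 0) (i2 := k)); rewrite ?ieval0//.
  rewrite v9 (sm 7 k)//; set s2 := State _ _ _ _.
  have fin o : o = (if (fl_cst F 0 <= rd s 7 k)%R then FAdd else FSub) ->
      J k.+1 (wr G s2 8 0 (fl F o (rd s' 8 0) (rd s' 7 k)) 1).
    move=> ->; split; last by rewrite /= fls; lia.
    + move=> c i iG ci; rewrite (rd_wr G_gt0)//; move: (ci).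
      by rewrite !inE negb_or => /andP[/negbTE-> c9]; exact: sm.
    + by rewrite (rd_wr G_gt0).
    + by rewrite (rd_wr G_gt0)// !eqxx /= v8 sm.
  apply: wp_if; rewrite /= /upd /=.
  case: ifP => h; apply: (wpr_op _ G_gt0 GW (i1 := 0) (i2 := 0) (i3 := k));
    rewrite ?ieval0//=; apply: fin; first by case: ifP h.
  by case: ifP h.
- by move=> s' fs' [sm v9 v8 fls]; apply: HQ => // y ny; rewrite fs' ?(notin_sub _ ny).
Qed.

Lemma wp_csumsq Qn s Q :
  regs s 6 = G -> regs s 5 = Qn -> Qn <= G ->
  (forall s', frame [:: 16] s s' -> same [:: 13; 14] s s' ->
     rd s' 14 0 = fdot F (rd s 7) (rd s 7) Qn -> flops s' = flops s + 2 * Qn -> Q s') ->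
  wp csumsq s Q.
Proof.
move=> s6 s5 QG HQ.
apply: wp_seq; apply: (wpr_const _ G_gt0 GW (i1 := 0)); rewrite ?ieval0//.
set s1 := wr _ _ _ _ _ _.
pose J k s' := [/\ same [:: 13; 14] s s',
  rd s' 14 0 = fdot F (rd s 7) (rd s 7) k & flops s' = flops s + 2 * k].
apply: (@wp_for _ _ _ _ _ _ Qn J) => //.
- by apply: (ltn_word G_gt0 GW); lia.
- by move=> s' fs'; rewrite ieval_reg fs'.
- split; last by rewrite /= !addn0.
  + move=> c i iG; rewrite !inE negb_or => /andP[c8 c9].
    by rewrite !(rd_wr G_gt0)// (negbTE c9).
  + by rewrite (rd_wr G_gt0)// !eqxx.
- move=> k s' kQ fs' s'16 [sm v14 fls].
  have s6' : regs s' 6 = G by rewrite fs'.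
  have kG : k < G by lia.
  apply: wp_seq; apply: (wpr_op _ G_gt0 GW (i1 := 0) (i2 := k) (i3 := k));
    rewrite ?ieval0//.
  set v := fl _ _ _ _.
  apply: (wpr_op _ G_gt0 GW (i1 := 0) (i2 := 0) (i3 := 0)); rewrite ?ieval0//.
  have E1 : rd (wr G s' 13 0 v 1) 14 0 = rd s' 14 0 by rewrite (rd_wr G_gt0).
  have E2 : rd (wr G s' 13 0 v 1) 13 0 = v by rewrite (rd_wr G_gt0)// !eqxx.
  rewrite E1 E2; split; last by rewrite /= fls; lia.
  + move=> c i iG ci; rewrite !(rd_wr G_gt0)//; move: (ci).
    by rewrite !inE negb_or => /andP[/negbTE-> /negbTE->]; exact: sm.
  + by rewrite (rd_wr G_gt0)// !eqxx /= v14 /v sm.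
- by move=> s' fs' [sm v14 fls]; apply: HQ => // y ny; rewrite fs' ?(notin_sub _ ny).
Qed.

Lemma wp_cbis m st s Q :
  regs s 6 = G -> regs s 26 = st -> regs s 27 = m -> st < W -> m < W ->
  (forall s', frame [:: 9; 22; 23] s s' ->
     rd s' 15 0 = (fbis F m (rd s 14 0) (rd s 6 0) (rd s 8 0) st).1 ->
     flops s' = flops s + st * (m + 3) -> Q s') ->
  wp cbis s Q.
Proof.
move=> s6 s26 s27 stW mW HQ.
set T := rd s 14 0 in HQ; set h := rd s 6 0 in HQ; set d0 := rd s 8 0 in HQ.
apply: wp_seq; apply: (wpr_const _ G_gt0 GW (i1 := 0)); rewrite ?ieval0//.
set s1 := wr _ _ _ _ _ _.
pose J k s' := [/\ rd s' 14 0 = T, rd s' 6 0 = h,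
  rd s' 15 0 = (fbis F m T h d0 k).1, rd s' 8 0 = (fbis F m T h d0 k).2
  & flops s' = flops s + k * (m + 3)].
have s1r c : c != 15 -> rd s1 c 0 = rd s c 0.
  by move=> /negbTE c15; rewrite (rd_wr G_gt0)// c15.
apply: (@wp_for _ _ _ _ _ _ st J) => //.
- by move=> s' fs'; rewrite ieval_reg fs'.
- split; [exact: s1r|exact: s1r| |exact: s1r|by rewrite /= addn0].
  by rewrite (rd_wr G_gt0)// !eqxx.
- move=> k s' kst fs' s'22 [v14 v6 v15 v8 fls].
  have s6' : regs s' 6 = G by rewrite fs'.
  apply: wp_seq; apply: (wpr_op _ G_gt0 GW (i1 := 0) (i2 := 0) (i3 := 0));
    rewrite ?ieval0//.
  set x := fl _ _ _ _.
  apply: wp_seq; apply: (wpr_copy _ _ G_gt0 GW (i1 := 0) (i2 := 0)); rewrite ?ieval0//.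
  have -> : rd (wr G s' 2 0 x 1) 2 0 = x by rewrite (rd_wr G_gt0)// !eqxx.
  set s2 := wr _ _ 13 _ _ _.
  pose K t s3 := [/\ forall c, c != 13 -> rd s3 c 0 = rd s2 c 0,
    rd s3 13 0 = fsq F t x & flops s3 = flops s' + 1 + t].
  apply: wp_seq; apply: (@wp_for _ _ _ _ _ _ m K) => //.
  + by move=> s3 fs3; rewrite ieval_reg fs3 ?fs'.
  + by split=> //; rewrite (rd_wr G_gt0)// !eqxx.
  + move=> t s3 tm fs3 _ [w1 w2 l3].
    have s36 : regs s3 6 = G by rewrite fs3 ?fs'.
    apply: (wpr_op _ G_gt0 GW (i1 := 0) (i2 := 0) (i3 := 0)); rewrite ?ieval0//.
    split; last by rewrite /= l3; lia.
      by move=> c c13; rewrite (rd_wr G_gt0)// (negbTE c13) /= w1.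
    by rewrite (rd_wr G_gt0)// !eqxx /= w2.
  move=> s3 fs3 [w1 w2 l3].
  have s2r c : c != 13 -> c != 2 -> rd s2 c 0 = rd s' c 0.
    by move=> /negbTE h1 /negbTE h2; rewrite !(rd_wr G_gt0)// h1 h2.
  have s36 : regs s3 6 = G by rewrite fs3 ?fs'.
  apply: wp_seq; apply: (wpr_le _ _ G_gt0 GW (i1 := 0) (i2 := 0)); rewrite ?ieval0//.
  rewrite w2 w1// s2r// v14; set s4 := State _ _ _ _.
  have x2 : rd s4 2 0 = x.
    by rewrite -[LHS]/(rd s3 2 0) w1// !(rd_wr G_gt0)// !eqxx.
  have s4r c : c != 13 -> c != 2 -> rd s4 c 0 = rd s' c 0.
    by move=> h1 h2; rewrite -[LHS]/(rd s3 c 0) w1// s2r.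
  have xE : x = fl F FAdd (fbis F m T h d0 k).1 (fbis F m T h d0 k).2.
    by rewrite /x v15 v8.
  apply: wp_seq; apply: wp_if; rewrite /= /upd /=.
  have [xT|xT] := ifPn.
    apply: (wpr_copy _ _ G_gt0 GW (i1 := 0) (i2 := 0)); rewrite ?ieval0//.
    rewrite x2; set s5 := wr _ _ _ _ _ _.
    apply: (wpr_op _ G_gt0 GW (i1 := 0) (i2 := 0) (i3 := 0)); rewrite ?ieval0//.
    have s5r c : c != 15 -> rd s5 c 0 = rd s4 c 0.
      by move=> /negbTE h1; rewrite (rd_wr G_gt0)// h1.
    rewrite !s5r// !s4r//; split; last by rewrite /= l3 fls; lia.
    + by rewrite (rd_wr G_gt0)// s5r// s4r.
    + by rewrite (rd_wr G_gt0)// s5r// s4r.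
    + rewrite !(rd_wr G_gt0)// !eqxx /= -xE.
      by case: ifP xT.
    + by rewrite (rd_wr G_gt0)// !eqxx /= v8 v6.
  apply: wp_skip.
  apply: (wpr_op _ G_gt0 GW (i1 := 0) (i2 := 0) (i3 := 0)); rewrite ?ieval0//.
  rewrite !s4r//; split; last by rewrite /= l3 fls; lia.
  + by rewrite (rd_wr G_gt0)// s4r.
  + by rewrite (rd_wr G_gt0)// s4r.
  + rewrite (rd_wr G_gt0)// s4r// v15 /= -xE.
    by case: ifP xT.
  + by rewrite (rd_wr G_gt0)// !eqxx /= v8 v6.
- move=> s' fs' [v14 v6 v15 v8 fls]; apply: HQ => //.
  by move=> y ny; rewrite fs' ?(notin_sub _ ny).
Qed.
End MainSpecs.

Section NormSpec.
Context {R : realType} (F : fp_arith R) (W : nat) (tape : nat -> bool).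
Local Open Scope nat_scope.
Implicit Types (s : state R) (Q : state R -> Prop).
Notation wp := (wp F W tape).

Definition tabfl (t : seq R) (i : nat) : R := fl_cst F (nth 0%R t i).

Definition syminput (n0 L n : nat) (m : nat -> R) (z : nat) : R :=
  if (zrow n0 L z < 2 * n) && (zcol n0 L z < 2 * n)
  then m (symadr n (zrow n0 L z) (zcol n0 L z)) else fl_cst F 0%R.

Definition fnorm (n0 r : nat) (tU tV tW : seq R) (L n kappa st : nat)
    (m : nat -> R) : R :=
  let q := n0 * n0 in
  let a := syminput n0 L n m in
  let b := iter kappa (fmm F (tabfl tU) (tabfl tV) (tabfl tW) q r L) a in
  (fbis F kappa.+1 (fdot F b b (q ^ L)) (fl_cst F (1 / 2)%R)
     (fabs F a (q ^ L)) st).1.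

(** Two flops per entry for the sum of absolute values and two for the trace; then kappa matrix
    squarings; then bisection steps of one addition, kappa + 1 squarings, one comparison and one
    halving. *)
Definition norm_cost (n0 r L kappa st : nat) : nat :=
  4 * (n0 * n0) ^ L + kappa * (7 * (L * (r * r ^ L))) + st * (kappa + 4).

Lemma wp_cmain n0 r tU tV tW L n kappa st s Q :
  let q := n0 * n0 in let G := r ^ L in
  regs s 6 = G -> regs s 1 = n -> regs s 3 = L -> regs s 5 = q ^ L ->
  regs s 8 = kappa -> regs s 26 = st -> regs s 27 = kappa.+1 ->
  0 < n0 -> q <= r -> 1 < L -> L <= G -> 4 * n ^ 2 <= G ->
  32 * G <= W -> kappa.+1 < W -> st < W ->
  size tU = q * r -> size tV = q * r -> size tW = q * r ->
  (forall s', regs s' 0 = regs s 0 ->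
     cells s' 0 = fnorm n0 r tU tV tW L n kappa st (cells s) ->
     flops s' <= flops s + norm_cost n0 r L kappa st -> Q s') ->
  wp (cmain n0 r tU tV tW) s Q.
Proof.
move=> q G s6 s1 s3 s5 s8 s26 s27 n00 qr L1 LG nG GW kW stW sU sV sW HQ.
have q0 : 0 < q by rewrite muln_gt0 n00.
have r0 : 0 < r by apply: leq_trans qr.
have G0 : 0 < G by rewrite expn_gt0 r0.
have qLG : q ^ L <= G by rewrite leq_exp2r//; lia.
have qrG : q * r <= G.
  rewrite (leq_trans (_ : _ <= r ^ 2))//; first by rewrite expnS leq_mul.
  exact: leq_pexp2l.
have qG : q <= G by rewrite (leq_trans _ qrG)// leq_pmulr.
apply: wp_seq; apply: (wp_cload _ G0 GW); rewrite ?add0n ?sU//.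
move=> sa fa la ma _ va.
apply: wp_seq; apply: (wp_cload _ G0 GW); rewrite ?add0n ?sV ?fa//.
move=> sb fb lb mb _ vb.
apply: wp_seq; apply: (wp_cload _ G0 GW); rewrite ?add0n ?sW ?fb ?fa//.
move=> sc fc lc mc _ vc.
have {}fc y : regs sc y = regs s y by rewrite fc// fb// fa.
apply: wp_seq; apply: (wpr_const _ G0 GW (i1 := 0)); rewrite ?ieval0 ?fc//.
set sd := wr _ _ _ _ _ _.
have md c i : i < G -> c != 6 -> rd G sd c i = rd G sc c i.
  by move=> iG /negbTE c6; rewrite (rd_wr G0)// c6.
have vU k : k < q * r -> rd G sd 3 k = tabfl tU k.
  by move=> kq; have kG := leq_trans kq qrG; rewrite md// mc// mb//; exact: va.
have vV k : k < q * r -> rd G sd 4 k = tabfl tV k.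
  by move=> kq; have kG := leq_trans kq qrG; rewrite md// mc//; exact: vb.
have vW k : k < q * r -> rd G sd 5 k = tabfl tW k.
  by move=> kq; have kG := leq_trans kq qrG; rewrite md//; exact: vc.
have v6 : rd G sd 6 0 = fl_cst F (1 / 2)%R by rewrite (rd_wr G0)// !eqxx.
have v0 i : i < G -> rd G sd 0 i = cells s i.
  by move=> iG; rewrite md// mc// mb// ma.
have ld : flops sd = flops s by rewrite /= addn0 lc lb la.
have {}fc y : regs sd y = regs s y by rewrite fc.
move: (sd) fc vU vV vW v6 v0 ld => {}sd fd vU vV vW v6 v0 ld {md fa fb la lb lc ma mb mc va vb vc sa sb sc}.
apply: wp_seq; apply: (@wp_cinput _ _ _ _ _ G0 GW n0 n L); rewrite ?fd//.
move=> se fe me ve le.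
have {}fe y : y \notin mods (@cinput R n0) -> regs se y = regs s y.
  by move=> ny; rewrite fe// fd.
have {}ve z : z < q ^ L -> rd G se 7 z = syminput n0 L n (cells s) z.
  move=> zq; rewrite ve// /syminput; case: ifP => // /andP[h1 h2].
  by rewrite v0// (leq_trans (symadr_lt h1 h2)).
apply: wp_seq; apply: (@wp_cabs _ _ _ _ _ G0 GW (q ^ L)); rewrite ?fe//.
move=> sf ff mf vf lf.
have {}ff y : y \notin 9 :: mods (@cinput R n0) -> regs sf y = regs s y.
  by move=> ny; rewrite ff ?fe// ?(notin_sub _ ny).
set a := syminput n0 L n (cells s) in ve *.
pose B i := iter i (fmm F (tabfl tU) (tabfl tV) (tabfl tW) q r L) a.
pose J i s' := [/\ same G [:: 7; 10; 11; 12; 13] sf s',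
  forall z, z < q ^ L -> rd G s' 7 z = B i z
  & flops s' <= flops sf + i * (7 * (L * (r * G)))].
have smd c i : c \notin [:: 7; 8; 9] -> i < G -> rd G sf c i = rd G sd c i.
  by move=> nc iG; rewrite mf ?me// (notin_sub _ nc).
apply: wp_seq; apply: (@wp_for _ _ _ _ _ _ kappa J) => //.
- by lia.
- by move=> s' fs'; rewrite ieval_reg fs' ?ff.
- by split=> [//|z zq|]; [rewrite mf ?ve//; lia|rewrite addn0].
- move=> i s' ik fs' s'10 [sm vs fls].
  apply: (@wp_cmm _ _ _ _ _ G0 GW q r L) => //; rewrite ?fs' ?ff//.
  move=> s2 f2 m2 v2 l2; split.
  + exact: same_trans sm m2 _ _.
  + move=> z zq; rewrite v2//; apply: eq_fmm => //.
    * by move=> x xq; rewrite sm ?smd ?vU//; lia.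
    * by move=> x xq; rewrite sm ?smd ?vV//; lia.
    * by move=> x xq; rewrite sm ?smd ?vW//; lia.
  + by move: l2 fls; set X := 7 * _; rewrite mulSn; lia.
move=> sg fg [mg vg lg].
have {}fg y : y \notin 9 :: 10 :: mods (@cinput R n0) ++ mods (@cmm R q r) ->
    regs sg y = regs s y.
  by move=> ny; rewrite fg ?ff// ?(notin_sub _ ny).
apply: wp_seq; apply: (@wp_csumsq _ _ _ _ _ G0 GW (q ^ L)); rewrite ?fg//.
move=> sh fh mh vh lh.
apply: wp_seq; apply: (@wp_cbis _ _ _ _ _ G0 GW kappa.+1 st); rewrite ?fh ?fg//.
move=> si fi vi li.
apply: (wpr_copy _ _ G0 GW (i1 := 0) (i2 := 0)); rewrite ?ieval0//.
  by rewrite fi// fh// fg.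
apply: HQ.
- by rewrite [LHS]/= fi// fh// fg.
- rewrite -[LHS]/(rd G (wr G si 0 0 (rd G si 15 0) 0) 0 0) (rd_wr G0)// !eqxx.
  rewrite [LHS]/= -[LHS]/(rd G si 15 0) vi vh mh// mg// smd// v6 mh// mg// vf.
  rewrite /fnorm; congr (fbis _ _ _ _ _ _).1.
    by apply: eq_fdot => z zq; rewrite vg.
  by apply: eq_fabs => z zq; rewrite ve.
- rewrite /= addn0 li lh /norm_cost -/q -/G.
  rewrite lf le ld in lg; rewrite addSn -addnS.
  by rewrite (_ : kappa + 4 = (kappa + 3).+1); lia.
Qed.

(** [L] grows only while [n0 ^ L < 2 * n], so [n0 ^ L] ends below [n0 ^ 2 * (2 * n)]. Then
    [r <= n0 ^ e] makes the region size polynomial in [n], and a fixed power of the word base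
    suffices. *)
Lemma wp_csetup n0 r n e s Q :
  1 < n0 -> n0 * n0 <= r -> r <= n0 ^ e -> 0 < n -> regs s 1 = n ->
  32 * (n0 ^ 2 * (2 * n)) ^ e <= W -> 2 * n < W ->
  (forall s' L, frame [:: 3; 4; 5; 6] s s' -> cells s' = cells s ->
     flops s' = flops s -> regs s' 3 = L -> regs s' 5 = (n0 * n0) ^ L ->
     regs s' 6 = r ^ L -> 1 < L -> 2 * n <= n0 ^ L ->
     n0 ^ L <= n0 ^ 2 * (2 * n) -> 32 * r ^ L <= W -> Q s') ->
  wp (csetup n0 r) s Q.
Proof.
move=> n01 qr re n_gt0 s1 BW nW HQ.
set B := n0 ^ 2 * (2 * n) in BW HQ.
have q0 : 0 < n0 * n0 by rewrite muln_gt0; lia.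
have r0 : 0 < r by apply: leq_trans qr.
have n0r : n0 <= r by apply: leq_trans qr; rewrite leq_pmulr//; lia.
have rB L : n0 ^ L <= B -> 32 * r ^ L <= W.
  move=> h; apply: leq_trans BW; rewrite leq_mul2l /=.
  apply: leq_trans (_ : (n0 ^ L) ^ e <= _); last first.
    by case: (e) => // e'; rewrite leq_exp2r.
  rewrite -expnM mulnC expnM; case: L {h} => // L.
  by rewrite leq_exp2r.
have sm L x : n0 ^ L <= B -> x <= r ^ L -> x %% W = x.
  move=> /rB h xr; rewrite modn_small//.
  have : 0 < r ^ L by rewrite expn_gt0 r0.
  by lia.
have n02 : n0 ^ 2 <= B by rewrite leq_pmulr//; lia.
have pw L : n0 ^ L <= r ^ L by case: L => // L; rewrite leq_exp2r.
have qw L : (n0 * n0) ^ L <= r ^ L by case: L => // L; rewrite leq_exp2r.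
have c2W : 2 %% W = 2 by rewrite modn_small//; have := rB 0; rewrite /B; nia.
have L_le L : L < n0 ^ L by rewrite ltn_expl.
do 4 (apply: wp_seq; apply: wp_set).
rewrite /= (sm 2 (n0 ^ 2))// (sm 2 ((n0 * n0) ^ 2))// (sm 2 (r ^ 2))// c2W.
set s1' := setr _ 6 _.
have E1 : regs s1' 1 = n by [].
pose I s' := exists L, [/\ cells s' = cells s, flops s' = flops s,
  [/\ regs s' 3 = L, regs s' 4 = n0 ^ L, regs s' 5 = (n0 * n0) ^ L
    & regs s' 6 = r ^ L], 1 < L & n0 ^ L <= B].
apply: (@wp_while _ _ _ _ _ _ I (fun s' => 2 * n - regs s' 4)).
- by exists 2.
- move=> s' fs' [L [cs fls [r3 r4 r5 r6] L1 LB]].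
  rewrite [ieval _ _ _]/= fs'// E1 c2W modn_small// r4 subn_eq0 -ltnNge => ltn.
  have LB' : n0 ^ L.+1 <= B.
    rewrite expnS /B expnS expn1 -mulnA leq_mul2l.
    rewrite (leq_trans (ltnW ltn)) ?orbT//; rewrite leq_pmull//; lia.
  do 3 (apply: wp_seq; apply: wp_set); apply: wp_set.
  have kk x : x <= r ^ L.+1 -> x %% W = x by exact: sm.
  have rr : r <= r ^ L.+1 by rewrite expnS leq_pmulr// expn_gt0 r0.
  rewrite /= /upd /= (kk 1) ?expn_gt0 ?r0// (kk n0); last lia.
  rewrite (kk (n0 * n0)); last lia.
  rewrite (kk r)// r3 r4 r5 r6 -!expnSr !kk//; last first.
    by rewrite addn1; apply: leq_trans (pw _); exact: ltnW.
  split; first by exists L.+1; rewrite /= addn1; split=> //; exact: ltnW.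
  have : n0 ^ L * 2 <= n0 ^ L.+1 by rewrite expnSr leq_mul2l n01 orbT.
  by have := L_le L; lia.
- move=> s' fs' [L [cs fls [r3 r4 r5 r6] L1 LB]].
  rewrite [ieval _ _ _]/= fs'// E1 c2W modn_small// r4 => /eqP.
  rewrite subn_eq0 => ge.
  apply: (HQ s' L) => //; last exact: rB.
  move=> y ny; rewrite fs' ?(notin_sub _ ny)//.
  move: ny; rewrite /= /upd !inE !negb_or => /and4P[h1 h2 h3 h4].
  by rewrite (negbTE h1) (negbTE h2) (negbTE h3) (negbTE h4).
Qed.

Definition fdbl (eps : R) (i : nat) : R := iter i (fun x => fl F FAdd x x) eps.

Lemma wp_clog G p s Q :
  0 < G -> 32 * G <= W -> regs s 6 = G -> regs s 2 = p -> p < W ->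
  (forall s' j, frame [:: 7; 9] s s' -> same G [:: 1; 2] s s' ->
     regs s' 7 = j -> j <= p ->
     (forall i, i < j -> ~~ (fl_cst F 1 <= fdbl (cells s 0) i)%R) ->
     (j < p -> (fl_cst F 1 <= fdbl (cells s 0) j)%R) ->
     flops s' = flops s + 1 + 2 * j -> Q s') ->
  wp clog s Q.
Proof.
move=> G0 GW s6 s2 pW HQ.
have c1W : 1 %% W = 1 by rewrite modn_small//; lia.
apply: wp_seq; apply: (wpr_const _ G0 GW (i1 := 0)); rewrite ?ieval0//.
apply: wp_seq; apply: (wpr_copy _ _ G0 GW (i1 := 0) (i2 := 0)); rewrite ?ieval0//.
set s1 := wr _ _ 1 _ _ _.
rewrite (_ : rd G s1 0 0 = cells s 0); last by rewrite (rd_wr G0).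
set s2' := wr _ _ 2 _ _ _.
apply: wp_seq; apply: wp_set; rewrite ieval0.
apply: wp_seq; apply: (wpr_le _ _ G0 GW (i1 := 0) (i2 := 0)); rewrite ?ieval0//.
rewrite !rd_setr (_ : rd G s2' 1 0 = fl_cst F 1%R); last first.
  by rewrite !(rd_wr G0)// !eqxx.
rewrite (_ : rd G s2' 2 0 = cells s 0); last by rewrite !(rd_wr G0)// !eqxx.
set s3 := State _ _ _ _.
pose I s' := [/\ same G [:: 1; 2] s s',
  rd G s' 1 0 = fl_cst F 1%R /\ rd G s' 2 0 = fdbl (cells s 0) (regs s' 7),
  regs s' 7 <= p /\ regs s' 9 = (fl_cst F 1 <= fdbl (cells s 0) (regs s' 7))%R,
  forall i, i < regs s' 7 -> ~~ (fl_cst F 1 <= fdbl (cells s 0) i)%R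
  & flops s' = flops s + 1 + 2 * regs s' 7].
have cond s' : frame [:: 7; 9] s3 s' ->
    (ieval W (regs s') (IMul (ISub (IConst 1) (IReg 9)) (ISub (IReg 2) (IReg 7))) == 0)
    = (regs s' 9 != 0) || (p <= regs s' 7).
  move=> fs'; have E2 : regs s' 2 = p by rewrite fs'.
  rewrite /= c1W E2 modn_small.
    by rewrite muln_eq0 !subn_eq0 lt0n.
  by apply: leq_ltn_trans pW; case: (regs s' 9) => [|k]; rewrite ?subn0 ?mul1n ?leq_subr.
apply: (@wp_while _ _ _ _ _ _ I (fun s' => p - regs s' 7)).
- split=> //; last by rewrite /= !addn0.
    move=> c i iG; rewrite !inE negb_or => /andP[c1 c2].
    by rewrite -[LHS]/(rd G s2' c i) !(rd_wr G0)// (negbTE c2) (negbTE c1).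
  split; first by rewrite -[LHS]/(rd G s2' 1 0) !(rd_wr G0)// !eqxx.
  by rewrite -[LHS]/(rd G s2' 2 0) !(rd_wr G0)// !eqxx.
- move=> s' fs' [sm [v1 v2] [jp r9] lt fls].
  rewrite cond// negb_or negbK -ltnNge => /andP[r90 jp'].
  have s6' : regs s' 6 = G by rewrite fs'.
  apply: wp_seq; apply: (wpr_op _ G0 GW (i1 := 0) (i2 := 0) (i3 := 0)); rewrite ?ieval0//.
  set v := fl _ _ _ _.
  apply: wp_seq; apply: wp_set; rewrite [ieval _ _ _]/= c1W modn_small; last lia.
  apply: (wpr_le _ _ G0 GW (i1 := 0) (i2 := 0)); rewrite ?ieval0//.
  rewrite !rd_setr addn1.
  have E1 : rd G (wr G s' 2 0 v 1) 1 0 = fl_cst F 1%R by rewrite (rd_wr G0)// v1.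
  have E2 : rd G (wr G s' 2 0 v 1) 2 0 = fdbl (cells s 0) (regs s' 7).+1.
    by rewrite (rd_wr G0)// !eqxx /= /v v2.
  rewrite E1 E2; split; last by rewrite /= /upd /=; lia.
  split.
  + move=> c i iG; rewrite !inE negb_or => /andP[c1 c2].
    rewrite -[LHS]/(rd G (wr G s' 2 0 v 1) c i) (rd_wr G0)// (negbTE c2).
    by apply: sm; rewrite // !inE negb_or c1.
  + by [].
  + by split; rewrite //= /upd.
  + move=> i; rewrite /= /upd /= ltnS leq_eqVlt => /orP[/eqP->|]; last exact: lt.
    by move: r90; rewrite r9; case: (_ <= _)%R.
  + by rewrite /= /upd /= fls; lia.
- move=> s' fs' [sm [v1 v2] [jp r9] lt fls] /eqP; rewrite cond// => h.
  apply: (HQ s' (regs s' 7)) => //.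
    move=> y ny; rewrite fs'//; move: ny; rewrite /= /upd !inE negb_or.
    by move=> /andP[/negbTE-> /negbTE->].
  by move=> jp2; move: h; rewrite leqNgt jp2 orbF r9; case: (_ <= _)%R.
Qed.

Lemma wp_cnorm n0 r tU tV tW c1 c2 c3 n p e s Q :
  let q := n0 * n0 in let B := n0 ^ 2 * (2 * n) in
  1 < n0 -> q <= r -> r <= n0 ^ e -> 0 < n ->
  regs s 1 = n -> regs s 2 = p -> regs s 0 = 0 ->
  32 * B ^ e <= W -> c1 < W -> c2 < W -> c3 < W -> 2 * n < W ->
  p + c2 * (B + 1) < W -> c3 * ((p + B + c1 + 1) * (B + 1)) < W ->
  p + B + c1 + 1 < W ->
  size tU = q * r -> size tV = q * r -> size tW = q * r ->
  (forall s' L j, 1 < L -> 2 * n <= n0 ^ L -> n0 ^ L <= B -> j <= p ->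
     (forall i, i < j -> ~~ (fl_cst F 1 <= fdbl (cells s 0) i)%R) ->
     (j < p -> (fl_cst F 1 <= fdbl (cells s 0) j)%R) ->
     let kappa := j + L + c1 in let st := j + c2 * (L + 1) in
     (if c3 * (kappa.+1 * (L + 1)) <= p then
       regs s' 0 = 0 /\
       cells s' 0 = fnorm n0 r tU tV tW L n kappa st (cells s) /\
       flops s' <= flops s + 1 + 2 * j + norm_cost n0 r L kappa st
     else regs s' 0 != 0 /\ flops s' = flops s + 1 + 2 * j) ->
     Q s') ->
  wp (cnorm n0 r tU tV tW c1 c2 c3) s Q.
Proof.
move=> q B n01 qr re n_gt0 s1 s2 s0 BW c1W c2W c3W nW hW1 hW2 hW3 sU sV sW HQ.
have q0 : 0 < q by rewrite muln_gt0; lia.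
have r0 : 0 < r by apply: leq_trans qr.
apply: wp_seq; apply: (@wp_csetup n0 r n e) => //.
move=> sa L fa ca la r3 r5 r6 L1 nL LB GW.
set G := r ^ L in r6 GW.
have G0 : 0 < G by rewrite expn_gt0 r0.
have pW : p < W by lia.
have oneW : 1 %% W = 1 by rewrite modn_small//; lia.
have LltB : L < B by apply: leq_trans LB; rewrite ltn_expl.
have qLG : q ^ L <= G by rewrite leq_exp2r//; lia.
have nLq : (n0 ^ L) ^ 2 = q ^ L by rewrite -expnM mulnC expnM /q mulnn.
have LG : L <= G.
  apply: leq_trans qLG; rewrite -nLq; apply: (@leq_trans (n0 ^ L)).
    by apply/ltnW/ltn_expl.
  by rewrite expnS expn1 leq_pmulr// expn_gt0; lia.
have nG : 4 * n ^ 2 <= G.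
  apply: leq_trans qLG; rewrite -nLq (_ : 4 * n ^ 2 = (2 * n) ^ 2).
    by rewrite leq_exp2r.
  by rewrite expnMn.
apply: wp_seq; apply: (@wp_clog G p) => //; first by rewrite fa.
move=> sb j fb mb r7 jp lt ge lb.
rewrite ca in lt ge.
have cz i : i < G -> cells sb i = cells s i.
  by move=> iG; have := mb 0 i iG isT; rewrite /rd ca.
have fb0 y : y \notin [:: 7; 9] -> regs sb y = regs sa y by exact: fb.
have {}fb y : y \notin [:: 3; 4; 5; 6; 7; 9] -> regs sb y = regs s y.
  by move=> ny; rewrite fb ?fa// (notin_sub _ ny).
have b3 : regs sb 3 = L by rewrite fb0.
have b5 : regs sb 5 = q ^ L by rewrite fb0.
have b6 : regs sb 6 = G by rewrite fb0.
do 3 (apply: wp_seq; apply: wp_set).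
set kappa := j + L + c1; set st := j + c2 * (L + 1).
have st_le : st <= p + c2 * (B + 1).
  by rewrite leq_add// leq_mul2l leq_add2r (ltnW LltB) orbT.
have ka_le : kappa.+1 <= p + B + c1 + 1 by rewrite /kappa; lia.
have ck_le : c3 * (kappa.+1 * (L + 1)) <= c3 * ((p + B + c1 + 1) * (B + 1)).
  by rewrite leq_mul2l leq_mul ?orbT// leq_add2r ltnW.
rewrite [ieval _ _ _]/= r7 b3 (modn_small c1W) modnDml (@modn_small (j + L + c1)); last first.
  by rewrite -/kappa; lia.
rewrite -/kappa; set sc := setr sb 8 _.
have E26 : ieval W (regs sc) (IAdd (IReg 7) (IMul (IConst c2) (IAdd (IReg 3) (IConst 1)))) = st.
  rewrite /= /upd /= r7 b3 oneW (modn_small c2W) modnMmr modnDmr modn_small//.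
  by rewrite -/st; lia.
rewrite E26; set sd := setr sc 26 _.
have E27 : ieval W (regs sd) (IAdd (IReg 8) (IConst 1)) = kappa.+1.
  by rewrite /= /upd /= oneW addn1 modn_small//; lia.
rewrite E27; set se := setr sd 27 _.
have fe y : y \notin [:: 8; 26; 27] -> regs se y = regs sb y.
  rewrite !inE !negb_or /= /upd => /and3P[h1 h2 h3].
  by rewrite (negbTE h1) (negbTE h2) (negbTE h3).
apply: wp_if.
have -> : (ieval W (regs se) (ILe (IMul (IConst c3) (IMul (IReg 27)
    (IAdd (IReg 3) (IConst 1)))) (IReg 2)) != 0) = (c3 * (kappa.+1 * (L + 1)) <= p).
  rewrite /= /upd /= b3 fb// s2 oneW (modn_small c3W).
  rewrite (@modn_small (L + 1)); last by lia.
  rewrite modnMmr modn_small; last by lia.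
  by case: leqP.
case: ifP => chk; last first.
  apply: wp_set; rewrite [ieval _ _ _]/= oneW.
  apply: (HQ _ L j) => //; rewrite chk; split=> //=.
  by rewrite lb la.
apply: (@wp_cmain n0 r tU tV tW L n kappa st) => //; rewrite ?fe//.
- by rewrite fb// fa.
- lia.
- lia.
- lia.
move=> sf f0 cf lf; apply: (HQ _ L j) => //; rewrite chk; split.
  by rewrite f0 fb.
split; last first.
  by move: lf; rewrite /= lb la.
rewrite cf /fnorm.
(* [clog] has written only to regions 1 and 2, so the input in region 0 is intact. *)
have ex z : z < q ^ L -> syminput n0 L n (cells se) z = syminput n0 L n (cells s) z.
  move=> zq; rewrite /syminput; case: ifP => // /andP[h1 h2].
  by apply: cz; apply: leq_trans (symadr_lt h1 h2) nG.
have ex2 i z : z < q ^ L ->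
  iter i (fmm F (tabfl tU) (tabfl tV) (tabfl tW) q r L) (syminput n0 L n (cells se)) z =
  iter i (fmm F (tabfl tU) (tabfl tV) (tabfl tW) q r L) (syminput n0 L n (cells s)) z.
  elim: i z => [|i IH] z zq; first exact: ex.
  by rewrite !iterS; apply: eq_fmm.
by congr (fbis _ _ _ _ _ _).1; [apply: eq_fdot => z zq; exact: ex2|apply: eq_fabs].
Qed.
End NormSpec.

(** * Real bilinear algorithms below the matrix multiplication exponent *)

Lemma sum_ord_mul (R : nmodType) (a b : nat) (f : nat -> R) :
  \sum_(k < a * b) f k = \sum_(i < a) \sum_(j < b) f (i * b + j)%N.
Proof.
elim: a => [|a IH]; first by rewrite mul0n !big_ord0.
by rewrite mulSnr big_split_ord big_ord_recr /= IH.
Qed.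

Lemma sum_delta2 (R : pzRingType) n (u : 'M[R]_n) (a b : 'I_n) :
  \sum_i \sum_j u i j * (delta_mx a b : 'M[R]_n) i j = u a b.
Proof.
rewrite (bigD1 a)//= (bigD1 b)//= big1 => [|j /negbTE jb]; last first.
  by rewrite mxE eqxx jb mulr0.
rewrite big1 ?addr0 => [|i /negbTE ia]; first by rewrite mxE !eqxx mulr1.
by rewrite big1// => j _; rewrite mxE ia mulr0.
Qed.

(** The Brent equations: apply the algorithm to two matrix units and read one entry of the
    product. *)
Lemma brent (F : fieldType) n r (u v w : 'I_r -> 'M[F]_n) :
  (forall A B : 'M[F]_n, A *m B = \sum_(l < r)
      ((\sum_i \sum_j u l i j * A i j) * (\sum_i \sum_j v l i j * B i j))
        *: w l) ->
  forall i j a b c d, \sum_(l < r) u l a b * v l c d * w l i j =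
    ((a == i) && (b == c) && (d == j))%:R.
Proof.
move=> H i j a b c d.
have := congr1 (fun M : 'M[F]_n => M i j) (H (delta_mx a b) (delta_mx c d)).
rewrite summxE => E.
rewrite (_ : \sum_(l < r) _ = (delta_mx a b *m delta_mx c d) i j).
  rewrite mul_delta_mx_cond mulmxnE mxE.
  by rewrite [i == a]eq_sym [j == d]eq_sym -mulrnA mulnb andbAC.
by rewrite E; apply: eq_bigr => l _; rewrite mxE !sum_delta2.
Qed.

Section RealBilinear.
Context {R : realType}.

(* The four terms of Re (u v w) turn a complex algorithm of rank r into a real
   one of rank 4 r. *)
Lemma real_brent (n r : nat) : (0 < n)%N -> bilinear_rank_le R[i] n r ->
  exists u v w : nat -> nat -> R,
    forall z x y, (z < n * n)%N -> (x < n * n)%N -> (y < n * n)%N ->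
    \sum_(l < 4 * r) w z l * (u l x * v l y) =
    ((x %/ n == z %/ n) && (x %% n == y %/ n) && (y %% n == z %% n))%N%:R.
Proof.
case: n => // n _ [u [v [w /brent H]]].
pose at_ (m : 'I_r -> 'M[R[i]]_n.+1) l x : R[i] :=
  if insub l is Some l' then m l' (inord (x %/ n.+1)) (inord (x %% n.+1)) else 0.
(* Re (u v w) = Re u Re v Re w - Re u Im v Im w - Im u Re v Im w - Im u Im v Re w; the quotient
   [k %/ r] selects the term. *)
pose U k x := let c := at_ u (k %% r)%N x in
  if (k %/ r < 2)%N then complex.Re c else complex.Im c.
pose V k x := let c := at_ v (k %% r)%N x in
  if odd (k %/ r) then complex.Im c else complex.Re c.
pose Z x k := let c := at_ w (k %% r)%N x in
  if (k %/ r == 0)%N then complex.Re c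
  else if (k %/ r == 3)%N then - complex.Re c else - complex.Im c.
exists U, V, Z => z x y zn xn yn.
have ltd (t : nat) : (t < n.+1 * n.+1)%N -> (t %/ n.+1 < n.+1)%N by rewrite ltn_divLR.
have ltm (t : nat) : (t %% n.+1 < n.+1)%N by rewrite ltn_pmod.
have := congr1 (@complex.Re R) (H (inord (z %/ n.+1)) (inord (z %% n.+1))
  (inord (x %/ n.+1)) (inord (x %% n.+1)) (inord (y %/ n.+1)) (inord (y %% n.+1))).
have io (s t : nat) : (s < n.+1)%N -> (t < n.+1)%N ->
    ((inord s : 'I_n.+1) == inord t) = (s == t).
  by move=> hs ht; rewrite -val_eqE /= !inordK.
rewrite !io ?ltd ?ltm// => E.
have Rb (b : bool) : b%:R = @complex.Re R (b%:R : R[i]) by case: b.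
rewrite Rb -{}E (sum_ord_mul 4 r (fun l => Z z l * (U l x * V l y))) exchange_big.
rewrite (big_morph (@complex.Re R) (id1 := 0) (op1 := +%R)) //; last by move=> [? ?] [? ?].
apply: eq_bigr => l _.
have r0 : (0 < r)%N by case: (r) l => // -[].
have dl (s : nat) : ((s * r + l) %/ r = s)%N by rewrite divnMDl// divn_small// addn0.
have ml (s : nat) : ((s * r + l) %% r = l)%N by rewrite modnMDl modn_small.
rewrite !big_ord_recl big_ord0 /U /V /Z !dl !ml /= /at_ !valK.
case: (u l _ _) => ur ui; case: (v l _ _) => vr vi; case: (w l _ _) => wr wi /=.
by ring.
Qed.

(** Fixing the second factor to the identity matrix (the sum over [v l (k * n + k)]) makes A = A * 1
    factor through a space of dimension [r], so the identity on n * n matrices has rank at most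
    [r]. *)
Lemma brent_rank (n r : nat) (u v w : nat -> nat -> R) : (0 < n)%N ->
  (forall z x y, (z < n * n)%N -> (x < n * n)%N -> (y < n * n)%N ->
    \sum_(l < r) w z l * (u l x * v l y) =
    ((x %/ n == z %/ n) && (x %% n == y %/ n) && (y %% n == z %% n))%N%:R) ->
  (n * n <= r)%N.
Proof.
move=> n0 H.
pose P : 'M[R]_(n * n, r) :=
  \matrix_(z, l) (w z l * \sum_(k < n) v l (k * n + k)%N).
pose Q : 'M[R]_(r, n * n) := \matrix_(l, x) u l x.
have PQ : P *m Q = 1%:M.
  apply/matrixP => z x; rewrite !mxE.
  under eq_bigr => l _ do rewrite !mxE -mulrA mulr_suml mulr_sumr.
  rewrite exchange_big /=.
  have kn (k : 'I_n) : (k * n + k < n * n)%N.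
    have : (k.+1 * n <= n * n)%N by rewrite leq_mul2r ltn_ord orbT.
    by rewrite mulSn; have := ltn_ord k; lia.
  have kd (k : 'I_n) : ((k * n + k) %/ n = k)%N.
    by rewrite divnMDl// divn_small// addn0.
  have km (k : 'I_n) : ((k * n + k) %% n = k)%N by rewrite modnMDl modn_small.
  under eq_bigr => k _.
    under eq_bigr => l _ do rewrite [v _ _ * _]mulrC.
    rewrite H// ?ltn_ord// kd km.
    over.
  have xm : (x %% n < n)%N by rewrite ltn_pmod.
  rewrite (bigD1 (Ordinal xm))//= big1 => [|k /negbTE kx]; last first.
    rewrite (_ : (x %% n == k)%N = false) ?andbF//.
    by rewrite -kx -val_eqE /= eq_sym.
  rewrite eqxx andbT addr0; congr (_%:R).
  congr nat_of_bool; rewrite -val_eqE /= [RHS]eq_sym; apply/andP/eqP.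
    by move=> [/eqP h1 /eqP h2]; rewrite (divn_eq x n) h1 h2 -divn_eq.
  by move=> ->.
by have := mulmx_max_rank P Q; rewrite PQ mxrank1.
Qed.

(** The schoolbook algorithm; it shows that 3 belongs to the set whose infimum is the exponent. *)
Lemma bilinear_rank_cube (F : fieldType) n : bilinear_rank_le F n (n * n * n).
Proof.
have cardT : #|{: 'I_n * 'I_n * 'I_n}| = (n * n * n)%N by rewrite !card_prod !card_ord.
rewrite -cardT.
exists (fun l => delta_mx (enum_val l).1.1 (enum_val l).1.2),
  (fun l => delta_mx (enum_val l).1.2 (enum_val l).2),
  (fun l => delta_mx (enum_val l).1.1 (enum_val l).2) => A B.
have sd (M : 'M[F]_n) a b : \sum_i \sum_j delta_mx a b i j * M i j = M a b.
  rewrite -[RHS]sum_delta2; apply: eq_bigr => i _; apply: eq_bigr => j _.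
  exact: mulrC.
transitivity (\sum_(t : 'I_n * 'I_n * 'I_n)
    (A t.1.1 t.1.2 * B t.1.2 t.2) *: (delta_mx t.1.1 t.2 : 'M[F]_n)); last first.
  rewrite (reindex _ (onW_bij _ (@enum_val_bij ('I_n * 'I_n * 'I_n)%type))) /=.
  by apply: eq_bigr => l _; rewrite !sd.
apply/matrixP => i j; rewrite mxE summxE.
rewrite -(pair_bigA _ (fun ab c =>
  ((A ab.1 ab.2 * B ab.2 c) *: (delta_mx ab.1 c : 'M[F]_n)) i j)) /=.
rewrite -(pair_bigA _ (fun a b => \sum_c
  ((A a b * B b c) *: (delta_mx a c : 'M[F]_n)) i j)) /=.
rewrite [RHS](bigD1 i)//= [X in _ = _ + X]big1; last first.
  move=> a /negbTE ai; apply: big1 => b _; apply: big1 => c _.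
  by rewrite !mxE eq_sym ai mulr0.
rewrite addr0; apply: eq_bigr => k _; rewrite (bigD1 j)//= big1; last first.
  by move=> c /negbTE cj; rewrite !mxE [j == c]eq_sym cj andbF mulr0.
by rewrite !mxE !eqxx mulr1 addr0.
Qed.

Lemma nat_powR_ge (a M : R) : 0 < a -> exists2 n : nat, (1 < n)%N & M <= n%:R `^ a.
Proof.
move=> a0; pose X := Num.max M 1 `^ a^-1.
have X0 : 0 <= X by exact: powR_ge0.
exists (Num.bound X).+2 => //.
apply: (@le_trans _ _ (Num.max M 1)); first by rewrite le_max lexx.
have -> : Num.max M 1 = X `^ a.
  by rewrite -powRrM mulVf ?gt_eqF// powRr1// le_max ler01 orbT.
apply: ge0_ler_powR; rewrite ?nnegrE// ?(ltW a0)//.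
by rewrite (le_trans (ltW (archi_boundP X0)))// ler_nat; lia.
Qed.

Definition mm_exponents : set R := [set tau : R | exists K : R,
  forall n : nat, (0 < n)%N ->
    exists2 r : nat, bilinear_rank_le R[i] n r & r%:R <= K * n%:R `^ tau]%classic.

(** A lower bound is what gives the infimum its approximation property. A rank is at least 1, and
    [K * n ^ tau] would drop below 1 for large [n] if tau were negative. *)
Lemma mm_exponents_ge0 (tau : R) : mm_exponents tau -> 0 <= tau.
Proof.
move=> [K HK]; rewrite leNgt; apply/negP => tau0.
have ntau : 0 < - tau by rewrite oppr_gt0.
have [n n1 hn] := nat_powR_ge (1 + `|K|) ntau.
have n0 : (0 < n)%N by apply: ltnW.
have [r /(real_brent n0)[u [v [w H]]] hr] := HK n n0.
have h := brent_rank n0 H.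
have r1 : 1 <= r%:R :> R by rewrite ler1n; nia.
have nt : n%:R `^ tau * (n%:R `^ (- tau)) = 1 :> R.
  rewrite -powRD; first by rewrite subrr powRr0.
  by rewrite pnatr_eq0 -lt0n n0 implybT.
have p1 : 0 <= n%:R `^ tau :> R by exact: powR_ge0.
have p2 : 0 < n%:R `^ (- tau) :> R by apply: powR_gt0; rewrite ltr0n.
have : n%:R `^ (- tau) <= K.
  have h1 : 1 <= K * n%:R `^ tau by apply: le_trans hr.
  have := ler_wpM2r (ltW p2) h1; rewrite mul1r -mulrA nt mulr1.
  exact.
by move=> hK; have := ler_norm K; lra.
Qed.

(** Take tau in the set with tau < omega + eta. For [n] large, [n ^ (omega + eta - tau)] exceeds
    [4 * K], which swallows the implied constant and the passage to real coefficients. *)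
Lemma fast_bilinear (eta : R) : 0 < eta ->
  exists (n r : nat) (u v w : nat -> nat -> R),
  [/\ (1 < n)%N, (n * n <= r)%N, 0 <= mm_exponent R + eta,
      r%:R <= n%:R `^ (mm_exponent R + eta)
    & forall z x y, (z < n * n)%N -> (x < n * n)%N -> (y < n * n)%N ->
      \sum_(l < r) w z l * (u l x * v l y) =
      ((x %/ n == z %/ n) && (x %% n == y %/ n) && (y %% n == z %% n))%N%:R].
Proof.
move=> eta0.
have hinf : has_inf mm_exponents.
  split; last by exists 0 => tau; exact: mm_exponents_ge0.
  exists 3%:R, 1 => n _; exists (n * n * n)%N; first exact: bilinear_rank_cube.
  by rewrite mul1r powR_mulrn// !natrM -expr2 -exprSr.
have [tau Htau ltau] := inf_adherent eta0 hinf.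
have tau0 := mm_exponents_ge0 Htau.
rewrite -/(mm_exponent R) in ltau; set om := mm_exponent R + eta in ltau *.
have [K HK] := Htau.
have omtau : 0 < om - tau by rewrite subr_gt0.
have [n n1 hn] := nat_powR_ge (4 * `|K|) omtau.
have n0 : (0 < n)%N by apply: ltnW.
have [r /(real_brent n0)[u [v [w H]]] hr] := HK n n0.
exists n, (4 * r)%N, u, v, w; split=> //.
- exact: brent_rank H.
- exact: le_trans (ltW ltau).
rewrite natrM (_ : om = (om - tau) + tau); last by rewrite subrK.
rewrite powRD; last by rewrite pnatr_eq0 -lt0n n0 implybT.
have hr' : r%:R <= `|K| * n%:R `^ tau.
  by rewrite (le_trans hr)// ler_wpM2r ?powR_ge0 ?ler_norm.
by have := ler_wpM2r (powR_ge0 n%:R tau) hn; lra.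
Qed.
End RealBilinear.

(** * Kronecker powers of a bilinear algorithm *)

Section Kronecker.
Context {R : realType}.
Implicit Types (M : nat -> nat -> R) (v : nat -> R).

Definition stage M (D D' I : nat) v (k : nat) : R :=
  \sum_(d < D) M (k %% D')%N d * v (d * I + k %/ D')%N.

Fixpoint stages M (D D' L t : nat) v : nat -> R :=
  if t is t'.+1 then
    stage M D D' (D ^ (L - t'.+1) * D' ^ t') (stages M D D' L t' v)
  else v.

(** Entry (l, x) of the t-th Kronecker power of [M]: the product over matching digits of [l] in base
    [D'] and of [x] in base [D]. *)
Fixpoint kron M (D D' t l x : nat) : R :=
  if t is t'.+1 then kron M D D' t' (l %/ D') (x %/ D) * M (l %% D')%N (x %% D)%N
  else 1.

(** After [t] stages an index starts with the digits [xr] not yet treated and ends with the [t] new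
    digits [l]; the [t] former leading digits [x] have been summed out. *)
Lemma stages_kron M (D D' L t : nat) v : (0 < D)%N -> (0 < D')%N -> (t <= L)%N ->
  forall xr l, (xr < D ^ (L - t))%N -> (l < D' ^ t)%N ->
  stages M D D' L t v (xr * D' ^ t + l)%N =
  \sum_(x < D ^ t) kron M D D' t l x * v (x * D ^ (L - t) + xr)%N.
Proof.
move=> D0 D'0; elim: t => [|t IH] tL xr l xrD lD'.
  rewrite expn0 subn0 big_ord1 mul1r /= mul0n add0n muln1.
  by move: lD'; rewrite expn0 ltnS leqn0 => /eqP->; rewrite addn0.
have lt : (l %/ D' < D' ^ t)%N by rewrite ltn_divLR// -expnSr.
rewrite [LHS]/= /stage [(D ^ t.+1)%N]expnSr (sum_ord_mul _ _
  (fun x => kron M D D' t.+1 l x * v (x * D ^ (L - t.+1) + xr)%N)).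
rewrite exchange_big /=; apply: eq_bigr => d _.
have e1 : ((xr * D' ^ t.+1 + l) %% D' = l %% D')%N.
  by rewrite expnSr mulnA modnMDl.
have e2 : ((xr * D' ^ t.+1 + l) %/ D' = xr * D' ^ t + l %/ D')%N.
  by rewrite expnSr mulnA divnMDl.
have e3 : (d * (D ^ (L - t.+1) * D' ^ t) + (xr * D' ^ t + l %/ D') =
    (d * D ^ (L - t.+1) + xr) * D' ^ t + l %/ D')%N.
  by rewrite mulnDl mulnA addnA.
have DS : (D ^ (L - t) = D * D ^ (L - t.+1))%N by rewrite -expnS subnSK.
rewrite e1 e2 e3 IH//; first last.
- rewrite DS; have : (d.+1 * D ^ (L - t.+1) <= D * D ^ (L - t.+1))%N.
    by rewrite leq_mul2r ltn_ord orbT.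
  by rewrite mulSn; lia.
- exact: ltnW.
rewrite mulr_sumr; apply: eq_bigr => x _.
rewrite divnMDl// (divn_small (ltn_ord d)) addn0 modnMDl (modn_small (ltn_ord d)).
rewrite mulrCA mulrA; congr (_ * v _).
by rewrite DS mulnDl addnA mulnA.
Qed.

Lemma stagesE M (D D' L : nat) v l : (0 < D)%N -> (0 < D')%N -> (l < D' ^ L)%N ->
  stages M D D' L L v l = \sum_(x < D ^ L) kron M D D' L l x * v x.
Proof.
move=> D0 D'0 lD.
have := stages_kron M v D0 D'0 (leqnn L) (xr := 0) (l := l).
rewrite subnn mul0n add0n => -> //.
by apply: eq_bigr => x _; rewrite muln1 addn0.
Qed.

(** The definition peels off the most significant digit, as the decoding loop does; this form peels
    off the least significant one, as [kron] does. *)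
Lemma zrowS n0 t z : zrow n0 t.+1 z =
  (zrow n0 t (z %/ (n0 * n0)) * n0 + (z %% (n0 * n0)) %/ n0)%N.
Proof.
elim: t => [|t IH]; first by rewrite /= expn0 divn1 muln1 mul0n.
rewrite [LHS]/= -/(zrow n0 t.+1 z) IH [in RHS]/= mulnDl -!addnA; congr (_ + _)%N.
by rewrite addnC [(n0 ^ t.+1)%N]expnSr mulnA -divnMA -expnS.
Qed.

Lemma zcolS n0 t z : zcol n0 t.+1 z =
  (zcol n0 t (z %/ (n0 * n0)) * n0 + (z %% (n0 * n0)) %% n0)%N.
Proof.
elim: t => [|t IH]; first by rewrite /= expn0 divn1 muln1 mul0n.
rewrite [LHS]/= -/(zcol n0 t.+1 z) IH [in RHS]/= mulnDl -!addnA; congr (_ + _)%N.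
by rewrite addnC [(n0 ^ t.+1)%N]expnSr mulnA -divnMA -expnS.
Qed.

(** Interleaving digits is a bijection between codes and pairs (row, column). *)
Lemma zsum n0 t (g : nat -> nat -> R) : (0 < n0)%N ->
  \sum_(x < (n0 * n0) ^ t) g (zrow n0 t x) (zcol n0 t x) =
  \sum_(i < n0 ^ t) \sum_(j < n0 ^ t) g i j.
Proof.
move=> n00; elim: t g => [|t IH] g; first by rewrite !expn0 !big_ord1.
have q0 : (0 < n0 * n0)%N by rewrite muln_gt0 n00.
rewrite expnSr (sum_ord_mul _ _ (fun x => g (zrow n0 t.+1 x) (zcol n0 t.+1 x))).
transitivity (\sum_(x < (n0 * n0) ^ t) \sum_(d1 < n0) \sum_(d2 < n0)
    g (zrow n0 t x * n0 + d1)%N (zcol n0 t x * n0 + d2)%N).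
  apply: eq_bigr => x _.
  rewrite (sum_ord_mul _ _ (fun j => g (zrow n0 t.+1 (x * (n0 * n0) + j))
    (zcol n0 t.+1 (x * (n0 * n0) + j)))).
  apply: eq_bigr => d1 _; apply: eq_bigr => d2 _.
  have dlt : (d1 * n0 + d2 < n0 * n0)%N.
    have : (d1.+1 * n0 <= n0 * n0)%N by rewrite leq_mul2r ltn_ord orbT.
    by rewrite mulSn; have := ltn_ord d2; lia.
  rewrite zrowS zcolS !divnMDl// (divn_small dlt) addn0 !modnMDl (modn_small dlt).
  by rewrite divnMDl// divn_small// addn0 modnMDl modn_small.
rewrite (IH (fun i j => \sum_(d1 < n0) \sum_(d2 < n0) g (i * n0 + d1)%N (j * n0 + d2)%N)).
rewrite expnSr (sum_ord_mul _ _ (fun i => \sum_(j < n0 ^ t * n0) g i j)).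
apply: eq_bigr => i _; rewrite exchange_big; apply: eq_bigr => d1 _ /=.
by rewrite (sum_ord_mul _ _ (fun j => g (i * n0 + d1)%N j)).
Qed.

Variables (n0 r : nat) (u v w : nat -> nat -> R).
Hypotheses (n0_gt0 : (0 < n0)%N) (r_gt0 : (0 < r)%N).
Let q := (n0 * n0)%N.
Hypothesis brentP : forall z x y, (z < q)%N -> (x < q)%N -> (y < q)%N ->
  \sum_(l < r) w z l * (u l x * v l y) =
  ((x %/ n0 == z %/ n0) && (x %% n0 == y %/ n0) && (y %% n0 == z %% n0))%N%:R.

Lemma eq_digits (a b a' b' : nat) : (b < n0)%N -> (b' < n0)%N ->
  (a * n0 + b == a' * n0 + b')%N = (a == a') && (b == b').
Proof.
move=> hb hb'; apply/eqP/andP => [E|[/eqP-> /eqP->]//].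
have := congr1 (divn^~ n0) E; have := congr1 (modn^~ n0) E.
rewrite /= !modnMDl !divnMDl// !divn_small// !addn0 !modn_small// => -> ->.
by rewrite !eqxx.
Qed.

(** The Kronecker power of a matrix multiplication tensor is the tensor of the larger size: the
    Brent equations multiply digit by digit. *)
Lemma brent_kron t z x y : (z < q ^ t)%N -> (x < q ^ t)%N -> (y < q ^ t)%N ->
  \sum_(l < r ^ t) kron w r q t z l * (kron u q r t l x * kron v q r t l y) =
  ((zrow n0 t x == zrow n0 t z) && (zcol n0 t x == zrow n0 t y)
    && (zcol n0 t y == zcol n0 t z))%N%:R.
Proof.
have q0 : (0 < q)%N by rewrite muln_gt0 n0_gt0.
elim: t z x y => [|t IH] z x y; first by rewrite expn0 big_ord1 /= !mulr1.
rewrite !expnSr => hz hx hy.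
have dl (s : nat) : (s < q ^ t * q)%N -> (s %/ q < q ^ t)%N by rewrite ltn_divLR.
have ml (s : nat) : ((s %% q) %/ n0 < n0)%N by rewrite ltn_divLR// ltn_pmod.
rewrite (sum_ord_mul _ _ (fun l => kron w r q t.+1 z l *
  (kron u q r t.+1 l x * kron v q r t.+1 l y))).
rewrite !zrowS !zcolS -/q !eq_digits ?ml ?ltn_pmod//.
transitivity ((\sum_(l < r ^ t) kron w r q t (z %/ q) l *
     (kron u q r t l (x %/ q) * kron v q r t l (y %/ q))) *
   \sum_(l < r) w (z %% q)%N l * (u l (x %% q)%N * v l (y %% q)%N)).
  rewrite mulr_suml; apply: eq_bigr => l _; rewrite mulr_sumr.
  apply: eq_bigr => d _ /=; rewrite divnMDl// (divn_small (ltn_ord d)) addn0.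
  by rewrite modnMDl (modn_small (ltn_ord d)); ring.
rewrite IH ?dl// brentP ?ltn_pmod// -natrM mulnb; congr (nat_of_bool _)%:R.
by do ![case: (_ == _)].
Qed.

Definition mmx L (a : nat -> R) : nat -> R :=
  stages w r q L L (fun l => stages u q r L L a l * stages v q r L L a l).

(** Expanding both transforms gives a double sum over codes x and y, weighted by the left-hand side
    of [brent_kron]. The indicator keeps x in the row of z, y in the column of z, and forces their
    inner indices to agree. *)
Lemma mmxE L (A : nat -> nat -> R) a z : (z < q ^ L)%N ->
  (forall x, (x < q ^ L)%N -> a x = A (zrow n0 L x) (zcol n0 L x)) ->
  mmx L a z = \sum_(k < n0 ^ L) A (zrow n0 L z) k * A k (zcol n0 L z).
Proof.
move=> zq Ha; have q0 : (0 < q)%N by rewrite muln_gt0 n0_gt0.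
rewrite /mmx stagesE//.
transitivity (\sum_(x < q ^ L) \sum_(y < q ^ L)
  ((zrow n0 L x == zrow n0 L z) && (zcol n0 L x == zrow n0 L y)
    && (zcol n0 L y == zcol n0 L z))%N%:R * (a x * a y)).
  transitivity (\sum_(l < r ^ L) \sum_(x < q ^ L) \sum_(y < q ^ L)
     (kron w r q L z l * (kron u q r L l x * kron v q r L l y)) * (a x * a y)).
    apply: eq_bigr => l _; rewrite !stagesE// mulr_suml mulr_sumr.
    apply: eq_bigr => x _; rewrite mulr_sumr mulr_sumr; apply: eq_bigr => y _.
    by ring.
  rewrite exchange_big /=; apply: eq_bigr => x _; rewrite exchange_big /=.
  by apply: eq_bigr => y _; rewrite -mulr_suml brent_kron.
set zr := zrow n0 L z; set zc := zcol n0 L z.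
have zrl : (zr < n0 ^ L)%N by exact: zrow_lt.
have zcl : (zc < n0 ^ L)%N by exact: zcol_lt.
transitivity (\sum_(x < q ^ L) \sum_(i < n0 ^ L) \sum_(j < n0 ^ L)
  ((zrow n0 L x == zr) && (zcol n0 L x == i) && (nat_of_ord j == zc))%N%:R *
    (A (zrow n0 L x) (zcol n0 L x) * A i j)).
  apply: eq_bigr => x _.
  rewrite -(zsum _ (fun i j => ((zrow n0 L x == zr) && (zcol n0 L x == i) && (j == zc))%N%:R *
    (A (zrow n0 L x) (zcol n0 L x) * A i j)))//.
  by apply: eq_bigr => y _; rewrite !Ha.
rewrite (zsum _ (fun i' j' => \sum_(i < n0 ^ L) \sum_(j < n0 ^ L)
  ((i' == zr) && (j' == i) && (nat_of_ord j == zc))%N%:R * (A i' j' * A i j)))//.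
rewrite (bigD1 (Ordinal zrl))//= [X in _ + X]big1 ?addr0; last first.
  move=> i; rewrite -val_eqE /= => /negbTE ne; apply: big1 => j _.
  by apply: big1 => i2 _; apply: big1 => j2 _; rewrite ne mul0r.
apply: eq_bigr => k _; rewrite (bigD1 k)//= [X in _ + X]big1 ?addr0; last first.
  move=> i; rewrite -val_eqE /= eq_sym => /negbTE ne.
  by apply: big1 => j _; rewrite ne andbF mul0r.
rewrite (bigD1 (Ordinal zcl))//= big1 ?addr0 ?eqxx ?mul1r//.
by move=> j; rewrite -val_eqE /= => /negbTE->; rewrite ?andbF mul0r.
Qed.
End Kronecker.

(** * Rounding errors *)

Lemma normM_le (R : realDomainType) (x y a b : R) :
  `|x| <= a -> `|y| <= b -> `|x * y| <= a * b.
Proof. by move=> ha hb; rewrite normrM ler_pM. Qed.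

Lemma norm_sum_le (R : realDomainType) n (f : nat -> R) (h : R) :
  (forall i, (i < n)%N -> `|f i| <= h) -> `|\sum_(i < n) f i| <= n%:R * h.
Proof.
move=> H; apply: (le_trans (ler_norm_sum _ _ _)).
rewrite -[n in n%:R]card_ord -sum1_card natr_sum mulr_suml.
by apply: ler_sum => i _; rewrite mul1r H.
Qed.

(** Error coefficient of [fdot], in units of the roundoff. A step adds 3 for the rounded product and
    coefficient, then D + 4 plus the previous coefficient for rounding the new partial sum. It is
    exponential in [D], which is harmless since [D] is a fixed constant of the program. *)
Fixpoint gam (D : nat) : nat := if D is d.+1 then (2 * gam d + d + 7)%N else 0%N.

Definition mktab {R : Type} (rows cols : nat) (f : nat -> nat -> R) : seq R :=
  mkseq (fun i => f (i %/ cols)%N (i %% cols)%N) (rows * cols).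

Lemma nth_mktab {R : nmodType} rows cols (f : nat -> nat -> R) k d :
  (k < rows)%N -> (d < cols)%N -> (mktab rows cols f)`_(k * cols + d) = f k d.
Proof.
move=> hk hd; have c0 : (0 < cols)%N by case: cols hd.
rewrite nth_mkseq; first by rewrite divnMDl// divn_small// addn0 modnMDl modn_small.
have : (k.+1 * cols <= rows * cols)%N by rewrite leq_mul2r hk orbT.
by rewrite mulSn; lia.
Qed.

Section FloatError.
Context {R : realType} (u : R) (F : fp_arith R).
Hypotheses (Fu : fp_model u F) (u_ge0 : 0 <= u) (u_le1 : u <= 1).

Lemma flP o a b : o <> FDiv ->
  exists2 delta : R, `|delta| <= u & fl F o a b = (1 + delta) * flop_exact o a b.
Proof. by move=> oD; apply: Fu.1. Qed.

(** A relative error leaves 0 exact, so padding and initial accumulators introduce no error. *)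
Lemma fl_cst0 : fl_cst F 0 = 0.
Proof. by have [d _ ->] := Fu.2 0; rewrite mulr0. Qed.

Lemma fl_cst_err c m : `|c| <= m -> `|fl_cst F c - c| <= u * m.
Proof.
move=> cm; have [d du ->] := Fu.2 c.
rewrite (_ : (1 + d) * c - c = d * c); last by ring.
exact: normM_le.
Qed.

(** [al'] stands for the rounded coefficients and [al] for the exact ones. Terms of higher order in
    the roundoff are absorbed using [u <= 1]. *)
Lemma fdot_err (al' al x : nat -> R) (m a : R) D : 0 <= m -> 0 <= a ->
  (forall d, (d < D)%N -> `|al d| <= m) ->
  (forall d, (d < D)%N -> `|al' d - al d| <= u * m) ->
  (forall d, (d < D)%N -> `|x d| <= a) ->
  `|fdot F al' x D - \sum_(d < D) al d * x d| <= u * (gam D)%:R * (m * a).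
Proof.
move=> m0 a0; elim: D => [|D IH] Hal Hal' Hx.
  by rewrite big_ord0 /= fl_cst0 subrr normr0 mulr0 mul0r.
rewrite big_ord_recr /=.
set S := \sum_(d < D) _; set h := m * a.
have h0 : 0 <= h by exact: mulr_ge0.
have {}IH : `|fdot F al' x D - S| <= u * (gam D)%:R * h.
  by apply: IH => d dD; [apply: Hal|apply: Hal'|apply: Hx]; lia.
have hS : `|S| <= D%:R * h.
  apply: (norm_sum_le (f := fun d => al d * x d)) => d dD.
  by apply: normM_le; [apply: Hal|apply: Hx]; lia.
have [d1 hd1 ->] : exists2 d, `|d| <= u & fl F FMul (al' D) (x D) = (1 + d) * (al' D * x D).
  exact: (@flP FMul).
set T := (1 + d1) * _; set acc := fdot _ _ _ _ in IH *.
have [d2 hd2 ->] : exists2 d, `|d| <= u & fl F FAdd acc T = (1 + d) * (acc + T).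
  exact: (@flP FAdd).
have hal : `|al' D| <= 2 * m.
  have := ler_normD (al' D - al D) (al D); rewrite subrK.
  have := Hal' D (ltnSn _); have := Hal D (ltnSn _).
  have : u * m <= m by rewrite ler_piMl.
  lra.
have hT : `|T - al D * x D| <= 3 * u * h.
  rewrite (_ : T - _ = d1 * (al' D * x D) + (al' D - al D) * x D); last by rewrite /T; ring.
  have q1 := normM_le hd1 (normM_le hal (Hx D (ltnSn _))).
  have q2 := normM_le (Hal' D (ltnSn _)) (Hx D (ltnSn _)).
  apply: (le_trans (ler_normD _ _)); rewrite /h; move: q1 q2; lra.
have hX : `|acc + T - (S + al D * x D)| <= u * ((gam D)%:R + 3) * h.
  rewrite (_ : _ - _ = (acc - S) + (T - al D * x D)); last by ring.
  by apply: (le_trans (ler_normD _ _)); lra.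
have hSt : `|S + al D * x D| <= (D%:R + 1) * h.
  apply: (le_trans (ler_normD _ _)).
  have := normM_le (Hal D (ltnSn _)) (Hx D (ltnSn _)); rewrite -/h; lra.
have hX2 : `|acc + T| <= (D%:R + 4 + (gam D)%:R) * h.
  have := ler_normD (acc + T - (S + al D * x D)) (S + al D * x D); rewrite subrK.
  have : u * ((gam D)%:R + 3) * h <= ((gam D)%:R + 3) * h.
    by rewrite -mulrA ler_piMl// mulr_ge0// addr_ge0.
  lra.
rewrite (_ : (1 + d2) * (acc + T) - _ =
  (acc + T - (S + al D * x D)) + d2 * (acc + T)); last by ring.
apply: (le_trans (ler_normD _ _)).
have := normM_le hd2 hX2; rewrite !natrD ?natrM; lra.
Qed.

Lemma stage_bound (M : nat -> nat -> R) D D' I v m a k : (0 < D')%N -> 0 <= m ->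
  (forall l d, (l < D')%N -> (d < D)%N -> `|M l d| <= m) ->
  (forall x, (x < D * I)%N -> `|v x| <= a) -> (k < I * D')%N ->
  `|stage M D D' I v k| <= D%:R * (m * a).
Proof.
move=> D'0 m0 HM Hv kI.
apply: (norm_sum_le (f := fun d => M (k %% D')%N d * v (d * I + k %/ D')%N)) => d dD.
by apply: normM_le; [apply: HM; rewrite ?ltn_pmod|apply/Hv/stage_index].
Qed.

Lemma stageB (M : nat -> nat -> R) D D' I v v' k :
  stage M D D' I v k - stage M D D' I v' k = stage M D D' I (fun x => v x - v' x) k.
Proof. by rewrite /stage -sumrB; apply: eq_bigr => d _; rewrite mulrBr. Qed.

Section Stages.
Variables (tab : nat -> R) (M : nat -> nat -> R) (D D' : nat) (m beta Gamma : R).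
Hypotheses (D'_gt0 : (0 < D')%N) (m_ge0 : 0 <= m).
Hypothesis M_le : forall l d, (l < D')%N -> (d < D)%N -> `|M l d| <= m.
Hypothesis tab_err : forall l d, (l < D')%N -> (d < D)%N ->
  `|tab (l * D + d)%N - M l d| <= u * m.
Hypotheses (beta_ge1 : 1 <= beta) (Dm_le : D%:R * m <= beta) (m_le : m <= beta).
Hypotheses (Gamma_ge : u * (gam D)%:R <= Gamma) (Gamma_le1 : Gamma <= 1).

(** A stage multiplies exact values by at most beta. The inherited error contributes one beta times
    the old bound and the new rounding two, hence growth by [3 * beta]. *)
Lemma fstages_err L (v : nat -> R) (a : R) t : 0 <= a ->
  (forall x, (x < D ^ L)%N -> `|v x| <= a) -> (t <= L)%N ->
  forall k, (k < D ^ (L - t) * D' ^ t)%N ->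
  `|stages M D D' L t v k| <= beta ^+ t * a /\
  `|fstages F tab D D' L t v k - stages M D D' L t v k| <= Gamma * (3 * beta) ^+ t * a.
Proof.
move=> a0 Hv.
have G0 : 0 <= Gamma by apply: le_trans Gamma_ge; rewrite mulr_ge0.
have b0 : 0 <= beta by apply: le_trans beta_ge1.
elim: t => [|t IH] tL k kI.
  rewrite subn0 muln1 in kI; rewrite /= expr0 mul1r subrr normr0; split.
    exact: Hv.
  by rewrite expr0 mulr1 mulr_ge0.
set I := (D ^ (L - t.+1) * D' ^ t)%N.
have kI' : (k < I * D')%N by rewrite -mulnA -expnSr.
have DI : (D * I = D ^ (L - t) * D' ^ t)%N by exact: stage_size.
have {}IH x : (x < D * I)%N ->
    `|stages M D D' L t v x| <= beta ^+ t * a /\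
    `|fstages F tab D D' L t v x - stages M D D' L t v x| <= Gamma * (3 * beta) ^+ t * a.
  by rewrite DI; apply: IH; exact: ltnW.
set p := beta ^+ t in IH *; set p3 := (3 * beta) ^+ t in IH *.
have p0 : 0 <= p by exact: exprn_ge0.
have pp3 : p <= p3 by rewrite lerXn2r ?nnegrE//; lra.
have p30 : 0 <= p3 by exact: le_trans pp3.
rewrite /= -/I; split.
  have := stage_bound D'_gt0 m_ge0 M_le (fun x h => (IH x h).1) kI'.
  move=> h; apply: (le_trans h); rewrite exprS -/p mulrA -[beta * p * a]mulrA.
  by apply: ler_wpM2r => //; exact: mulr_ge0.
set vt := fstages _ _ _ _ _ _ _; set et := stages _ _ _ _ _ _.
have hv x : (x < D * I)%N -> `|vt x| <= (p + Gamma * p3) * a.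
  move=> xI; have [h1 h2] := IH x xI.
  by have := ler_normD (vt x - et x) (et x); rewrite subrK /vt /et; lra.
have A1 : `|fstage F tab D D' I vt k - stage M D D' I vt k| <=
    Gamma * (beta * ((p + Gamma * p3) * a)).
  apply: le_trans (_ : u * (gam D)%:R * (m * ((p + Gamma * p3) * a)) <= _).
    apply: (fdot_err (al := fun d => M (k %% D')%N d)
      (x := fun d => vt (d * I + k %/ D')%N)) => //.
    - by rewrite mulr_ge0// addr_ge0// mulr_ge0.
    - by move=> d dD; apply: M_le; rewrite ?ltn_pmod.
    - by move=> d dD; apply: tab_err; rewrite ?ltn_pmod.
    - by move=> d dD; apply/hv/stage_index.
  apply: ler_pM => //; rewrite ?mulr_ge0// ?addr_ge0 ?mulr_ge0//.
  by apply: ler_wpM2r => //; rewrite mulr_ge0// addr_ge0 ?mulr_ge0.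
have A2 : `|stage M D D' I vt k - stage M D D' I et k| <= beta * (Gamma * p3 * a).
  rewrite stageB.
  apply: le_trans (stage_bound (a := Gamma * p3 * a) D'_gt0 m_ge0 M_le _ kI') _.
    by move=> x xI; exact: (IH x xI).2.
  by rewrite mulrA; apply: ler_wpM2r => //; rewrite !mulr_ge0.
have := ler_normD (fstage F tab D D' I vt k - stage M D D' I vt k)
  (stage M D D' I vt k - stage M D D' I et k).
rewrite addrA subrK => h; apply: (le_trans h).
have A3 : Gamma * (beta * ((p + Gamma * p3) * a)) <= Gamma * (beta * (2 * p3 * a)).
  do 2 (apply: ler_wpM2l => //); apply: ler_wpM2r => //.
  have : Gamma * p3 <= p3 by exact: ler_piMl.
  by lra.
by rewrite exprS -/p3; move: A1 A2 A3; lra.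
Qed.
End Stages.

Variables (n0 r : nat) (mu mv mw : nat -> nat -> R) (m beta Gamma : R).
Let q := (n0 * n0)%N.
Hypotheses (n0_gt0 : (0 < n0)%N) (qr : (q <= r)%N) (m_ge0 : 0 <= m).
Hypothesis mu_le : forall l x, (l < r)%N -> (x < q)%N -> `|mu l x| <= m.
Hypothesis mv_le : forall l x, (l < r)%N -> (x < q)%N -> `|mv l x| <= m.
Hypothesis mw_le : forall z l, (z < q)%N -> (l < r)%N -> `|mw z l| <= m.
Hypotheses (beta_ge1 : 1 <= beta) (rm_le : r%:R * m <= beta).
Hypotheses (Gamma_ge : u * (gam r)%:R <= Gamma) (Gamma_le1 : Gamma <= 1).

Lemma gam_mono D D' : (D <= D')%N -> (gam D <= gam D')%N.
Proof.
by elim: D' D => [|D' IH] [|D]// DD' /=; have := IH D DD'; lia.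
Qed.

(** A pointwise product has error constant 7: 2 + 1 from the errors of its factors, 4 from its
    rounding. The backward transform carries this 7 along and adds 8, since its rounded input is at
    most 8 times the exact bound; this gives 15. *)
Lemma fmm_err L (a : nat -> R) (b : R) z : 0 <= b ->
  (forall x, (x < q ^ L)%N -> `|a x| <= b) -> (z < q ^ L)%N ->
  `|fmm F (tabfl F (mktab r q mu)) (tabfl F (mktab r q mv)) (tabfl F (mktab q r mw))
     q r L a z - mmx n0 r mu mv mw L a z| <= 15 * Gamma * ((3 * beta) ^+ L) ^+ 3 * b ^+ 2.
Proof.
move=> b0 Ha zq.
have q0 : (0 < q)%N by rewrite muln_gt0 n0_gt0.
have r0 : (0 < r)%N by exact: leq_trans qr.
have G0 : 0 <= Gamma by apply: le_trans Gamma_ge; rewrite mulr_ge0.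
have m_le : m <= beta.
  by apply: le_trans rm_le; rewrite ler_peMl// ler1n.
have qm_le : q%:R * m <= beta.
  by apply: le_trans rm_le; apply: ler_wpM2r => //; rewrite ler_nat.
have uG : u <= Gamma.
  apply: le_trans Gamma_ge; rewrite ler_peMr// ler1n.
  by case: (r) r0 => //= r' _; lia.
have Gq : u * (gam q)%:R <= Gamma.
  by apply: le_trans Gamma_ge; rewrite ler_wpM2l// ler_nat gam_mono.
have te rows cols (f : nat -> nat -> R) l d : (l < rows)%N -> (d < cols)%N ->
    `|f l d| <= m -> `|tabfl F (mktab rows cols f) (l * cols + d)%N - f l d| <= u * m.
  by move=> hl hd hf; rewrite /tabfl nth_mktab//; exact: fl_cst_err.
set B := (3 * beta) ^+ L.
have b0' : 0 <= beta by exact: le_trans beta_ge1.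
have b3 : 1 <= 3 * beta by move: beta_ge1; lra.
have Bb : beta ^+ L <= B.
  by apply: lerXn2r; rewrite ?nnegrE//; move: b0'; lra.
have B1 : 1 <= B by rewrite exprn_ege1.
have key f l : (forall l x, (l < r)%N -> (x < q)%N -> `|f l x| <= m) -> (l < r ^ L)%N ->
    `|stages f q r L L a l| <= B * b /\
    `|fstages F (tabfl F (mktab r q f)) q r L L a l - stages f q r L L a l| <= Gamma * B * b.
  move=> hf lr; have := fstages_err r0 m_ge0 hf (fun l d hl hd => te r q f l d hl hd (hf l d hl hd))
    beta_ge1 qm_le m_le Gq Gamma_le1 b0 Ha (leqnn L) (k := l).
  rewrite subnn mul1n => /(_ lr)[h1 h2]; split=> //.
  by apply: (le_trans h1); exact: ler_wpM2r.
pose c' l := fl F FMul (fstages F (tabfl F (mktab r q mu)) q r L L a l)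
  (fstages F (tabfl F (mktab r q mv)) q r L L a l).
pose c l := stages mu q r L L a l * stages mv q r L L a l.
have hc l : (l < r ^ L)%N -> `|c l| <= (B * b) ^+ 2 /\ `|c' l - c l| <= 7 * Gamma * (B * b) ^+ 2.
  move=> lr; have [u1 u2] := key mu l mu_le lr; have [v1 v2] := key mv l mv_le lr.
  split; first by rewrite expr2; exact: normM_le.
  rewrite /c' /c.
  set U' := fstages _ _ _ _ _ _ _ _ in u2 *; set V' := fstages _ _ _ _ _ _ _ _ in v2 *.
  set U := stages _ _ _ _ _ _ _ in u1 u2 *; set V := stages _ _ _ _ _ _ _ in v1 v2 *.
  have [d hd ->] : exists2 d, `|d| <= u & fl F FMul U' V' = (1 + d) * (U' * V').
    exact: (@flP FMul).
  set e := Gamma * B * b in u2 v2.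
  have Bb0 : 0 <= B * b by rewrite mulr_ge0//; lra.
  have e0 : 0 <= e by rewrite /e -mulrA mulr_ge0.
  have eb : e <= B * b by rewrite /e -mulrA ler_piMl.
  have U2 : `|U'| <= 2 * (B * b) by have := ler_normD (U' - U) U; rewrite subrK; lra.
  have V2 : `|V'| <= 2 * (B * b) by have := ler_normD (V' - V) V; rewrite subrK; lra.
  rewrite (_ : (1 + d) * (U' * V') - U * V =
    (U' - U) * V' + U * (V' - V) + d * (U' * V')); last by ring.
  have t1 := normM_le u2 V2; have t2 := normM_le u1 v2.
  have t3 := normM_le (le_trans hd uG) (normM_le U2 V2).
  apply: (le_trans (ler_normD _ _)).
  have := ler_normD ((U' - U) * V') (U * (V' - V)).
  by move: t1 t2 t3; rewrite /e; lra.
have C0 : 0 <= (B * b) ^+ 2 by exact: sqr_ge0.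
have hc' l : (l < r ^ L)%N -> `|c' l| <= 8 * (B * b) ^+ 2.
  move=> lr; have [h1 h2] := hc l lr; have := ler_normD (c' l - c l) (c l); rewrite subrK.
  have : Gamma * (B * b) ^+ 2 <= (B * b) ^+ 2 by exact: ler_piMl.
  by lra.
have zq' : (z < r ^ (L - L) * q ^ L)%N by rewrite subnn mul1n.
have C8 : 0 <= 8 * (B * b) ^+ 2 by rewrite mulr_ge0.
have [_ w1] := fstages_err q0 m_ge0 mw_le
  (fun l d hl hd => te q r mw l d hl hd (mw_le hl hd))
  beta_ge1 rm_le m_le Gamma_ge Gamma_le1 C8 hc' (leqnn L) zq'.
have E : stages mw r q L L c' z - stages mw r q L L c z =
    stages mw r q L L (fun l => c' l - c l) z.
  by rewrite !stagesE// -sumrB; apply: eq_bigr => x _; rewrite mulrBr.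
have C7 : 0 <= 7 * Gamma * (B * b) ^+ 2.
  by apply: mulr_ge0 => //; exact: mulr_ge0.
have [w2 _] := fstages_err q0 m_ge0 mw_le
  (fun l d hl hd => te q r mw l d hl hd (mw_le hl hd))
  beta_ge1 rm_le m_le Gamma_ge Gamma_le1 C7 (fun l h => (hc l h).2) (leqnn L) zq'.
rewrite [fmm _ _ _ _ _ _ _ _ _](_ : _ = fstages F (tabfl F (mktab q r mw)) r q L L c' z)//.
rewrite [mmx _ _ _ _ _ _ _ _](_ : _ = stages mw r q L L c z)//.
have := ler_normD (fstages F (tabfl F (mktab q r mw)) r q L L c' z - stages mw r q L L c' z)
  (stages mw r q L L c' z - stages mw r q L L c z).
rewrite addrA subrK => h; apply: (le_trans h).
have w2' : `|stages mw r q L L c' z - stages mw r q L L c z| <= B * (7 * Gamma * (B * b) ^+ 2).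
  by rewrite E; apply: (le_trans w2); exact: ler_wpM2r.
by move: w1 w2'; rewrite -/B; lra.
Qed.
End FloatError.

(** * Norms of the powers of a symmetric matrix *)

Section SymmetricNorms.
Context {R : realType}.

(** By Lagrange's identity, the difference of the two sides is half the double sum of the squares of
    [f i * g j - f j * g i]. *)
Lemma cauchy_schwarz_sum (I : finType) (f g : I -> R) :
  (\sum_i f i * g i) ^+ 2 <= (\sum_i f i ^+ 2) * (\sum_i g i ^+ 2).
Proof.
set P := \sum_i _ * _; set X := \sum_i f i ^+ 2; set Y := \sum_i g i ^+ 2.
have : 0 <= \sum_i \sum_j (f i * g j - f j * g i) ^+ 2.
  by apply: sumr_ge0 => i _; apply: sumr_ge0 => j _; exact: sqr_ge0.
have -> : \sum_i \sum_j (f i * g j - f j * g i) ^+ 2 =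
    \sum_i (f i ^+ 2 * Y + g i ^+ 2 * X - f i * g i * (2 * P)).
  apply: eq_bigr => i _; rewrite /Y /X /P !mulr_sumr -big_split -sumrB /=.
  by apply: eq_bigr => j _; ring.
rewrite sumrB big_split /= -!mulr_suml -/P -/X -/Y; lra.
Qed.

Variable N : nat.
Implicit Types (x : 'cV[R]_N) (S P : 'M[R]_N).

Definition nrm2 x : R := \sum_i x i 0 ^+ 2.

Lemma nrm2_ge0 x : 0 <= nrm2 x.
Proof. by apply: sumr_ge0 => i _; exact: sqr_ge0. Qed.

Definition frob2 P : R := \sum_i \sum_j P i j ^+ 2.

Lemma nrm2_frob P x : nrm2 (P *m x) <= frob2 P * nrm2 x.
Proof.
rewrite /nrm2 /frob2 mulr_suml; apply: ler_sum => i _; rewrite mxE.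
exact: (cauchy_schwarz_sum (fun j => P i j) (fun j => x j 0)).
Qed.

Lemma nrm2_delta j : nrm2 (delta_mx j 0 : 'cV[R]_N) = 1.
Proof.
rewrite /nrm2 (bigD1 j)//= big1 ?addr0; first by rewrite mxE !eqxx expr1n.
by move=> i /negbTE ij; rewrite mxE ij expr0n.
Qed.

Lemma nrm2_col P j : nrm2 (P *m delta_mx j 0) = \sum_i P i j ^+ 2.
Proof.
apply: eq_bigr => i _; rewrite mxE (bigD1 j)//= big1 ?addr0.
  by rewrite mxE !eqxx mulr1.
by move=> k /negbTE kj; rewrite mxE kj mulr0.
Qed.

Definition sqpow k S : 'M[R]_N := iter k (fun P => P *m P) S.

Lemma sqpow_sym k S : S^T = S -> (sqpow k S)^T = sqpow k S.
Proof. by move=> Ssym; elim: k => //= k IH; rewrite trmx_mul IH. Qed.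

Variables (S : 'M[R]_N) (s : R).
Hypotheses (S_sym : S^T = S) (s_ge0 : 0 <= s).
Hypothesis s_ub : forall x, nrm2 (S *m x) <= s ^+ 2 * nrm2 x.
Hypothesis s_lub : forall c, 0 <= c ->
  (forall x, nrm2 (S *m x) <= c * nrm2 x) -> s ^+ 2 <= c.

(** The hypotheses [s_ub] and [s_lub] say that [s] is the operator norm of [S]; the estimates of
    this section rest on them and on symmetry alone. *)
Lemma sqpow_ub k x : nrm2 (sqpow k S *m x) <= (s ^+ (2 ^ k)) ^+ 2 * nrm2 x.
Proof.
elim: k x => [|k IH] x; first by rewrite expn0 expr1.
rewrite /= -mulmxA; apply: (le_trans (IH _)).
apply: (le_trans (ler_wpM2l _ (IH x))); first exact: sqr_ge0.
by rewrite expnS mulnC exprM mulrA -expr2 -!exprM.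
Qed.

Lemma sqpow_entry k i j : `|sqpow k S i j| <= s ^+ (2 ^ k).
Proof.
have e0 : 0 <= s ^+ (2 ^ k) by exact: exprn_ge0.
rewrite -ler_sqr ?nnegrE// real_normK ?num_real//.
have := sqpow_ub k (delta_mx j 0); rewrite nrm2_col nrm2_delta mulr1.
apply: le_trans; rewrite (bigD1 i)//= lerDl.
by apply: sumr_ge0 => l _; exact: sqr_ge0.
Qed.

Lemma frob2_le k : frob2 (sqpow k S) <= N%:R * (s ^+ (2 ^ k)) ^+ 2.
Proof.
rewrite /frob2 exchange_big /=.
rewrite -[N in N%:R]card_ord -sum1_card natr_sum mulr_suml.
apply: ler_sum => j _; rewrite mul1r.
by have := sqpow_ub k (delta_mx j 0); rewrite nrm2_col nrm2_delta mulr1.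
Qed.

(* |Px|^4 = <x, P^2 x>^2 <= |x|^2 |P^2 x|^2 for symmetric P. *)
Lemma nrm2_sq P x : P^T = P -> nrm2 (P *m x) ^+ 2 <= nrm2 x * nrm2 ((P *m P) *m x).
Proof.
move=> Psym.
have E1 : nrm2 (P *m x) = ((P *m x)^T *m (P *m x)) 0 0.
  by rewrite mxE; apply: eq_bigr => i _; rewrite [(P *m x)^T 0 i]mxE expr2.
have E2 (z : 'cV[R]_N) : (x^T *m z) 0 0 = \sum_j x j 0 * z j 0.
  by rewrite mxE; apply: eq_bigr => j _; rewrite mxE.
have -> : nrm2 (P *m x) = \sum_j x j 0 * ((P *m P) *m x) j 0.
  by rewrite E1 -E2 trmx_mul Psym !mulmxA.
exact: cauchy_schwarz_sum.
Qed.

(** If [c] bounds the squared norm for P ^ 2, then [nrm2_sq] makes sqrt c a bound for P. So the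
    operator norm of P ^ 2 is at least the square of that of P. *)
Lemma sqpow_lub k c : 0 <= c ->
  (forall x, nrm2 (sqpow k S *m x) <= c * nrm2 x) -> (s ^+ (2 ^ k)) ^+ 2 <= c.
Proof.
elim: k c => [|k IH] c c0 H; first by rewrite expn0 expr1; exact: s_lub.
have h : (s ^+ (2 ^ k)) ^+ 2 <= Num.sqrt c.
  apply: IH => [|x]; first exact: sqrtr_ge0.
  rewrite -ler_sqr ?nnegrE ?nrm2_ge0//; last by rewrite mulr_ge0 ?sqrtr_ge0 ?nrm2_ge0.
  apply: (le_trans (nrm2_sq x (sqpow_sym k S_sym))).
  rewrite exprMn sqr_sqrtr// expr2 mulrCA; apply: ler_wpM2l; first exact: nrm2_ge0.
  exact: H.
rewrite expnS mulnC exprM -(sqr_sqrtr c0) ler_sqr ?nnegrE ?sqrtr_ge0//.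
by rewrite exprn_ge0// exprn_ge0.
Qed.

(** The squared Frobenius norm is an admissible constant in [sqpow_lub]. *)
Lemma frob2_ge k : (s ^+ (2 ^ k)) ^+ 2 <= frob2 (sqpow k S).
Proof.
apply: sqpow_lub => [|x]; last exact: nrm2_frob.
by apply: sumr_ge0 => i _; apply: sumr_ge0 => j _; exact: sqr_ge0.
Qed.

End SymmetricNorms.

(** * The real symmetric matrix of a Hermitian matrix *)

Section SpectralNormInput.
Context {R : realType} (n : nat) (A : 'M[R[i]]_n) (N : nat).
Hypotheses (A_herm : A \is hermsymmx) (nN : (2 * n <= N)%N).

Definition symfun (i j : nat) : R :=
  if (i < 2 * n)%N && (j < 2 * n)%N then input_mem A 0 (symadr n i j) else 0.

Definition symmx : 'M[R]_N := \matrix_(i, j) symfun i j.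

Lemma herm_entry (i j : 'I_n) : A i j = conjc (A j i).
Proof.
have /is_hermitianmxP := A_herm; rewrite expr0 scale1r => /matrixP/(_ i j) ->.
by rewrite !mxE.
Qed.

Lemma input_memE eps a b (i j : 'I_n) : a = i :> nat -> b = j :> nat ->
  input_mem A eps (1 + 2 * (a * n + b)) = complex.Re (A i j) /\
  input_mem A eps (2 + 2 * (a * n + b)) = complex.Im (A i j).
Proof.
move=> -> ->.
have n0 : (0 < n)%N by case: (n) i => // -[].
have e1 : ((i * n + j) %/ n = i)%N by rewrite divnMDl// divn_small// addn0.
have e2 : ((i * n + j) %% n = j)%N by rewrite modnMDl modn_small.
rewrite /input_mem !addSn add0n mul2n /= uphalf_double doubleK e1 e2 !valK odd_double.
by [].
Qed.

(** The two off-diagonal blocks are read from the same cells, so their symmetry is automatic; the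
    diagonal blocks use that the real part of A is symmetric. *)
Lemma symfunC i j : symfun i j = symfun j i.
Proof.
rewrite /symfun andbC; case: ifP => // /andP[hj hi].
have sub (a : nat) : (a < 2 * n)%N -> exists k : 'I_n,
    if (n <= a)%N then (a - n = k)%N else a = k.
  move=> ha; have [na|na] := leqP n a; last by exists (Ordinal na).
  have hn : (a - n < n)%N by lia.
  by exists (Ordinal hn).
have [k hk] := sub i hi; have [l hl] := sub j hj; rewrite /symadr.
have [/= E1 E2] : complex.Re (A k l) = complex.Re (A l k) /\
   complex.Im (A k l) = - complex.Im (A l k).
  by rewrite herm_entry; case: (A l k).
move: hk hl; case: (leqP n i) => ni; case: (leqP n j) => nj hk hl.
- by rewrite (input_memE _ hk hl).1 (input_memE _ hl hk).1.
- by [].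
- by [].
- by rewrite (input_memE _ hk hl).1 (input_memE _ hl hk).1.
Qed.

Lemma symmx_sym : symmx^T = symmx.
Proof. by apply/matrixP => i j; rewrite !mxE symfunC. Qed.


Definition get (x : 'cV[R]_N) (k : nat) : R :=
  if insub k is Some i then x i 0 else 0.

(** The first n coordinates are the real parts and the next n the imaginary parts; the padding
    coordinates are dropped. *)
Definition cvec (x : 'cV[R]_N) : 'cV[R[i]]_n :=
  \col_k (get x k +i* get x (n + k))%C.

Definition rvec (y : 'cV[R[i]]_n) : 'cV[R]_N :=
  \col_(i < N) if insub (i : nat) is Some k then complex.Re (y k 0)
    else if insub (i - n)%N is Some k then complex.Im (y k 0) else 0.

Definition l2sq (y : 'cV[R[i]]_n) : R :=
  \sum_i (complex.Re (y i 0) ^+ 2 + complex.Im (y i 0) ^+ 2).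

Lemma getE x (i : 'I_N) : get x i = x i 0.
Proof. by rewrite /get valK. Qed.

Lemma sum_blocks (g : nat -> R) : \sum_(i < N) g i =
  \sum_(i < n) g i + \sum_(i < n) g (n + i)%N + \sum_(i < N - 2 * n) g (2 * n + i)%N.
Proof.
have e : (n + n + (N - 2 * n) = N)%N by lia.
by rewrite -[in LHS]e !big_split_ord /= mul2n -addnn.
Qed.

(** The imaginary part Y of A is antisymmetric, so the block Y^T equals -Y and the matrix is A
    acting on pairs (Re, Im). *)
Lemma symfun_blocks (k l : 'I_n) :
  [/\ symfun k l = complex.Re (A k l), symfun (n + k) l = complex.Im (A k l),
      symfun k (n + l) = - complex.Im (A k l)
    & symfun (n + k) (n + l) = complex.Re (A k l)].
Proof.
have hk := ltn_ord k; have hl := ltn_ord l.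
have lt1 (a : nat) : (a < n)%N -> (a < 2 * n)%N by lia.
have lt2 (a : nat) : (a < n)%N -> (n + a < 2 * n)%N by lia.
have nle (a : nat) : (a < n)%N -> (n <= a)%N = false by move=> h; rewrite leqNgt h.
rewrite /symfun /symadr (lt1 _ hk) (lt1 _ hl) (lt2 _ hk) (lt2 _ hl) /=.
rewrite (nle _ hk) (nle _ hl) !leq_addr !addKn.
rewrite (input_memE _ (erefl (k : nat)) (erefl (l : nat))).1.
rewrite (input_memE _ (erefl (k : nat)) (erefl (l : nat))).2.
rewrite (input_memE _ (erefl (l : nat)) (erefl (k : nat))).2.
by split=> //; rewrite [A k l]herm_entry; case: (A l k) => a b /=; rewrite opprK.
Qed.

Definition symvec (x : 'cV[R]_N) (i : nat) : R := \sum_(j < N) symfun i j * get x j.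

Lemma symvec_blocks x (k : 'I_n) :
  [/\ symvec x k = complex.Re ((A *m cvec x) k 0),
      symvec x (n + k) = complex.Im ((A *m cvec x) k 0)
    & forall i, (2 * n <= i)%N -> symvec x i = 0].
Proof.
have z0 i j : (2 * n <= i)%N || (2 * n <= j)%N -> symfun i j = 0.
  by rewrite /symfun => h; case: ifP => // /andP[]; lia.
have ReD : {morph (@complex.Re R) : a b / a + b} by move=> [? ?] [? ?].
have Re0 : @complex.Re R 0 = 0 by [].
have Im0 : @complex.Im R 0 = 0 by [].
have ReM (z : R[i]) a b :
  complex.Re (z * (a +i* b)%C) = complex.Re z * a - complex.Im z * b by case: z.
have ImM (z : R[i]) a b :
  complex.Im (z * (a +i* b)%C) = complex.Re z * b + complex.Im z * a by case: z.
have ImD : {morph (@complex.Im R) : a b / a + b} by move=> [? ?] [? ?].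
have tail i : \sum_(j < N - 2 * n) symfun i (2 * n + j) * get x (2 * n + j)%N = 0.
  by apply: big1 => j _; rewrite z0 ?mul0r// leq_addr orbT.
split; last by move=> i hi; apply: big1 => j _; rewrite z0 ?mul0r// hi.
- rewrite /symvec (sum_blocks (fun j => symfun k j * get x j)) tail addr0 mxE.
  rewrite (big_morph (@complex.Re R) ReD Re0) -big_split; apply: eq_bigr => l _.
  have [-> _ -> _] := symfun_blocks k l; rewrite mxE ReM.
  by rewrite mulNr.
- rewrite /symvec (sum_blocks (fun j => symfun (n + k) j * get x j)) tail addr0 mxE.
  rewrite (big_morph (@complex.Im R) ImD Im0) -big_split; apply: eq_bigr => l _.
  have [_ -> _ ->] := symfun_blocks k l; rewrite mxE ImM.
  by rewrite addrC.
Qed.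

Lemma nrm2_symmx x : nrm2 (symmx *m x) = l2sq (A *m cvec x).
Proof.
transitivity (\sum_(i < N) symvec x i ^+ 2).
  apply: eq_bigr => i _; congr (_ ^+ 2); rewrite mxE; apply: eq_bigr => j _.
  by rewrite mxE getE.
rewrite (sum_blocks (fun i => symvec x i ^+ 2)) [X in _ + X]big1 ?addr0; last first.
  move=> j _; rewrite /symvec big1 ?expr0n// => j' _.
  by rewrite /symfun ltnNge leq_addr mul0r.
rewrite -big_split; apply: eq_bigr => k _ /=.
by have [-> -> _] := symvec_blocks x k.
Qed.

Lemma l2sq_cvec x : l2sq (cvec x) <= nrm2 x.
Proof.
have -> : nrm2 x = \sum_(i < N) get x i ^+ 2.
  by apply: eq_bigr => i _; rewrite getE.
rewrite (sum_blocks (fun i => get x i ^+ 2)) -big_split /=.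
rewrite (_ : l2sq _ = \sum_(i < n) (get x i ^+ 2 + get x (n + i) ^+ 2)).
  by rewrite lerDl; apply: sumr_ge0 => i _; exact: sqr_ge0.
by apply: eq_bigr => i _; rewrite !mxE.
Qed.

Lemma get_rvec y (k : 'I_n) :
  [/\ get (rvec y) k = complex.Re (y k 0), get (rvec y) (n + k) = complex.Im (y k 0)
    & forall i, (2 * n <= i)%N -> get (rvec y) i = 0].
Proof.
have hk := ltn_ord k.
split.
- have kN : (k < N)%N by lia.
  by rewrite /get insubT mxE /= valK.
- have kN : (n + k < N)%N by lia.
  rewrite /get insubT mxE /= insubF; last by rewrite ltnNge leq_addr.
  by rewrite addKn valK.
- move=> i hi; rewrite /get; case: insubP => // j _ ji; rewrite mxE ji.
  rewrite insubF; last by apply/negbTE; rewrite -leqNgt; lia.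
  by rewrite insubF//; apply/negbTE; rewrite -leqNgt; lia.
Qed.

Lemma rvecK y : cvec (rvec y) = y.
Proof.
apply/matrixP => k j; rewrite ord1 mxE.
by have [-> -> _] := get_rvec y k; case: (y k 0).
Qed.

Lemma nrm2_rvec y : (0 < n)%N -> nrm2 (rvec y) = l2sq y.
Proof.
move=> n0.
have -> : nrm2 (rvec y) = \sum_(i < N) get (rvec y) i ^+ 2.
  by apply: eq_bigr => i _; rewrite getE.
rewrite (sum_blocks (fun i => get (rvec y) i ^+ 2)) [X in _ + X]big1 ?addr0.
  rewrite -big_split; apply: eq_bigr => k _ /=.
  by have [-> -> _] := get_rvec y k.
move=> i _; have [_ _ ->] := get_rvec y (Ordinal n0); first by rewrite expr0n.
exact: leq_addr.
Qed.

Lemma l2normE y : l2norm y = Num.sqrt (l2sq y). Proof. by []. Qed.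

Hypothesis n_gt0 : (0 < n)%N.

Lemma spectral_has_sup :
  has_sup [set l2norm (A *m x) | x in [set x | l2norm x <= 1]]%classic.
Proof.
have z0 : l2norm (0 : 'cV[R[i]]_n) = 0.
  by rewrite l2normE /l2sq big1 ?sqrtr0// => i _; rewrite mxE /= expr0n addr0.
split; first by exists (l2norm (A *m 0)), 0 => //=; rewrite z0.
exists (Num.sqrt (frob2 symmx)) => _ [y /= y1 <-].
rewrite l2normE -(rvecK y) -nrm2_symmx ler_wsqrtr//.
apply: (le_trans (nrm2_frob _ _)); rewrite nrm2_rvec// ler_piMr//.
  by apply: sumr_ge0 => i _; apply: sumr_ge0 => j _; exact: sqr_ge0.
have := y1; rewrite l2normE -{1}sqrtr1 ler_sqrt//.
Qed.

Lemma spectral_norm_ge0 : 0 <= spectral_norm A.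
Proof.
have z0 : l2norm (0 : 'cV[R[i]]_n) = 0.
  by rewrite l2normE /l2sq big1 ?sqrtr0// => i _; rewrite mxE /= expr0n addr0.
apply: (sup_upper_bound spectral_has_sup); exists 0 => /=; first by rewrite z0.
by rewrite mulmx0 z0.
Qed.

(** With [spectral_lub], this provides the two hypotheses under which the powers were bounded.
    Padding coordinates only increase the norm of [x]. *)
Lemma spectral_ub x : nrm2 (symmx *m x) <= spectral_norm A ^+ 2 * nrm2 x.
Proof.
have [x0|x0] := eqVneq (nrm2 x) 0.
  by have := nrm2_frob symmx x; rewrite x0 !mulr0.
have xp : 0 < nrm2 x by rewrite lt_def x0 nrm2_ge0.
pose t := (Num.sqrt (nrm2 x))^-1.
have t2 : t ^+ 2 = (nrm2 x)^-1 by rewrite exprVn sqr_sqrtr// nrm2_ge0.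
have sc (z : 'cV[R]_N) : nrm2 (t *: z) = (nrm2 x)^-1 * nrm2 z.
  by rewrite -t2 /nrm2 mulr_sumr; apply: eq_bigr => i _; rewrite mxE exprMn.
have h : Num.sqrt (l2sq (A *m cvec (t *: x))) <= spectral_norm A.
  apply: (sup_upper_bound spectral_has_sup); exists (cvec (t *: x)) => //=.
  rewrite l2normE -[leRHS]sqrtr1 ler_wsqrtr// (le_trans (l2sq_cvec _))//.
  by rewrite sc mulVf.
rewrite -nrm2_symmx -scalemxAr sc in h.
have := h; rewrite -ler_sqr ?nnegrE ?sqrtr_ge0 ?spectral_norm_ge0//.
rewrite sqr_sqrtr; last by rewrite mulr_ge0 ?invr_ge0 ?nrm2_ge0.
by rewrite mulrC ler_pdivrMr.
Qed.

Lemma spectral_lub c : 0 <= c ->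
  (forall x, nrm2 (symmx *m x) <= c * nrm2 x) -> spectral_norm A ^+ 2 <= c.
Proof.
move=> c0 H; rewrite -[leRHS](sqr_sqrtr c0).
rewrite ler_sqr ?nnegrE ?sqrtr_ge0 ?spectral_norm_ge0//.
apply: ge_sup; first by case: spectral_has_sup.
move=> _ [y /= y1 <-]; rewrite l2normE -(rvecK y) -nrm2_symmx ler_wsqrtr//.
apply: (le_trans (H _)); rewrite nrm2_rvec// ler_piMr//.
have := y1; rewrite l2normE -{1}sqrtr1 ler_sqrt//.
Qed.

(** A zero norm makes the Frobenius norm vanish by [frob2_le] at k = 0, hence all entries. *)
Lemma spectral_norm_gt0 : A != 0 -> 0 < spectral_norm A.
Proof.
move=> A0; rewrite lt_def spectral_norm_ge0 andbT; apply: contra A0 => /eqP s0.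
have := frob2_le spectral_ub 0; rewrite s0 expn0 expr1 expr0n mulr0 => fr.
have f0 : frob2 symmx = 0.
  apply/eqP; rewrite eq_le fr.
  by apply: sumr_ge0 => i _; apply: sumr_ge0 => j _; exact: sqr_ge0.
have ent (i j : 'I_N) : symmx i j = 0.
  apply/eqP; rewrite -sqrf_eq0; apply/eqP.
  move: f0 => /psumr_eq0P H.
  have {H} := H (fun i _ => sumr_ge0 _ (fun j _ => sqr_ge0 _)) i isT.
  by move=> /psumr_eq0P H; apply: H => // k _; exact: sqr_ge0.
apply/eqP/matrixP => k l; rewrite mxE.
have [kN lN nkN] : [/\ (k < N)%N, (l < N)%N & (n + k < N)%N].
  by have := ltn_ord k; have := ltn_ord l; split; lia.
have := ent (Ordinal kN) (Ordinal lN); have := ent (Ordinal nkN) (Ordinal lN).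
rewrite !mxE /=; have [-> -> _ _] := symfun_blocks k l.
by case: (A k l) => a b /= -> ->.
Qed.

End SpectralNormInput.

(** * Accuracy of the repeated squaring and of the bisection *)

(** Inverse of the pair ([zrow], [zcol]), used to index the stored matrix by rows and columns. *)
Fixpoint zenc (n0 t i j : nat) : nat :=
  if t is t'.+1 then
    (zenc n0 t' (i %/ n0) (j %/ n0) * (n0 * n0) + ((i %% n0) * n0 + j %% n0))%N
  else 0%N.

Lemma digit_lt n0 a b : (0 < n0)%N -> (a %% n0 * n0 + b %% n0 < n0 * n0)%N.
Proof.
move=> n00; have : ((a %% n0).+1 * n0 <= n0 * n0)%N by rewrite leq_mul2r ltn_pmod ?orbT.
by rewrite mulSn; have := ltn_pmod b n00; lia.
Qed.

Lemma zenc_lt n0 t i j : (0 < n0)%N -> (zenc n0 t i j < (n0 * n0) ^ t)%N.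
Proof.
move=> n00; elim: t i j => //= t IH i j; have := digit_lt i j n00.
have : ((zenc n0 t (i %/ n0) (j %/ n0)).+1 * (n0 * n0) <= (n0 * n0) ^ t * (n0 * n0))%N.
  by rewrite leq_mul2r IH orbT.
by rewrite mulSn -expnSr; lia.
Qed.

Lemma zrow_zenc n0 t i j : (0 < n0)%N -> (i < n0 ^ t)%N -> zrow n0 t (zenc n0 t i j) = i.
Proof.
move=> n00; elim: t i j => [|t IH] i j; first by case: i.
rewrite expnSr => it; have q0 : (0 < n0 * n0)%N by rewrite muln_gt0 n00.
have dl := digit_lt i j n00.
rewrite zrowS /= divnMDl// (divn_small dl) addn0 IH ?ltn_divLR// modnMDl (modn_small dl).
by rewrite divnMDl// [((j %% n0) %/ n0)%N]divn_small ?ltn_pmod// addn0 -divn_eq.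
Qed.

Lemma zcol_zenc n0 t i j : (0 < n0)%N -> (j < n0 ^ t)%N -> zcol n0 t (zenc n0 t i j) = j.
Proof.
move=> n00; elim: t i j => [|t IH] i j; first by case: j.
rewrite expnSr => it; have q0 : (0 < n0 * n0)%N by rewrite muln_gt0 n00.
have dl := digit_lt i j n00.
rewrite zcolS /= divnMDl// (divn_small dl) addn0 IH ?ltn_divLR// modnMDl (modn_small dl).
by rewrite modnMDl modn_mod -divn_eq.
Qed.

Lemma zencK n0 t x : (0 < n0)%N -> (x < (n0 * n0) ^ t)%N ->
  zenc n0 t (zrow n0 t x) (zcol n0 t x) = x.
Proof.
move=> n00; elim: t x => [|t IH] x; first by case: x.
have q0 : (0 < n0 * n0)%N by rewrite muln_gt0 n00.
rewrite expnSr => xt; rewrite zrowS zcolS [zenc _ _ _ _]/=.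
have ml : ((x %% (n0 * n0)) %/ n0 < n0)%N by rewrite ltn_divLR// ltn_pmod.
rewrite !divnMDl// !modnMDl (divn_small ml) (modn_small ml).
rewrite [((_ %% n0) %/ n0)%N]divn_small ?ltn_pmod// !addn0 modn_mod -divn_eq.
by rewrite IH ?ltn_divLR// -divn_eq.
Qed.

Section Estimates.
Context {R : realType}.

Lemma bernoulli_ge (x : R) k : 0 <= x -> x <= 1 -> 1 - k%:R * x <= (1 - x) ^+ k.
Proof.
move=> x0 x1; elim: k => [|k IH]; first by rewrite mul0r subr0 expr0.
rewrite exprS; apply: le_trans (ler_wpM2l _ IH); last by lra.
have : 0 <= k%:R * x * x by rewrite !mulr_ge0.
by rewrite -natr1; lra.
Qed.

Lemma bernoulli (x : R) k : 0 <= x -> 1 + k%:R * x <= (1 + x) ^+ k.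
Proof.
move=> x0; elim: k => [|k IH]; first by rewrite mul0r addr0 expr0.
rewrite exprS; apply: le_trans (ler_wpM2l _ IH); last by lra.
have : 0 <= k%:R * x * x by rewrite !mulr_ge0.
by rewrite -natr1; lra.
Qed.

(** Bernoulli gives the lower bound; the upper one follows from (1 + x) (1 - x) <= 1. *)
Lemma pow_near1 (x : R) k : 0 <= x -> x <= 1 -> k%:R * x <= 1 / 2 ->
  1 / 2 <= (1 - x) ^+ k /\ (1 + x) ^+ k <= 2.
Proof.
move=> x0 x1 kx; have h := bernoulli_ge k x0 x1; split; first by lra.
have : ((1 + x) * (1 - x)) ^+ k <= 1.
  by apply: exprn_ile1; nra.
rewrite exprMn; have : 0 <= (1 + x) ^+ k by apply: exprn_ge0; lra.
have : 1 / 2 <= (1 - x) ^+ k by lra.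
move: ((1 + x) ^+ k) ((1 - x) ^+ k) => a b; nra.
Qed.

Variables (u : R) (F : fp_arith R).
Hypotheses (Fu : fp_model u F) (u_ge0 : 0 <= u) (u_le1 : u <= 1).

Lemma delta_bounds (d : R) : `|d| <= u -> 0 <= 1 - u /\ 1 - u <= 1 + d /\ 1 + d <= 1 + u.
Proof.
have [U0 U1] := conj u_ge0 u_le1.
by rewrite ler_norml => /andP[h1 h2]; split; [|split]; lra.
Qed.

Lemma fl_pos_add a b : 0 <= a + b ->
  (1 - u) * (a + b) <= fl F FAdd a b /\ fl F FAdd a b <= (1 + u) * (a + b).
Proof.
have [U0 U1] := conj u_ge0 u_le1.
move=> ab; have [d /delta_bounds[_ [h1 h2]] ->] := Fu.1 FAdd a b (fun h => ltac:(by [])).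
by split; apply: ler_wpM2r.
Qed.

Lemma fl_pos_mul a b : 0 <= a * b ->
  (1 - u) * (a * b) <= fl F FMul a b /\ fl F FMul a b <= (1 + u) * (a * b).
Proof.
have [U0 U1] := conj u_ge0 u_le1.
move=> ab; have [d /delta_bounds[_ [h1 h2]] ->] := Fu.1 FMul a b (fun h => ltac:(by [])).
by split; apply: ler_wpM2r.
Qed.

(** Shared by the two sums of nonnegative terms: without cancellation, each step adds one relative
    error factor. *)
Lemma fsum_step (k : nat) (S t acc t' x : R) : 0 <= S -> 0 <= t ->
  (1 - u) ^+ k.+1 * S <= acc -> acc <= (1 + u) ^+ k.+1 * S ->
  (1 - u) * t <= t' -> t' <= (1 + u) * t ->
  (1 - u) * (acc + t') <= x -> x <= (1 + u) * (acc + t') ->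
  (1 - u) ^+ k.+2 * (S + t) <= x /\ x <= (1 + u) ^+ k.+2 * (S + t).
Proof.
have [U0 U1] := conj u_ge0 u_le1.
move=> S0 t0 a1 a2 t1 t2 x1 x2.
have u1 : 0 <= 1 - u by lra.
have l1 : (1 - u) ^+ k.+1 * t <= (1 - u) * t.
  apply: ler_wpM2r => //; rewrite exprS ler_piMr// exprn_ile1//; lra.
have l2 : (1 + u) * t <= (1 + u) ^+ k.+1 * t.
  apply: ler_wpM2r => //; rewrite exprS ler_peMr//; first by lra.
  by apply: exprn_ege1; lra.
rewrite [(1 - u) ^+ k.+2]exprS [(1 + u) ^+ k.+2]exprS -!mulrA; split.
  by apply: (le_trans _ x1); apply: ler_wpM2l => //; rewrite mulrDr; lra.
by apply: (le_trans x2); apply: ler_wpM2l; [lra|rewrite mulrDr; lra].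
Qed.

Lemma fdot_sq (b : nat -> R) D :
  (1 - u) ^+ D.+1 * (\sum_(i < D) b i ^+ 2) <= fdot F b b D /\
  fdot F b b D <= (1 + u) ^+ D.+1 * (\sum_(i < D) b i ^+ 2).
Proof.
have [U0 U1] := conj u_ge0 u_le1.
elim: D => [|D [IH1 IH2]]; first by rewrite big_ord0 !mulr0 /= (fl_cst0 Fu).
have S0 : 0 <= \sum_(i < D) b i ^+ 2 by apply: sumr_ge0 => i _; exact: sqr_ge0.
have b0 : 0 <= b D * b D by rewrite -expr2 sqr_ge0.
have [t1 t2] := fl_pos_mul b0.
have acc0 : 0 <= fdot F b b D.
  by apply: le_trans IH1; rewrite mulr_ge0// exprn_ge0//; lra.
have t0 : 0 <= fl F FMul (b D) (b D).
  by apply: le_trans t1; rewrite mulr_ge0//; lra.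
have [x1 x2] := fl_pos_add (addr_ge0 acc0 t0).
by rewrite big_ord_recr /= expr2; apply: (fsum_step S0 b0 IH1 IH2 t1 t2 x1 x2).
Qed.

Lemma fabs_sum (b : nat -> R) D :
  (1 - u) ^+ D.+1 * (\sum_(i < D) `|b i|) <= fabs F b D /\
  fabs F b D <= (1 + u) ^+ D.+1 * (\sum_(i < D) `|b i|).
Proof.
have [U0 U1] := conj u_ge0 u_le1.
elim: D => [|D [IH1 IH2]]; first by rewrite big_ord0 !mulr0 /= (fl_cst0 Fu).
have S0 : 0 <= \sum_(i < D) `|b i| by apply: sumr_ge0.
have acc0 : 0 <= fabs F b D.
  by apply: le_trans IH1; rewrite mulr_ge0// exprn_ge0//; lra.
have b0 := normr_ge0 (b D).
have [x1 x2] : (1 - u) * (fabs F b D + `|b D|) <= fabs F b D.+1 /\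
    fabs F b D.+1 <= (1 + u) * (fabs F b D + `|b D|).
  rewrite /= (fl_cst0 Fu); case: (leP 0 (b D)) => hb.
    by rewrite ger0_norm//; apply: fl_pos_add; exact: addr_ge0.
  rewrite ltr0_norm//.
  have [d /delta_bounds[_ [h1 h2]] ->] := Fu.1 FSub (fabs F b D) (b D) (fun h => ltac:(by [])).
  by split; apply: ler_wpM2r => //=; lra.
have t1 : (1 - u) * `|b D| <= `|b D| by rewrite ler_piMl//; lra.
have t2 : `|b D| <= (1 + u) * `|b D| by rewrite ler_peMl//; lra.
by rewrite big_ord_recr; apply: (fsum_step S0 b0 IH1 IH2 t1 t2 x1 x2).
Qed.

Lemma fdbl_bounds (eps : R) i : 0 <= eps ->
  (1 - u) ^+ i * (2 ^+ i * eps) <= fdbl F eps i /\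
  fdbl F eps i <= (1 + u) ^+ i * (2 ^+ i * eps).
Proof.
have [U0 U1] := conj u_ge0 u_le1.
move=> e0; elim: i => [|i [IH1 IH2]]; first by rewrite !expr0 !mul1r.
have x0 : 0 <= fdbl F eps i.
  by apply: le_trans IH1; rewrite !mulr_ge0 ?exprn_ge0//; lra.
have [h1 h2] := fl_pos_add (addr_ge0 x0 x0).
rewrite /= !exprS; split.
  apply: le_trans h1; rewrite -!mulrA; apply: ler_wpM2l; first by lra.
  by move: IH1; lra.
apply: (le_trans h2); rewrite -!mulrA; apply: ler_wpM2l; first by lra.
by move: IH2; lra.
Qed.

Lemma fsq_bounds k x : 0 <= x ->
  ((1 - u) * x) ^+ (2 ^ k) <= fsq F k x /\ fsq F k x <= ((1 + u) * x) ^+ (2 ^ k).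
Proof.
have [U0 U1] := conj u_ge0 u_le1.
move=> x0.
have u1 : 0 <= 1 - u by lra.
(* The extra factor makes the induction close: squaring produces it twice, and one copy pays for
   rounding the square. *)
suff [y0 [h1 h2]] : 0 <= fsq F k x /\
    ((1 - u) * x) ^+ (2 ^ k) <= (1 - u) * fsq F k x /\
    (1 + u) * fsq F k x <= ((1 + u) * x) ^+ (2 ^ k).
  split; first by apply: (le_trans h1); rewrite ler_piMl//; lra.
  by apply: le_trans h2; rewrite ler_peMl//; lra.
elim: k => [|k [y0 [h1 h2]]]; first by rewrite expn0 !expr1.
have yy : 0 <= fsq F k x * fsq F k x by exact: mulr_ge0.
have [g1 g2] := fl_pos_mul yy.
rewrite expnSr !exprM /= -/(fsq F k x).
set y := fsq F k x in y0 h1 h2 yy g1 g2 *; split.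
  by apply: le_trans g1; exact: mulr_ge0.
have A0 : 0 <= ((1 - u) * x) ^+ (2 ^ k) by rewrite exprn_ge0// mulr_ge0.
split.
  apply: (@le_trans _ _ (((1 - u) * y) ^+ 2)).
    by rewrite ler_sqr ?nnegrE// mulr_ge0.
  by rewrite expr2 -mulrA ler_wpM2l// mulrCA.
apply: (@le_trans _ _ (((1 + u) * y) ^+ 2)).
  rewrite (_ : ((1 + u) * y) ^+ 2 = (1 + u) * ((1 + u) * (y * y))); last by ring.
  by apply: ler_wpM2l; [lra|exact: g2].
rewrite ler_sqr ?nnegrE//; first by rewrite mulr_ge0//; lra.
by apply: le_trans h2; rewrite mulr_ge0//; lra.
Qed.

Section Bisection.
Variables (k : nat) (s eps T d0 Nr : R).
Let M := (2 ^ k)%N.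
Hypotheses (s_gt0 : 0 < s) (eps_gt0 : 0 < eps) (eps_lt : eps < 1 / 2) (Nr_ge1 : 1 <= Nr).
Hypotheses (Mu : M%:R * u <= 1 / 2) (u_small : u <= 1 / 8).
Hypotheses (T_ge : s ^+ M / 8 <= T) (T_le : T <= 6 * Nr * s ^+ M).
Hypothesis M_large : 16 * Nr <= (1 + eps / 4) ^+ M.
Hypotheses (d0_ge : s / 2 <= d0) (d0_le : d0 <= 2 * Nr ^+ 2 * s).

Lemma fsq_near x : 0 <= x -> x ^+ M / 2 <= fsq F k x /\ fsq F k x <= 2 * x ^+ M.
Proof.
have [U0 U1] := conj u_ge0 u_le1.
have [e0 e1] := conj eps_gt0 eps_lt; have [N1 U2] := conj Nr_ge1 u_small.
move=> x0; have [h1 h2] := fsq_bounds k x0.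
have [p1 p2] := pow_near1 u_ge0 u_le1 Mu.
have xM : 0 <= x ^+ M by exact: exprn_ge0.
rewrite !exprMn -/M in h1 h2; split.
  by apply: le_trans h1; have := ler_wpM2r xM p1; lra.
by apply: (le_trans h2); have := ler_wpM2r xM p2; lra.
Qed.

(** From (1 - eps/4) (1 + eps/4) <= 1 and [M_large], x ^ M is at most s ^ M / 16, so doubling it for
    rounding stays below the lower bound on [T]. *)
Lemma fsq_small x : 0 <= x -> x <= (1 - eps / 4) * s -> fsq F k x <= T.
Proof.
have [U0 U1] := conj u_ge0 u_le1.
have [e0 e1] := conj eps_gt0 eps_lt; have [N1 U2] := conj Nr_ge1 u_small.
move=> x0 xs; have [_ h] := fsq_near x0; apply: (le_trans h).
have sM : 0 < s ^+ M by exact: exprn_gt0.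
have e2 : 0 <= 1 - eps / 4 by lra.
have h2 : x ^+ M <= (1 - eps / 4) ^+ M * s ^+ M.
  by rewrite -exprMn lerXn2r ?nnegrE// mulr_ge0// ltW.
have : ((1 + eps / 4) * (1 - eps / 4)) ^+ M <= 1 by apply: exprn_ile1; nra.
rewrite exprMn; have : 0 <= (1 - eps / 4) ^+ M by exact: exprn_ge0.
move: M_large T_ge h2 sM; move: ((1 + _) ^+ M) ((1 - _) ^+ M) (s ^+ M) (x ^+ M) => a b c d.
move=> h16 hT hd c0 b0 ab.
have : b * 16 <= 1.
  by have : b * (16 * Nr) <= b * a by [exact: ler_wpM2l]; nra.
by nra.
Qed.

(** Beyond (1 + eps/4) s the rounded power would be at least 8 Nr s ^ M, above the upper bound 6 Nr
    s ^ M on [T]. *)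
Lemma fsq_large x : 0 <= x -> fsq F k x <= T -> x <= (1 + eps / 4) * s.
Proof.
have [U0 U1] := conj u_ge0 u_le1.
have [e0 e1] := conj eps_gt0 eps_lt; have [N1 U2] := conj Nr_ge1 u_small.
move=> x0 hT; rewrite leNgt; apply/negP => xs.
have [h _] := fsq_near x0.
have sM : 0 < s ^+ M by exact: exprn_gt0.
have h2 : (1 + eps / 4) ^+ M * s ^+ M <= x ^+ M.
  rewrite -exprMn lerXn2r ?nnegrE//; last exact: ltW.
  by rewrite mulr_ge0// ?ltW//; lra.
have h3 : 16 * Nr * s ^+ M <= (1 + eps / 4) ^+ M * s ^+ M by rewrite ler_pM2r.
have : 0 < Nr * s ^+ M by rewrite mulr_gt0//; lra.
by move: T_le; lra.
Qed.

(** Nothing is known about the test between (1 - eps/4) s and (1 + eps/4) s, so the invariant tracks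
    only these two ends. Each step loses a factor 1 - 4u on the reach [lo + 2 * d] and multiplies
    the step by at most (1 + 3u) / 2. *)
Lemma fbis_inv i : let ld := fbis F k T (fl_cst F (1 / 2)) d0 i in
  [/\ 0 <= ld.1, ld.1 <= (1 + eps / 4) * s,
      (1 - 4 * u) ^+ i * ((1 - eps / 4) * s) <= ld.1 + 2 * ld.2, 0 <= ld.2
    & ld.2 <= (1 + 3 * u) ^+ i * d0 / 2 ^+ i].
Proof.
have [U0 U1] := conj u_ge0 u_le1.
have [e0 e1] := conj eps_gt0 eps_lt; have [N1 U2] := conj Nr_ge1 u_small.
have [D1 D2] := conj d0_ge d0_le; have S0 := s_gt0.
have es : 0 <= (1 - eps / 4) * s by rewrite mulr_ge0// ?ltW//; lra.
elim: i => [|i]; first by rewrite /= (fl_cst0 Fu) !expr0 divr1 !mul1r add0r;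
  split=> //; [rewrite mulr_ge0// ?ltW//|have : 0 <= eps * s by rewrite mulr_ge0// ltW|]; lra.
rewrite [fbis _ _ _ _ _ i.+1]/= -/(fbis F k T (fl_cst F (1 / 2)) d0 i).
case: (fbis _ _ _ _ _ _) => lo d /= [lo0 lo1 inv dd0 dd1].
have [dl hdl hE] := Fu.2 (1 / 2).
have [_ [b1 b2]] := delta_bounds hdl.
have hh0 : 0 <= d * fl_cst F (1 / 2) by rewrite hE !mulr_ge0//; lra.
have [m1 m2] := fl_pos_mul hh0.
set d' := fl F FMul d _ in m1 m2 *.
have d'1 : (1 - 2 * u) * d <= 2 * d'.
  have : (1 - u) * (1 - u) * d <= 2 * ((1 - u) * (d * fl_cst F (1 / 2))).
    rewrite hE (_ : 2 * _ = (1 - u) * (1 + dl) * d); last by field.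
    by apply: ler_wpM2r => //; apply: ler_wpM2l => //; lra.
  have : 0 <= u * u * d by rewrite !mulr_ge0.
  by lra.
have d'2 : 2 * d' <= (1 + 3 * u) * d.
  have : 2 * ((1 + u) * (d * fl_cst F (1 / 2))) <= (1 + u) * (1 + u) * d.
    rewrite hE (_ : 2 * _ = (1 + u) * (1 + dl) * d); last by field.
    by apply: ler_wpM2r => //; apply: ler_wpM2l => //; lra.
  have : 0 <= (1 - u) * u * d by rewrite !mulr_ge0//; lra.
  by lra.
have d'0 : 0 <= d' by apply: le_trans m1; rewrite mulr_ge0//; lra.
have d'3 : d' <= (1 + 3 * u) ^+ i.+1 * d0 / 2 ^+ i.+1.
  have P0 : 0 < 2 ^+ i :> R by exact: exprn_gt0.
  have dd2 : d * 2 ^+ i <= (1 + 3 * u) ^+ i * d0 by rewrite -ler_pdivlMr.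
  rewrite ler_pdivlMr ?exprn_gt0// !exprS.
  have h3 : 0 <= 1 + 3 * u by lra.
  have q1 := ler_wpM2l h3 dd2; have q2 := ler_wpM2r (ltW P0) d'2.
  by lra.
have [x1 x2] := fl_pos_add (addr_ge0 lo0 dd0).
set x := fl F FAdd lo d in x1 x2 *.
have x0 : 0 <= x.
  by apply: le_trans x1; apply: mulr_ge0; [lra|exact: addr_ge0].
set rho := (1 - 4 * u) ^+ i in inv.
have rho0 : 0 <= rho by apply: exprn_ge0; lra.
have rho1 : rho <= 1 by apply: exprn_ile1; lra.
rewrite exprS -/rho; have r4 : 0 <= 1 - 4 * u by lra.
have [xT|xT] := leP (fsq F k x) T; split=> //.
- exact: fsq_large.
- have h : (1 - 4 * u) * rho * ((1 - eps / 4) * s) <= (1 - 4 * u) * (lo + 2 * d).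
    by rewrite -mulrA; exact: ler_wpM2l.
  apply: (le_trans h).
  have : 0 <= u * lo by exact: mulr_ge0.
  have : 0 <= u * d by exact: mulr_ge0.
  by move: x1 d'1; lra.
- have xs : (1 - eps / 4) * s <= x.
    by rewrite leNgt; apply/negP => /ltW xs; move: (fsq_small x0 xs); rewrite leNgt xT.
  have A : (1 - 4 * u) * rho * ((1 - eps / 4) * s) <= (1 - 4 * u) * ((1 + u) * (lo + d)).
    rewrite -mulrA; apply: ler_wpM2l => //.
    by apply: (@le_trans _ _ ((1 - eps / 4) * s)); [exact: ler_piMl|lra].
  apply: (le_trans A).
  have : 0 <= u * lo by exact: mulr_ge0.
  have : 0 <= u * d by exact: mulr_ge0.
  have : 0 <= u * (u * lo) by rewrite !mulr_ge0.
  have : 0 <= u * (u * d) by rewrite !mulr_ge0.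
  by move: d'1; lra.
Qed.

Lemma fbis_correct i : i%:R * (4 * u) <= eps / 8 -> 64 * Nr ^+ 2 <= eps * 2 ^+ i ->
  `|(fbis F k T (fl_cst F (1 / 2)) d0 i).1 - s| <= eps * s.
Proof.
have [U0 U1] := conj u_ge0 u_le1.
have [e0 e1] := conj eps_gt0 eps_lt; have [N1 U2] := conj Nr_ge1 u_small.
move=> iu i2; have [lo0 lo1 inv dd0 dd1] := fbis_inv i.
case: (fbis _ _ _ _ _ _) lo0 lo1 inv dd0 dd1 => lo d /= lo0 lo1 inv dd0 dd1.
have [D1 D2] := conj d0_ge d0_le; have S0 := s_gt0.
have es : 0 < eps * s by exact: mulr_gt0.
have r1 : 1 - eps / 8 <= (1 - 4 * u) ^+ i.
  have u4 : 0 <= 4 * u by lra. have u41 : 4 * u <= 1 by lra.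
  by have := bernoulli_ge i u4 u41; lra.
have p3 : (1 + 3 * u) ^+ i <= 2.
  have u3 : 0 <= 3 * u by lra. have u31 : 3 * u <= 1 by lra.
  have i3 : i%:R * (3 * u) <= 1 / 2 by have : 0 <= i%:R * u by [exact: mulr_ge0]; lra.
  by have [] := pow_near1 u3 u31 i3.
have P0 : 0 < 2 ^+ i :> R by exact: exprn_gt0.
have hd : d <= eps * s / 16.
  apply: (le_trans dd1); rewrite ler_pdivrMr//.
  have q1 : (1 + 3 * u) ^+ i * d0 <= 2 * (2 * Nr ^+ 2 * s).
    by apply: ler_pM => //; [apply: exprn_ge0; lra|have := d0_ge; lra].
  apply: (le_trans q1).
  have := ler_wpM2r (ltW s_gt0) i2; lra.
have q2 : (1 - eps / 8) * ((1 - eps / 4) * s) <= lo + 2 * d.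
  apply: le_trans inv; apply: ler_wpM2r => //.
  by rewrite mulr_ge0// ?ltW//; lra.
have e2 : 0 <= eps * (eps * s) by rewrite mulr_ge0 ?ltW.
by rewrite ler_norml; apply/andP; split; lra.
Qed.

End Bisection.
End Estimates.

(** * Error of the matrix powers and accuracy of the result *)

Section PowerError.
Context {R : realType} (u : R) (F : fp_arith R).
Hypotheses (Fu : fp_model u F) (u_ge0 : 0 <= u) (u_le1 : u <= 1).
Variables (n0 r : nat) (mu mv mw : nat -> nat -> R) (m beta Gamma : R).
Let q := (n0 * n0)%N.
Hypotheses (n0_gt0 : (0 < n0)%N) (qr : (q <= r)%N) (m_ge0 : 0 <= m).
Hypothesis mu_le : forall l x, (l < r)%N -> (x < q)%N -> `|mu l x| <= m.
Hypothesis mv_le : forall l x, (l < r)%N -> (x < q)%N -> `|mv l x| <= m.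
Hypothesis mw_le : forall z l, (z < q)%N -> (l < r)%N -> `|mw z l| <= m.
Hypotheses (beta_ge1 : 1 <= beta) (rm_le : r%:R * m <= beta).
Hypotheses (Gamma_ge : u * (gam r)%:R <= Gamma) (Gamma_le1 : Gamma <= 1).
Hypothesis brentP : forall z x y, (z < q)%N -> (x < q)%N -> (y < q)%N ->
  \sum_(l < r) mw z l * (mu l x * mv l y) =
  ((x %/ n0 == z %/ n0) && (x %% n0 == y %/ n0) && (y %% n0 == z %% n0))%N%:R.
Variables (n : nat) (A : 'M[R[i]]_n) (eps : R) (L : nat).
Let N := (n0 ^ L)%N.
Hypotheses (A_herm : A \is hermsymmx) (A_neq0 : A != 0) (n_gt0 : (0 < n)%N).
Hypothesis nN : (2 * n <= N)%N.

Let s := spectral_norm A.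
Let S : 'M[R]_N := symmx A N.
Let a := syminput F n0 L n (input_mem A eps).
Let B k := iter k (fmm F (tabfl F (mktab r q mu)) (tabfl F (mktab r q mv))
  (tabfl F (mktab q r mw)) q r L) a.
Let nu := 15 * Gamma * ((3 * beta) ^+ L) ^+ 3.
Let en k := (4 * N%:R) ^+ k * (4 * nu).

Lemma input_entry (i j : 'I_N) : a (zenc n0 L i j) = S i j.
Proof.
rewrite /a /syminput zrow_zenc ?zcol_zenc// mxE /symfun (fl_cst0 Fu).
(* [symfun] reads the input memory with eps = 0, which makes no difference: [symadr] never points to
   cell 0, where eps is stored. *)
case: ifP => // _; rewrite /input_mem.
have : (0 < symadr n i j)%N by rewrite /symadr; do 2 case: ifP => _.
by case: (symadr n i j).
Qed.

Let s_ub x : nrm2 (S *m x) <= s ^+ 2 * nrm2 x.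
Proof. exact: spectral_ub. Qed.

Let s_ge0 : 0 <= s. Proof. exact: (spectral_norm_ge0 A_herm nN n_gt0). Qed.

Lemma N_ge1 : 1 <= N%:R :> R.
Proof. by rewrite ler1n expn_gt0 n0_gt0. Qed.

Lemma const_sum (c : R) : \sum_(i < N) c = N%:R * c.
Proof. by rewrite sumr_const card_ord mulr_natl. Qed.

Lemma nu_ge0 : 0 <= nu.
Proof.
have G0 : 0 <= Gamma by apply: le_trans Gamma_ge; rewrite mulr_ge0.
have b1 := beta_ge1.
have b3 : 0 <= (3 * beta) ^+ L by apply: exprn_ge0; lra.
by apply: mulr_ge0; [exact: mulr_ge0|exact: exprn_ge0].
Qed.

Lemma en_ge0 k : 0 <= en k.
Proof.
have N1 := N_ge1; have n1 := nu_ge0.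
by apply: mulr_ge0; [apply: exprn_ge0; lra|lra].
Qed.

(** Entrywise errors are measured in units of s ^ (2 ^ k). Squaring propagates at most 3 N e, and
    its own rounding adds at most 4 nu <= e <= N e: a factor 4 N in all. The initial value 4 nu is
    slack that makes 4 nu <= e hold at every step. *)
Lemma power_err k : en k <= 1 -> forall i j : 'I_N,
  `|B k (zenc n0 L i j) - sqpow k S i j| <= en k * s ^+ (2 ^ k).
Proof.
have N1 := N_ge1; have n1 := nu_ge0.
elim: k => [|k IH] ek i j.
  by rewrite /B /= input_entry subrr normr0 mulr_ge0// en_ge0.
have e0 := en_ge0 k.
have eS : en k.+1 = 4 * N%:R * en k by rewrite /en exprS; ring.
have Ne : en k <= N%:R * en k by exact: ler_peMl.
have ek1 : en k <= 1 by rewrite eS in ek; lra.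
have {}IH := IH ek1.
set e := en k in e0 eS Ne ek1 IH; set s' := s ^+ (2 ^ k) in IH.
have s'0 : 0 <= s' by exact: exprn_ge0.
have Pe (i' j' : 'I_N) : `|sqpow k S i' j'| <= s' by exact: sqpow_entry s_ge0 s_ub _ _ _.
have Be (i' j' : 'I_N) : `|B k (zenc n0 L i' j')| <= (1 + e) * s'.
  have := ler_normD (B k (zenc n0 L i' j') - sqpow k S i' j') (sqpow k S i' j').
  by rewrite subrK; have := IH i' j'; have := Pe i' j'; lra.
have zl i' j' : (zenc n0 L i' j' < q ^ L)%N by exact: zenc_lt.
have bb x : (x < q ^ L)%N -> `|B k x| <= (1 + e) * s'.
  move=> xq; rewrite -(zencK n0_gt0 xq).
  have := Be (Ordinal (zrow_lt L x n0_gt0)) (Ordinal (zcol_lt L x n0_gt0)).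
  by [].
have es0 : 0 <= (1 + e) * s' by rewrite mulr_ge0//; lra.
have f1 := fmm_err Fu u_ge0 u_le1 n0_gt0 qr m_ge0 mu_le mv_le mw_le beta_ge1 rm_le
  Gamma_ge Gamma_le1 es0 bb (zl i j).
have r_gt0 : (0 < r)%N by apply: leq_trans qr; rewrite muln_gt0 n0_gt0.
have f2 : mmx n0 r mu mv mw L (B k) (zenc n0 L i j) =
    \sum_(l < N) B k (zenc n0 L i l) * B k (zenc n0 L l j).
  rewrite (mmxE n0_gt0 r_gt0 brentP (A := fun i j => B k (zenc n0 L i j))) ?zl//.
    by rewrite zrow_zenc ?zcol_zenc.
  by move=> x xq; rewrite zencK.
have f3 : `|\sum_(l < N) B k (zenc n0 L i l) * B k (zenc n0 L l j) - sqpow k.+1 S i j| <=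
    N%:R * ((2 * e + e ^+ 2) * s' ^+ 2).
  rewrite /= mxE -sumrB.
  apply: (le_trans (ler_norm_sum _ _ _)).
  rewrite -[N in N%:R]card_ord -sum1_card natr_sum mulr_suml.
  apply: ler_sum => l _; rewrite mul1r.
  have -> : B k (zenc n0 L i l) * B k (zenc n0 L l j) - sqpow k S i l * sqpow k S l j =
    (B k (zenc n0 L i l) - sqpow k S i l) * B k (zenc n0 L l j) +
    sqpow k S i l * (B k (zenc n0 L l j) - sqpow k S l j) by ring.
  apply: (le_trans (ler_normD _ _)).
  have := normM_le (IH i l) (Be l j); have := normM_le (Pe i l) (IH l j).
  by lra.
have f4 : `|B k.+1 (zenc n0 L i j) - mmx n0 r mu mv mw L (B k) (zenc n0 L i j)| <=
  nu * ((1 + e) * s') ^+ 2 by exact: f1.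
rewrite f2 in f4.
have := ler_normD (B k.+1 (zenc n0 L i j) - \sum_(l < N) B k (zenc n0 L i l) * B k (zenc n0 L l j))
  (\sum_(l < N) B k (zenc n0 L i l) * B k (zenc n0 L l j) - sqpow k.+1 S i j).
rewrite addrA subrK => h; apply: (le_trans h); rewrite eS.
have -> : s ^+ (2 ^ k.+1) = s' ^+ 2 by rewrite /s' expnSr exprM.
have s2 : 0 <= s' ^+ 2 by exact: sqr_ge0.
have nue : 4 * nu <= e.
  rewrite /e /en ler_peMl//; first by rewrite mulr_ge0.
  by apply: exprn_ege1; lra.
have g1 : nu * ((1 + e) * s') ^+ 2 <= e * s' ^+ 2.
  rewrite exprMn mulrA; apply: ler_wpM2r => //.
  have : (1 + e) ^+ 2 <= 4 by nra.
  by move=> h4; have := ler_wpM2l n1 h4; lra.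
have g2 : N%:R * ((2 * e + e ^+ 2) * s' ^+ 2) <= 3 * (N%:R * e) * s' ^+ 2.
  rewrite mulrA; apply: ler_wpM2r => //.
  have : e ^+ 2 <= e by rewrite expr2 ler_piMl.
  have N0 : 0 <= N%:R :> R by [].
  by move=> h4; have := ler_wpM2l N0 h4; lra.
have g3 := ler_wpM2r s2 Ne.
by lra.
Qed.

Lemma zsum_enc (f : nat -> R) :
  \sum_(x < q ^ L) f x = \sum_(i < N) \sum_(j < N) f (zenc n0 L i j).
Proof.
rewrite -(zsum L (fun i j => f (zenc n0 L i j)) n0_gt0).
by apply: eq_bigr => x _; rewrite zencK.
Qed.

(** The exact squared Frobenius norm is known up to the dimension. Entry errors cost a factor 2 and
    at most half of s ^ (2 ^ k.+1), and rounding the sum another factor 2, giving 1/8 and 6 N. *)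
Lemma trace_bounds k : en k <= 1 -> N%:R * en k <= 1 / 2 ->
  (q ^ L).+1%:R * u <= 1 / 2 ->
  s ^+ (2 ^ k.+1) / 8 <= fdot F (B k) (B k) (q ^ L) /\
  fdot F (B k) (B k) (q ^ L) <= 6 * N%:R * s ^+ (2 ^ k.+1).
Proof.
move=> ek Ne Qu; have N1 := N_ge1; have e0 := en_ge0 k.
have [h1 h2] := fdot_sq Fu u_ge0 u_le1 (B k) (q ^ L).
have [p1 p2] := pow_near1 u_ge0 u_le1 Qu.
have er := power_err ek.
have fg : (s ^+ (2 ^ k)) ^+ 2 <= frob2 (sqpow k S).
  apply: frob2_ge => //; first exact: symmx_sym.
  exact: spectral_lub.
have fl := frob2_le s_ub k.
have -> : s ^+ (2 ^ k.+1) = (s ^+ (2 ^ k)) ^+ 2 by rewrite expnSr exprM.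
set s2 := (s ^+ (2 ^ k)) ^+ 2 in fg fl *.
have s20 : 0 <= s2 by exact: sqr_ge0.
set Sg := \sum_(i < q ^ L) _ in h1 h2.
have d2 (i j : 'I_N) : (B k (zenc n0 L i j) - sqpow k S i j) ^+ 2 <= (en k) ^+ 2 * s2.
  rewrite -exprMn -[leLHS]real_normK ?num_real//.
  by rewrite lerXn2r ?nnegrE// mulr_ge0// exprn_ge0.
have Ne2 : N%:R * (N%:R * ((en k) ^+ 2 * s2)) <= s2 / 4.
  have : (N%:R * en k) ^+ 2 <= (1 / 2) ^+ 2.
    by rewrite lerXn2r ?nnegrE// mulr_ge0//; lra.
  by move=> h; have := ler_wpM2r s20 h; lra.
have csum (c : R) : \sum_(i < N) \sum_(j < N) c = N%:R * (N%:R * c).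
  by rewrite !const_sum.
have lo : frob2 (sqpow k S) / 2 - s2 / 4 <= Sg.
  rewrite /Sg (zsum_enc (fun x => B k x ^+ 2)); apply: le_trans (_ : frob2 (sqpow k S) / 2 -
     \sum_(i < N) \sum_(j < N) ((en k) ^+ 2 * s2) <= _); first by rewrite csum; lra.
  rewrite /frob2 mulr_suml -sumrB; apply: ler_sum => i _.
  rewrite mulr_suml -sumrB; apply: ler_sum => j _; have := d2 i j.
  (* This square yields x ^ 2 >= y ^ 2 / 2 - (x - y) ^ 2; the one used for [hi] yields x ^ 2 <= 2 y
     ^ 2 + 2 (x - y) ^ 2. *)
  by move: (B k _) (sqpow k S i j) => x y; have := sqr_ge0 (2 * x - y); lra.
have hi : Sg <= 2 * frob2 (sqpow k S) + s2 / 2.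
  rewrite /Sg (zsum_enc (fun x => B k x ^+ 2)); apply: le_trans (_ : _ <= 2 * frob2 (sqpow k S) +
     2 * \sum_(i < N) \sum_(j < N) ((en k) ^+ 2 * s2)) _; last by rewrite csum; lra.
  rewrite /frob2 !mulr_sumr -big_split; apply: ler_sum => i _ /=.
  rewrite !mulr_sumr -big_split; apply: ler_sum => j _ /=; have := d2 i j.
  by move: (B k _) (sqpow k S i j) => x y; have := sqr_ge0 (x - 2 * y); lra.
have Sg0 : 0 <= Sg by apply: sumr_ge0 => x _; exact: sqr_ge0.
have q1 := ler_wpM2r Sg0 p1; have q2 := ler_wpM2r Sg0 p2.
have q3 := ler_wpM2r s20 N1.
by split; lra.
Qed.

(** Without rounding, the sum of absolute values lies between s and N ^ 2 s: it dominates the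
    Frobenius norm, and each entry is at most s. *)
Lemma abs_bounds : (q ^ L).+1%:R * u <= 1 / 2 ->
  s / 2 <= fabs F a (q ^ L) /\ fabs F a (q ^ L) <= 2 * N%:R ^+ 2 * s.
Proof.
move=> Qu; have N1 := N_ge1.
have [h1 h2] := fabs_sum Fu u_ge0 u_le1 a (q ^ L).
have [p1 p2] := pow_near1 u_ge0 u_le1 Qu.
set Sg := \sum_(i < q ^ L) _ in h1 h2.
have SgE : Sg = \sum_(i < N) \sum_(j < N) `|S i j|.
  rewrite /Sg (zsum_enc (fun x => `|a x|)).
  by apply: eq_bigr => i _; apply: eq_bigr => j _; rewrite input_entry.
have Sg0 : 0 <= Sg by apply: sumr_ge0.
have le1 (i j : 'I_N) : `|S i j| <= Sg.
  rewrite SgE (bigD1 i)//= (bigD1 j)//= -addrA lerDl addr_ge0//.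
    exact: sumr_ge0.
  by apply: sumr_ge0 => i' _; exact: sumr_ge0.
have s_le : s <= Sg.
  rewrite -ler_sqr ?nnegrE//.
  have fg : s ^+ 2 <= frob2 S.
    have S0 : 0 <= frob2 S.
      by apply: sumr_ge0 => i _; apply: sumr_ge0 => j _; exact: sqr_ge0.
    exact: (spectral_lub A_herm nN n_gt0 S0 (fun x => nrm2_frob S x)).
  apply: (le_trans fg); rewrite expr2 {1}SgE mulr_suml; apply: ler_sum => i _.
  rewrite mulr_suml; apply: ler_sum => j _.
  by rewrite -[leLHS]real_normK ?num_real// expr2 ler_wpM2l.
have Sg_le : Sg <= N%:R ^+ 2 * s.
  rewrite SgE (_ : N%:R ^+ 2 * s = \sum_(i < N) \sum_(j < N) s).
    apply: ler_sum => i _; apply: ler_sum => j _.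
    by have := sqpow_entry s_ge0 s_ub 0 i j; rewrite expn0 expr1.
  by rewrite !const_sum; ring.
have q1 := ler_wpM2r Sg0 p1; have q2 := ler_wpM2r Sg0 p2.
by split; lra.
Qed.

Lemma fnorm_correct kappa st : 0 < eps -> eps < 1 / 2 ->
  en kappa <= 1 -> N%:R * en kappa <= 1 / 2 -> (q ^ L).+1%:R * u <= 1 / 2 ->
  (2 ^ kappa.+1)%:R * u <= 1 / 2 -> u <= 1 / 8 ->
  16 * N%:R <= (1 + eps / 4) ^+ (2 ^ kappa.+1) ->
  st%:R * (4 * u) <= eps / 8 -> 64 * N%:R ^+ 2 <= eps * 2 ^+ st ->
  `|fnorm F n0 r (mktab r q mu) (mktab r q mv) (mktab q r mw) L n kappa st
      (input_mem A eps) - spectral_norm A| <= eps * spectral_norm A.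
Proof.
move=> e0 e1 ek Ne Qu Mu u8 hM hst hst2.
have [t1 t2] := trace_bounds ek Ne Qu; have [d1 d2] := abs_bounds Qu.
have s0 : 0 < s by exact: (spectral_norm_gt0 A_herm nN n_gt0).
exact: (fbis_correct Fu u_ge0 u_le1 s0 e0 e1 N_ge1 Mu u8 t1 t2 hM d1 d2 hst hst2).
Qed.
End PowerError.

(** * Choice of the constants *)

Lemma noflip_cload {R : Type} c i (t : seq R) : noflip (cload c i t).
Proof. by elim: t i => //= x t IH i. Qed.

Lemma noflip_cnorm {R : realType} n0 r (tU tV tW : seq R) c1 c2 c3 :
  noflip (cnorm n0 r tU tV tW c1 c2 c3).
Proof. by rewrite /= !noflip_cload. Qed.

(** With X = n + p + 2 >= 2, C <= 2 ^ C <= X ^ C, so Y = X ^ (C + 1) exceeds [C * X], hence every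
    base quantity. The others are products of at most three factors bounded by Y, up to a lower
    term, and so stay below Y ^ 4; Y ^ e takes care of B ^ e. *)
Lemma word_bounds (n0 c1 c2 c3 e n p : nat) : (0 < n)%N ->
  let B := (n0 ^ 2 * (2 * n))%N in
  let C := (2 * n0 ^ 2 + c1 + c2 + c3 + 32)%N in
  let W := ((n + p + 2) ^ (C.+1 * (e + 4)))%N in
  [/\ (32 * B ^ e <= W)%N, [/\ (c1 < W)%N, (c2 < W)%N, (c3 < W)%N & (2 * n < W)%N],
      (p + c2 * (B + 1) < W)%N, (c3 * ((p + B + c1 + 1) * (B + 1)) < W)%N
    & (p + B + c1 + 1 < W)%N].
Proof.
move=> n_gt0 B C W; pose X := (n + p + 2)%N.
have WX : W = (X ^ (C.+1 * (e + 4)))%N by [].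
pose Y := (X ^ C.+1)%N.
have X2 : (1 < X)%N by rewrite /X; lia.
have CX : (C * X <= Y)%N.
  rewrite /Y expnSr leq_mul2r; apply/orP; right.
  by apply: (leq_trans (ltnW (ltn_expl C (ltnSn 1)))); rewrite leq_exp2r// /C; lia.
have CY : (C <= Y)%N by apply: leq_trans CX; rewrite leq_pmulr//; lia.
have nX : (n0 ^ 2 * (2 * n) <= 2 * n0 ^ 2 * X)%N.
  by rewrite mulnCA mulnA leq_mul2l /X; apply/orP; right; lia.
have bY : (p + B + c1 + 1 <= Y)%N.
  apply: leq_trans CX; rewrite /C /B !mulnDl.
  have h1 : (p + 2 <= X)%N by rewrite /X; lia.
  have h2 : (c1 <= c1 * X)%N by rewrite leq_pmulr//; lia.
  have [h3 h4] := conj (leq0n (c2 * X)) (leq0n (c3 * X)).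
  by lia.
have BY : (B + 1 <= Y)%N by lia.
have WE : W = (Y ^ e * Y ^ 4)%N by rewrite WX expnM -/Y expnD.
have Y32 : (32 <= Y)%N by apply: leq_trans CY; rewrite /C; lia.
have Ye : (0 < Y ^ e)%N by rewrite expn_gt0; lia.
have Y4 : (Y ^ 4 <= W)%N by rewrite WE leq_pmull.
have YY : (Y * (Y * Y) < Y ^ 4)%N.
  have -> : (Y ^ 4 = Y * (Y * (Y * Y)))%N by rewrite !expnS expn0 muln1.
  by rewrite ltn_pmul2l ?ltn_pmul2l ?ltn_Pmull//; lia.
have YlY : (Y <= Y * Y)%N by rewrite leq_pmulr//; lia.
have YYl : (2 * (Y * Y) <= Y * (Y * Y))%N by rewrite leq_mul2r; lia.
have c_le : [/\ (c1 <= Y)%N, (c2 <= Y)%N & (c3 <= Y)%N].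
  by split; apply: leq_trans CY; rewrite /C; lia.
have [h1 h2 h3] := c_le.
have n_le : (2 * n <= Y)%N.
  apply: leq_trans CX; apply: (@leq_trans (32 * X)); first by rewrite /X; lia.
  by rewrite leq_mul2r /C; apply/orP; right; lia.
split.
- rewrite WE mulnC leq_mul//.
    by case: (e) => // e'; rewrite leq_exp2r//; lia.
  by apply: (leq_trans Y32); rewrite -[X in (X <= _)%N]expn1 leq_exp2l//; lia.
- by split; lia.
- have : (c2 * (B + 1) <= Y * Y)%N by exact: leq_mul.
  by lia.
- have : (c3 * ((p + B + c1 + 1) * (B + 1)) <= Y * (Y * Y))%N by rewrite !leq_mul.
  by lia.
- by lia.
Qed.

Lemma muln_distr5 (a b c d e y : nat) :
  ((a + b + 2 * c + d + 3 * e) * y = a * y + b * y + 2 * (c * y) + d * y + 3 * (e * y))%N.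
Proof. by lia. Qed.

(** The precision test, with Y = (kappa + 1) (L + 1), implies every bound on exponents of 2 needed
    later. In the third one, the terms account for N, (4 N) ^ kappa, the constant 60 <= 2 ^ 6,
    [gam r] and (3 beta) ^ (3 L). *)
Lemma exponent_bounds (c0 c2 cg cb L j kappa Y p : nat) :
  (kappa.+1 <= Y)%N -> (L + 1 <= Y)%N -> (L * kappa <= Y)%N -> (j <= kappa)%N ->
  ((16 + c2 + 2 * c0 + cg + 3 * cb) * Y <= p)%N ->
  [/\ (2 < p)%N, (cg < p)%N,
      (c0 * L + ((2 + c0 * L) * kappa + (6 + (cg + cb * L * 3))) < p)%N,
      ((c0 * L + c0 * L).+1 < p)%N
    & (kappa.+1 < p)%N /\ (j + c2 * (L + 1) + 7 + j < p)%N].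
Proof.
move=> Y1 Y2 Y3 jk; rewrite muln_distr5.
have LY : (L <= Y)%N by apply: leq_trans Y2; rewrite leq_addr.
have Y0 : (0 < Y)%N by exact: leq_trans Y1.
have m1 : (c0 * L <= c0 * Y)%N by rewrite leq_mul2l LY orbT.
have m2 : (c0 * (L * kappa) <= c0 * Y)%N by rewrite leq_mul2l Y3 orbT.
have m3 : (cg <= cg * Y)%N by rewrite leq_pmulr.
have m4 : (cb * L <= cb * Y)%N by rewrite leq_mul2l LY orbT.
have m5 : (c2 * (L + 1) <= c2 * Y)%N by rewrite leq_mul2l Y2 orbT.
rewrite (mulnDl 2%N) -(mulnA c0).
move: (c0 * L)%N (c0 * Y)%N (c0 * (L * kappa))%N (cg * Y)%N (cb * L)%N (cb * Y)%N
  (c2 * (L + 1))%N (c2 * Y)%N m1 m2 m3 m4 m5 => x1 x2 x3 x4 x5 x6 x7 x8 m1 m2 m3 m4 m5 h.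
by split; [lia|lia|lia|lia|split; lia].
Qed.

Lemma exp2_large (c0 L : nat) : (4 + c0 * L <= 2 ^ (L + c0 + 3))%N.
Proof.
rewrite !expnD; have := ltn_expl L (ltnSn 1); have := ltn_expl c0 (ltnSn 1).
set x := (2 ^ c0)%N; set y := (2 ^ L)%N => hx hy.
have : (L.+1 * c0.+1 <= y * x)%N by exact: leq_mul.
rewrite mulSn mulnS (mulnC L c0); move: (c0 * L)%N (y * x)%N => a b.
by lia.
Qed.

Lemma bisection_exp (c0 L : nat) : (8 + (c0 * L + c0 * L) <= (2 * c0 + 8) * (L + 1))%N.
Proof. by rewrite mulnDl mulnDr -mulnA; move: (c0 * L)%N; lia. Qed.

Section Accuracy.
Context {R : realType}.

Lemma roundoff_pow (E p : nat) : (E < p)%N -> 2 ^+ E * unit_roundoff p <= 1 / 2 :> R.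
Proof.
move=> Ep; rewrite /unit_roundoff ler_pdivrMr ?exprn_gt0//.
have : 2 ^+ E.+1 <= 2 ^+ p :> R by rewrite ler_eXn2l ?ltr1n.
by rewrite exprS; lra.
Qed.

Lemma natr_pow2 (a b : nat) : (a <= 2 ^ b)%N -> a%:R <= 2 ^+ b :> R.
Proof. by move=> h; rewrite -natrX ler_nat. Qed.

Variables (n0 r : nat) (mu mv mw : nat -> nat -> R) (m beta : R) (c0 cb cg : nat).
Let q := (n0 * n0)%N.
Hypotheses (n0_gt1 : (1 < n0)%N) (qr : (q <= r)%N) (m_ge0 : 0 <= m).
Hypothesis mu_le : forall l x, (l < r)%N -> (x < q)%N -> `|mu l x| <= m.
Hypothesis mv_le : forall l x, (l < r)%N -> (x < q)%N -> `|mv l x| <= m.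
Hypothesis mw_le : forall z l, (z < q)%N -> (l < r)%N -> `|mw z l| <= m.
Hypotheses (beta_ge1 : 1 <= beta) (rm_le : r%:R * m <= beta).
Hypothesis brentP : forall z x y, (z < q)%N -> (x < q)%N -> (y < q)%N ->
  \sum_(l < r) mw z l * (mu l x * mv l y) =
  ((x %/ n0 == z %/ n0) && (x %% n0 == y %/ n0) && (y %% n0 == z %% n0))%N%:R.
Hypotheses (n0_le : (n0 <= 2 ^ c0)%N) (beta_le : 3 * beta <= 2 ^+ cb).
Hypothesis gam_le : (gam r <= 2 ^ cg)%N.

Lemma fnorm_accurate n (A : 'M[R[i]]_n) eps p (F : fp_arith R) L j :
  fp_model (unit_roundoff p) F -> A \is hermsymmx -> A != 0 -> (0 < n)%N ->
  0 < eps -> eps < 1 / 2 -> (2 * n <= n0 ^ L)%N -> 1 <= 4 * (2 ^+ j * eps) ->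
  let c2 := (2 * c0 + 8)%N in
  let kappa := (j + L + (c0 + 6))%N in let st := (j + c2 * (L + 1))%N in
  ((16 + c2 + 2 * c0 + cg + 3 * cb) * (kappa.+1 * (L + 1)) <= p)%N ->
  `|fnorm F n0 r (mktab r q mu) (mktab r q mv) (mktab q r mw) L n kappa st
      (input_mem A eps) - spectral_norm A| <= eps * spectral_norm A.
Proof.
move=> Fu A_herm A0 n_gt0 e0 e1 nN je c2 kappa st chk.
set u := unit_roundoff p in Fu; set N := (n0 ^ L)%N.
have kE : kappa.+1 = (j + 4 + (L + c0 + 3))%N by rewrite /kappa; lia.
have [p2' pcg pE pQ [pk pst]] :
  [/\ (2 < p)%N, (cg < p)%N,
      (c0 * L + ((2 + c0 * L) * kappa + (6 + (cg + cb * L * 3))) < p)%N,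
      ((c0 * L + c0 * L).+1 < p)%N
    & (kappa.+1 < p)%N /\ (j + c2 * (L + 1) + 7 + j < p)%N].
  apply: exponent_bounds chk.
  - by rewrite leq_pmulr// addn1.
  - by rewrite leq_pmull.
  - by rewrite mulnC leq_mul ?leqnSn ?leq_addr.
  - by rewrite /kappa -addnA leq_addr.
have u0 : 0 <= u by rewrite invr_ge0 exprn_ge0.
have n00 : (0 < n0)%N by exact: ltnW.
have RP E : (E < p)%N -> 2 ^+ E * u <= 1 / 2 by exact: roundoff_pow.
have N2 : N%:R <= 2 ^+ (c0 * L) :> R.
  apply: natr_pow2; rewrite expnM /N; case: (L) => // L'.
  by rewrite leq_exp2r.
have N0 : 0 <= N%:R :> R by [].
have u8 : u <= 1 / 8.
  have := roundoff_pow p2'; rewrite -/u.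
  by rewrite expr2; lra.
have u1 : u <= 1 by lra.
pose Gamma := u * (gam r)%:R.
have G0 : 0 <= Gamma by exact: mulr_ge0.
have Gle : Gamma <= 2 ^+ cg * u.
  by rewrite /Gamma mulrC; apply: ler_wpM2r => //; exact: natr_pow2.
have G1 : Gamma <= 1.
  have : 2 ^+ cg * u <= 1 / 2 by exact: RP.
  by lra.
pose en := (4 * N%:R) ^+ kappa * (4 * (15 * Gamma * ((3 * beta) ^+ L) ^+ 3)).
have b0 : 0 <= 3 * beta by have := beta_ge1; lra.
have hb : ((3 * beta) ^+ L) ^+ 3 <= 2 ^+ (cb * L * 3).
  rewrite !exprM; apply: lerXn2r; rewrite ?nnegrE ?exprn_ge0//.
  by apply: lerXn2r; rewrite ?nnegrE ?exprn_ge0.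
have hN : (4 * N%:R) ^+ kappa <= 2 ^+ ((2 + c0 * L) * kappa) :> R.
  rewrite exprM; apply: lerXn2r; rewrite ?nnegrE ?exprn_ge0 ?mulr_ge0//.
  by rewrite exprD expr2; apply: ler_pM => //; lra.
have hbe0 : 0 <= ((3 * beta) ^+ L) ^+ 3 by rewrite !exprn_ge0.
have h15 : 4 * (15 * Gamma * ((3 * beta) ^+ L) ^+ 3) <=
    2 ^+ 6 * (2 ^+ cg * u * 2 ^+ (cb * L * 3)).
  have h : Gamma * ((3 * beta) ^+ L) ^+ 3 <= 2 ^+ cg * u * 2 ^+ (cb * L * 3) by exact: ler_pM.
  have h0 : 0 <= Gamma * ((3 * beta) ^+ L) ^+ 3 by exact: mulr_ge0.
  have -> : 2 ^+ 6 = 64 :> R by rewrite -natrX.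
  by lra.
have p5 : 0 <= 4 * (15 * Gamma * ((3 * beta) ^+ L) ^+ 3).
  by apply: mulr_ge0 => //; rewrite -mulrA; apply: mulr_ge0 => //; exact: mulr_ge0.
have Nen : N%:R * en <= 1 / 2.
  apply: le_trans (RP (c0 * L + ((2 + c0 * L) * kappa + (6 + (cg + cb * L * 3))))%N _).
    have p4 : 0 <= (4 * N%:R) ^+ kappa :> R by rewrite exprn_ge0// mulr_ge0.
    apply: (@le_trans _ _ (2 ^+ (c0 * L) * (2 ^+ ((2 + c0 * L) * kappa) *
        (2 ^+ 6 * (2 ^+ cg * u * 2 ^+ (cb * L * 3)))))).
      by apply: ler_pM => //; [exact: mulr_ge0|exact: ler_pM].
    rewrite !(exprD _ (c0 * L)) !(exprD _ ((2 + c0 * L) * kappa)) (exprD _ 6) (exprD _ cg).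
    by rewrite le_eqVlt; apply/orP; left; apply/eqP; ring.
  exact: pE.
have N1 : 1 <= N%:R :> R by rewrite ler1n expn_gt0 n00.
have en0 : 0 <= en.
  by apply: mulr_ge0 => //; apply: exprn_ge0; exact: mulr_ge0.
have en1 : en <= 1 by have := ler_wpM2r en0 N1; lra.
have qN : (q ^ L = N ^ 2)%N by rewrite /N -expnM mulnC expnM /q mulnn.
have NN : N%:R * N%:R <= 2 ^+ (c0 * L + c0 * L) :> R by rewrite exprD; exact: ler_pM.
have P1 : (q ^ L).+1%:R * u <= 1 / 2.
  apply: le_trans (RP (c0 * L + c0 * L).+1 _).
    rewrite ler_wpM2r// -natr1 qN natrX expr2 exprS.
    have : 1 <= 2 ^+ (c0 * L + c0 * L) :> R by apply: exprn_ege1; rewrite ler1n.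
    by lra.
  exact: pQ.
have P2 : (2 ^ kappa.+1)%:R * u <= 1 / 2 by rewrite natrX; exact: RP.
have pj : 0 < 2 ^+ j :> R by exact: exprn_gt0.
(* Since 2 ^ j eps >= 1/4, raising 1 + eps/4 to the power 2 ^ (j + 4) gives at least 2; the other
   factor of the exponent turns this 2 into 16 N. This fixes the constant in kappa. *)
have P3 : 16 * N%:R <= (1 + eps / 4) ^+ (2 ^ kappa.+1).
  have -> : (2 ^ kappa.+1 = 2 ^ (j + 4) * 2 ^ (L + c0 + 3))%N.
    by rewrite -expnD kE.
  rewrite exprM.
  have h2 : 2 <= (1 + eps / 4) ^+ (2 ^ (j + 4)).
    have e4 : 0 <= eps / 4 by lra.
    apply: le_trans (bernoulli (2 ^ (j + 4)) e4); rewrite natrX exprD.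
    have -> : 2 ^+ 4 = 16 :> R by rewrite -natrX.
    by lra.
  apply: (@le_trans _ _ (2 ^+ (2 ^ (L + c0 + 3)))); last first.
    by apply: lerXn2r; rewrite ?nnegrE//; lra.
  apply: (@le_trans _ _ (2 ^+ (4 + c0 * L))).
    rewrite exprD; have -> : 2 ^+ 4 = 16 :> R by rewrite -natrX.
    by lra.
  by rewrite ler_eXn2l ?ltr1n// exp2_large.
have P4 : st%:R * (4 * u) <= eps / 8.
  have h : 2 ^+ (st + 7 + j) * u <= 1 / 2.
    exact: RP.
  have hst : st%:R <= 2 ^+ st :> R by apply: natr_pow2; exact/ltnW/ltn_expl.
  have h128 : 2 ^+ 7 = 128 :> R by rewrite -natrX.
  have h' : st%:R * (128 * 2 ^+ j * u) <= 1 / 2.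
    apply: le_trans h; rewrite (exprD _ (st + 7)%N) (exprD _ st) h128.
    have : 0 <= 128 * 2 ^+ j * u by rewrite !mulr_ge0.
    by move=> h0; have := ler_wpM2r h0 hst; lra.
  have s0 : 0 <= st%:R * (4 * u) by rewrite !mulr_ge0.
  have := ler_wpM2l s0 je; have := ler_wpM2l (ltW e0) h'; lra.
(* The j steps compensate eps up to the factor 4, which makes 64 into 256 = 2 ^ 8; the remaining
   steps supply 256 N ^ 2. *)
have P5 : 64 * N%:R ^+ 2 <= eps * 2 ^+ st.
  rewrite /st exprD.
  have h : 256 * (N%:R * N%:R) <= 2 ^+ (c2 * (L + 1)) :> R.
    apply: (@le_trans _ _ (2 ^+ (8 + (c0 * L + c0 * L)))).
      rewrite exprD; have -> : 2 ^+ 8 = 256 :> R by rewrite -natrX.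
      by lra.
    by rewrite ler_eXn2l ?ltr1n// bisection_exp.
  have h0 : 0 <= 2 ^+ (c2 * (L + 1)) :> R by exact: exprn_ge0.
  by have := ler_wpM2r h0 je; rewrite expr2; lra.
exact: (fnorm_correct Fu u0 u1 n00 qr m_ge0 mu_le mv_le mw_le beta_ge1 rm_le
  (lexx Gamma) G1 brentP A_herm A0 n_gt0 nN e0 e1 en1 Nen P1 P2 u8 P3 P4 P5).
Qed.

End Accuracy.

(** * Operation count and precision in terms of the logarithms *)

Section Costs.
Context {R : realType}.

Lemma table_le (f : nat -> nat -> R) a b l x : (l < a)%N -> (x < b)%N ->
  `|f l x| <= \sum_(i < a) \sum_(j < b) `|f i j|.
Proof.
move=> la xb; rewrite (bigD1 (Ordinal la))//= (bigD1 (Ordinal xb))//= -addrA lerDl.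
by rewrite addr_ge0//; apply: sumr_ge0 => // i _; exact: sumr_ge0.
Qed.

Lemma ln2_gt0 : 0 < ln 2 :> R.
Proof. by rewrite -ln1 ltr_ln ?posrE// ltr1n. Qed.

Lemma powRnX (x om : R) L : 0 <= x -> (x `^ om) ^+ L = (x ^+ L) `^ om.
Proof.
move=> x0; rewrite -powR_mulrn ?powR_ge0// -powRrM mulrC powRrM.
by rewrite powR_mulrn.
Qed.

Lemma norm_cost_le n0 r L j c1 c2 kappa st : (0 < n0)%N -> (n0 * n0 <= r)%N ->
  kappa = (j + L + c1)%N -> st = (j + c2 * (L + 1))%N ->
  (1 + 2 * j + norm_cost n0 r L kappa st <=
    (6 + 7 * r + 4 * c2) * (kappa.+1 * ((L + 1) * r ^ L)) +
    4 * (kappa.+1 * (kappa.+1 * r ^ L)))%N.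
Proof.
move=> n00 qr kE ->; rewrite /norm_cost.
have r0 : (0 < r)%N by apply: leq_trans qr; rewrite muln_gt0 n00.
have G0 : (0 < r ^ L)%N by rewrite expn_gt0 r0.
have qG : ((n0 * n0) ^ L <= r ^ L)%N by case: (L) => // L'; rewrite leq_exp2r.
move: (r ^ L)%N ((n0 * n0) ^ L)%N G0 qG => G Q G0 QG.
have kj : (j <= kappa)%N by rewrite kE; lia.
move: kappa kj {kE} => k kj.
set X := (k.+1 * ((L + 1) * G))%N.
have e1 : (G <= X)%N.
  by rewrite /X mulnA leq_pmull// muln_gt0 addn1.
have e2 : (k.+1 <= X)%N by rewrite /X leq_pmulr// muln_gt0 addn1.
have e3 : (k * (7 * (L * (r * G))) <= 7 * r * X)%N.
  rewrite (_ : k * (7 * (L * (r * G))) = 7 * r * (k * (L * G)))%N; last by lia.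
  by rewrite leq_mul2l /X leq_mul ?orbT// leq_mul2r leq_addr orbT.
have e4 : (j * (k + 4) <= 4 * (k.+1 * (k.+1 * G)))%N.
  apply: (@leq_trans (k.+1 * (4 * k.+1)))%N.
    by apply: leq_mul; lia.
  by rewrite mulnCA leq_mul2l /= leq_mul2l /= leq_pmulr.
have e5 : (c2 * (L + 1) * (k + 4) <= 4 * c2 * X)%N.
  apply: (@leq_trans (c2 * (L + 1) * (4 * k.+1)))%N.
    by rewrite leq_mul2l; apply/orP; right; lia.
  rewrite (_ : c2 * (L + 1) * (4 * k.+1) = 4 * c2 * (k.+1 * (L + 1)))%N; last by lia.
  by rewrite leq_mul2l /X mulnA leq_pmulr ?orbT.
have e6 : ((6 + 7 * r + 4 * c2) * X = 6 * X + 7 * r * X + 4 * c2 * X)%N.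
  by rewrite !mulnDl.
by rewrite e6 mulnDl; move: e1 e2 e3 e4 e5 kj QG; move: (7 * r * X)%N (4 * c2 * X)%N; lia.
Qed.

(** j is O(log (1 / e')), L is O(1 + log n), and r ^ L is O(n ^ om) because r <= n0 ^ om has no
    constant. As e' < 1/2, the logarithms are at least ln 2 and absorb additive constants. *)
Lemma cost_bounds (n0 r c1 c2 c3 : nat) (om : R) : (1 < n0)%N -> (n0 * n0 <= r)%N ->
  0 <= om -> r%:R <= n0%:R `^ om ->
  exists2 K : R, 0 < K & forall n L j (eps e' : R), (0 < n)%N -> 0 < e' -> e' <= eps ->
    eps < 1 / 2 -> (n0 ^ L <= n0 ^ 2 * (2 * n))%N -> 2 ^+ j * eps <= 8 ->
    let logn := ln (n%:R / e') in let log1 := ln (1 / e') in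
    let kappa := (j + L + c1)%N in let st := (j + c2 * (L + 1))%N in
    [/\ (1 + 2 * j + norm_cost n0 r L kappa st)%N%:R <=
          K * (n%:R `^ om * logn ^+ 2 * log1),
        (1 < n)%N -> (c3 * (kappa.+1 * (L + 1)))%N%:R <= K * (logn ^+ 4 * ln n%:R)
      & 1 <= K * log1].
Proof.
move=> n01 qr om0 rom.
have l2 := ln2_gt0; set l := ln 2 in l2.
pose io := l^-1; have io0 : 0 < io by rewrite invr_gt0.
have iol : io * l = 1 by rewrite mulVf// gt_eqF.
have n00 : (0 < n0)%N by exact: ltnW.
pose a0 := ln (2 * n0 ^ 2)%N%:R : R.
have a00 : 0 <= a0 by rewrite ln_ge0// ler1n muln_gt0 expn_gt0 n00.
pose CL := io * (a0 * io + 1) + io; pose Ck := 4 * io + CL + c1%:R * io.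
pose CG := (2 * n0 ^ 2)%N%:R `^ om : R.
pose C' := (6 + 7 * r + 4 * c2)%N%:R * (Ck * (CL * CG)) + 4 * (Ck * (Ck * CG)) : R.
have CL0 : 0 <= CL by rewrite addr_ge0 ?mulr_ge0 ?addr_ge0 ?mulr_ge0// ltW.
have io1 := ltW io0.
have Ck0 : 0 <= Ck.
  by apply: addr_ge0; [apply: addr_ge0 => //|]; exact: mulr_ge0.
have CG0 : 0 <= CG by exact: powR_ge0.
have C'0 : 0 <= C'.
  by apply: addr_ge0; do ![apply: mulr_ge0 => //].
pose K3 := c3%:R * (Ck * CL * io ^+ 3) : R.
have K30 : 0 <= K3.
  by do ![apply: mulr_ge0 => //]; exact: exprn_ge0.
have C'io : 0 <= C' * io by exact: mulr_ge0.
(* The three terms serve the operation count, the precision bound and the last claim,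
   respectively. *)
exists (C' * io + K3 + io) => [|n L j eps e' n0' e'0 e'eps eps2 LB je]; first by lra.
move=> logn log1 kappa st.
set K := C' * io + K3 + io.
have nR : 0 < n%:R :> R by rewrite ltr0n.
have eps0 : 0 < eps by exact: lt_le_trans e'eps.
pose y := - ln e'.
have log1E : log1 = y by rewrite /log1 ln_div ?posrE// ln1 sub0r.
have lognE : logn = ln n%:R + y by rewrite /logn ln_div ?posrE.
have yl : l <= y.
  rewrite /y lerNr -lnV ?posrE// ler_ln ?posrE ?invr_gt0//.
  by rewrite -div1r; lra.
have lnn : 0 <= ln n%:R :> R by rewrite ln_ge0// ler1n.
have jl : j%:R <= 4 * io * y.
  have h : ln (2 ^+ j * eps) <= ln (2 ^+ 3 : R).
    rewrite ler_ln ?posrE ?mulr_gt0 ?exprn_gt0//.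
    by apply: (le_trans je); rewrite -natrX.
  rewrite lnM ?posrE ?exprn_gt0// !lnXn// -/l -mulr_natl -[l *+ 3]mulr_natl in h.
  have h2 : - ln eps <= y by rewrite /y lerN2 ler_ln ?posrE.
  have h3 : j%:R * l <= 4 * y by lra.
  have := ler_wpM2l (ltW io0) h3; rewrite mulrCA iol; lra.
have Ll : L%:R <= io * (a0 + ln n%:R).
  have h : ln (2 ^+ L : R) <= ln ((2 * n0 ^ 2)%N%:R * n%:R).
    rewrite ler_ln ?posrE ?exprn_gt0 ?mulr_gt0 ?ltr0n ?muln_gt0 ?expn_gt0 ?n00//.
    rewrite -natrX -natrM ler_nat; apply: (@leq_trans (n0 ^ L)%N).
      by case: (L) => // L'; rewrite leq_exp2r.
    by apply: (leq_trans LB); rewrite mulnCA mulnA.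
  rewrite lnM ?posrE ?ltr0n ?muln_gt0 ?expn_gt0 ?n00// lnXn// -/l -/a0 -[l *+ L]mulr_natl in h.
  have := ler_wpM2l (ltW io0) h; rewrite mulrCA iol; lra.
have Lx x : l <= x -> ln n%:R <= x -> L%:R + 1 <= CL * x.
  move=> lx nx.
  have ix : 1 <= io * x by rewrite -iol; apply: ler_wpM2l => //; exact: ltW.
  have h1 : io * (a0 + ln n%:R) <= io * (a0 * (io * x) + x).
    apply: ler_wpM2l; first exact: ltW.
    by apply: lerD => //; exact: ler_peMr.
  by rewrite /CL; lra.
have lognl : l <= logn by rewrite lognE; lra.
have nlogn : ln n%:R <= logn by rewrite lognE; lra.
have iln : 1 <= io * logn by rewrite -iol; apply: ler_wpM2l => //; exact: ltW.
have L1 := Lx _ lognl nlogn.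
have k1 : kappa.+1%:R <= Ck * logn.
  have c1l : c1%:R <= c1%:R * io * logn by rewrite -mulrA; exact: ler_peMr.
  have yl' : io * y <= io * logn by apply: ler_wpM2l; [exact: ltW|rewrite lognE; lra].
  by rewrite /kappa -natr1 !natrD /Ck; lra.
have G1 : (r ^ L)%N%:R <= CG * n%:R `^ om.
  rewrite natrX; apply: (@le_trans _ _ ((n0%:R `^ om) ^+ L)).
    by apply: lerXn2r; rewrite ?nnegrE ?powR_ge0.
  rewrite powRnX// /CG -powRM// -natrX -natrM.
  apply: ge0_ler_powR; rewrite ?nnegrE// ler_nat.
  by apply: (leq_trans LB); rewrite mulnCA mulnA.
have logn0 : 0 <= logn by lra.
have T0 : 0 <= n%:R `^ om :> R by exact: powR_ge0.
set T := n%:R `^ om in G1 T0 *.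
have LR : (L + 1)%N%:R <= CL * logn by rewrite natrD.
split.
- have h := norm_cost_le n00 qr (erefl kappa) (erefl st); rewrite -(ler_nat R) in h.
  apply: (le_trans h); rewrite natrD !natrM.
  have q1 : kappa.+1%:R * ((L + 1)%N%:R * (r ^ L)%N%:R) <=
      Ck * logn * (CL * logn * (CG * T)).
    by apply: ler_pM => //; apply: ler_pM.
  have q2 : kappa.+1%:R * (kappa.+1%:R * (r ^ L)%N%:R) <=
      Ck * logn * (Ck * logn * (CG * T)).
    by apply: ler_pM => //; apply: ler_pM.
  have q3 := ler_wpM2l (ler0n R (6 + 7 * r + 4 * c2)) q1.
  have q4 : C' * (T * logn ^+ 2) <= C' * (T * logn ^+ 2) * (io * y).
    apply: ler_peMr; first by rewrite mulr_ge0// mulr_ge0// sqr_ge0.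
    by rewrite -iol; apply: ler_wpM2l => //; exact: ltW.
  have q5 : 0 <= (K3 + io) * (T * logn ^+ 2 * y).
    rewrite mulr_ge0// ?mulr_ge0 ?sqr_ge0//; lra.
  rewrite log1E; apply: (@le_trans _ _ (C' * (T * logn ^+ 2))).
    by rewrite /C'; move: q2 q3; lra.
  by apply: (le_trans q4); rewrite /K; lra.
- move=> n1.
  (* Here n > 1 matters: ln n is bounded below, so L + 1 is O(ln n). *)
  have lnl : l <= ln n%:R by rewrite ler_ln ?posrE// ler_nat.
  have L2 := Lx _ lnl (lexx _).
  rewrite !natrM natrD.
  have q1 : kappa.+1%:R * (L%:R + 1%:R) <= Ck * logn * (CL * ln n%:R) by apply: ler_pM.
  have q2 := ler_wpM2l (ler0n R c3) q1.
  apply: (le_trans q2).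
  (* The product kappa L needs only one factor [logn]; the other three are padded with factors at
     least 1. *)
  have q3 : 1 <= (io * logn) ^+ 3 by exact: exprn_ege1.
  have q4 : 0 <= c3%:R * (Ck * logn * (CL * ln n%:R)) by rewrite !mulr_ge0.
  have q5 := ler_peMr q4 q3.
  have q6 : 0 <= (C' * io + io) * (logn ^+ 4 * ln n%:R).
    by rewrite !mulr_ge0 ?exprn_ge0//; lra.
  apply: (le_trans q5); rewrite /K.
  have -> : c3%:R * (Ck * logn * (CL * ln n%:R)) * (io * logn) ^+ 3 =
    K3 * (logn ^+ 4 * ln n%:R) by rewrite /K3; ring.
  by lra.
- rewrite log1E /K.
  have q1 : 1 <= io * y by rewrite -iol; apply: ler_wpM2l => //; exact: ltW.
  have q2 : 0 <= (C' * io + K3) * y by rewrite mulr_ge0//; lra.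
  by lra.
Qed.
End Costs.

(** * The doubling loop and the final assembly *)

Lemma coin_prob0 {R : realType} (E : 0.-tuple bool -> Prop) :
  (forall t, E t) -> coin_prob E = 1 :> R.
Proof.
move=> HE; rewrite /coin_prob expr0 divr1.
have -> : [set t : 0.-tuple bool | `[< E t >]]%SET = [set: 0.-tuple bool]%SET.
  by apply/setP => t; rewrite !inE; apply/asboolP.
by rewrite cardsT card_tuple expn0.
Qed.

Lemma coin_prob_ge0 {R : realType} N (E : N.-tuple bool -> Prop) :
  0 <= coin_prob E :> R.
Proof. by rewrite divr_ge0// exprn_ge0. Qed.

Lemma roundoff_mul {R : realType} (i p : nat) : (i <= p)%N ->
  i%:R * unit_roundoff p <= 1 / 2 :> R.
Proof.
move=> ip; case: p ip => [|p] ip.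
  by move: ip; rewrite leqn0 => /eqP->; rewrite mul0r; lra.
have h : i%:R <= 2 ^+ p :> R.
  by apply: natr_pow2; apply: (leq_trans ip); exact: ltn_expl.
rewrite /unit_roundoff ler_pdivrMr ?exprn_gt0// exprS; lra.
Qed.

(** At most p roundings change 2 ^ i eps by at most a factor 2. The previous doubling was rejected,
    against a rounded 1 that is at most 2, whence 8; acceptance against a rounded 1 that is at least
    1/2 gives the factor 4. *)
Lemma doubling_bounds {R : realType} (eps : R) (F : fp_arith R) (p j : nat) :
  fp_model (unit_roundoff p) F -> 0 < eps -> eps < 1 / 2 -> (j <= p)%N ->
  (forall i, (i < j)%N -> ~~ (fl_cst F 1 <= fdbl F eps i)) ->
  ((j < p)%N -> fl_cst F 1 <= fdbl F eps j) ->
  2 ^+ j * eps <= 8 /\ ((j < p)%N -> 1 <= 4 * (2 ^+ j * eps)).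
Proof.
move=> Fu e0 e1 jp below above; set u : R := unit_roundoff p in Fu.
have u0 : 0 <= u by rewrite invr_ge0 exprn_ge0.
have u1 : u <= 1 by rewrite invf_le1 ?exprn_gt0// exprn_ege1// ler1n.
have near i : (i <= p)%N -> 2 ^+ i * eps / 2 <= fdbl F eps i /\ fdbl F eps i <= 2 * (2 ^+ i * eps).
  move=> ip; have [h1 h2] := fdbl_bounds Fu u0 u1 i (ltW e0).
  have [p1 p2] := pow_near1 u0 u1 (roundoff_mul ip).
  have x0 : 0 <= 2 ^+ i * eps by rewrite mulr_ge0 ?exprn_ge0// ltW.
  by have := ler_wpM2r x0 p1; have := ler_wpM2r x0 p2; split; lra.
have [d du one] := Fu.2 1.
have [_ [d1 d2]] := delta_bounds u0 u1 du.
rewrite mulr1 in one; split.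
  case: j jp below above => [|j] jp below _; first by rewrite expr0; lra.
  have := below j (ltnSn _); rewrite -ltNge one => h.
  have [h1 _] := near j (ltnW jp); rewrite exprS; lra.
move=> jp'; have := above jp'; rewrite one => h.
have [_ h2] := near j jp.
have uh : u <= 1 / 2.
  have p1 : (1 <= p)%N by case: (p) jp'.
  by have := @roundoff_mul R 1 p p1; rewrite mul1r -/u; lra.
by lra.
Qed.

Theorem theorem4p4 (R : realType) (eta : R) (eta_gt0 : 0 < eta) :
  exists (NORM : program R) (K : R), 0 < K /\
  forall (n : nat) (A : 'M[R[i]]_n) (eps : R),
    A \is hermsymmx -> A != 0 -> 0 < eps -> eps < 1 / 2 ->
  forall (p : nat) (F : fp_arith R), fp_model (unit_roundoff p) F ->
  let log_n := ln (n%:R / eps_norm A eps) in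
  let log_1 := ln (1 / eps_norm A eps) in
  exists N : nat,
    let correct := 1 - K * (log_1 / n%:R) <=
      coin_prob (fun t : N.-tuple bool => exists s sigma,
        [/\ halts NORM F A eps p t s, outcome s = Some sigma
          & `|sigma - spectral_norm A| <= eps * spectral_norm A]) in
    let error := forall (t : N.-tuple bool) (s : state R),
      halts NORM F A eps p t s -> outcome s = None in
    [/\ forall t : N.-tuple bool, exists2 s, halts NORM F A eps p t s &
          (flops s)%:R <= K * (T_MM eta n * log_n ^+ 2 * log_1),
        K * (log_n ^+ 4 * ln n%:R) <= p%:R -> correct
      & correct \/ error].
Proof.
have [n0 [r [mu [mv [mw [n01 qr om0 rom brentP]]]]]] := fast_bilinear eta_gt0.
set q := (n0 * n0)%N in qr brentP.
pose m := \sum_(i < r) \sum_(j < q) `|mu i j| + \sum_(i < r) \sum_(j < q) `|mv i j|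
  + \sum_(i < q) \sum_(j < r) `|mw i j|.
have sum0 (a b : nat) (f : nat -> nat -> R) : 0 <= \sum_(i < a) \sum_(j < b) `|f i j|.
  by apply: sumr_ge0 => i _; exact: sumr_ge0.
have [su [sv sw]] := conj (sum0 r q mu) (conj (sum0 r q mv) (sum0 q r mw)).
have m0 : 0 <= m by rewrite /m; lra.
have mu_le l x : (l < r)%N -> (x < q)%N -> `|mu l x| <= m.
  by move=> h1 h2; have := table_le mu h1 h2; rewrite /m; lra.
have mv_le l x : (l < r)%N -> (x < q)%N -> `|mv l x| <= m.
  by move=> h1 h2; have := table_le mv h1 h2; rewrite /m; lra.
have mw_le z l : (z < q)%N -> (l < r)%N -> `|mw z l| <= m.
  by move=> h1 h2; have := table_le mw h1 h2; rewrite /m; lra.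
pose beta := 1 + r%:R * m.
have rm0 : 0 <= r%:R * m by exact: mulr_ge0.
have beta1 : 1 <= beta by rewrite /beta; lra.
have rm_le : r%:R * m <= beta by rewrite /beta; lra.
pose cb := Num.bound (3 * beta).
have beta_le : 3 * beta <= 2 ^+ cb.
  have b0 : 0 <= 3 * beta by lra.
  apply: (le_trans (ltW (archi_boundP b0))); apply: natr_pow2.
  exact/ltnW/ltn_expl.
have expl a : (a <= 2 ^ a)%N by exact/ltnW/ltn_expl.
(* Crude logarithms suffice for constants of the program: a <= 2 ^ a provides the exponents for n0
   and [gam r], and similarly here for r in base n0. *)
have re : (r <= n0 ^ r)%N by exact/ltnW/ltn_expl.
pose cg := gam r; pose c1 := (n0 + 6)%N; pose c2 := (2 * n0 + 8)%N.
pose c3 := (16 + c2 + 2 * n0 + cg + 3 * cb)%N.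
have c30 : (0 < c3)%N by rewrite !addn_gt0.
have [K K0 HK] := cost_bounds c1 c2 c3 n01 qr om0 rom.
pose wexp := ((2 * n0 ^ 2 + c1 + c2 + c3 + 32).+1 * (r + 4))%N.
pose tU := mktab r q mu; pose tV := mktab r q mv; pose tW := mktab q r mw.
pose NORM := Program wexp (cnorm n0 r tU tV tW c1 c2 c3).
exists NORM, K; split=> // n A eps Ah A0 e0 e1 p F Fu log_n log_1.
have n_gt0 : (0 < n)%N.
  by rewrite lt0n; apply: contra A0 => /eqP nE; subst n; rewrite [A]thinmx0.
(* Without coin tosses the sample space has one point, so the success probability is 0 or 1. *)
exists 0%N => correct error.
pose s0 := input_state A eps p.
have s_gt0 : 0 < spectral_norm A by exact: (spectral_norm_gt0 Ah (leqnn (2 * n)) n_gt0).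
pose e' := eps_norm A eps.
have e'0 : 0 < e' by rewrite mulr_gt0// lt_min ltr01.
have e'e : e' <= eps by rewrite ler_piMr ?(ltW e0)// ge_min lexx.
have [w1 [w2 w3 w4 w5] w6 w7 w8] := word_bounds n0 c1 c2 c3 r p n_gt0.
pose Good (s : state R) :=
  (flops s)%:R <= K * (T_MM eta n * log_n ^+ 2 * log_1) /\
  ((exists2 sigma, outcome s = Some sigma
      & `|sigma - spectral_norm A| <= eps * spectral_norm A) \/
   (outcome s = None /\
    ((1 < n)%N -> p%:R < K * (log_n ^+ 4 * ln n%:R)))).
have runP (t : 0.-tuple bool) : exists2 s, halts NORM F A eps p t s & Good s.
  have [s rs Gs] : wp F ((n + p + 2) ^ wexp)%N (nth false t) (cnorm n0 r tU tV tW c1 c2 c3) s0 Good.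
    apply: (@wp_cnorm _ F _ _ n0 r tU tV tW c1 c2 c3 n p r) => //.
    - by rewrite size_mkseq mulnC.
    - by rewrite size_mkseq mulnC.
    - by rewrite size_mkseq.
    move=> s L j L1 nL LB jp below above; cbv zeta.
    have [j8 j4] := doubling_bounds Fu e0 e1 jp below above.
    have [cost prec _] := HK n L j eps e' n_gt0 e'0 e'e e1 LB j8.
    case: ifP => chk.
      move=> [r0 [c0 fl]]; split.
        by apply: le_trans cost; rewrite ler_nat; move: fl; rewrite add0n.
      left; exists (cells s 0); first by rewrite /outcome r0.
      rewrite c0; apply: (fnorm_accurate n01 qr m0 mu_le mv_le mw_le beta1 rm_le brentP
        (expl n0) beta_le (expl cg) Fu Ah A0 n_gt0 e0 e1 nL) => //.
      (* Passing the test forces j < p, so the doubling loop stopped on its comparison and not on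
         its cap. *)
      apply: j4; apply: leq_trans chk.
      apply: (@leq_trans (j + L + c1).+1); first by rewrite ltnS -addnA leq_addr.
      by rewrite mulnCA leq_pmulr// muln_gt0 c30 addn1.
    move=> [r0 fl]; split.
      apply: le_trans cost; rewrite ler_nat fl /=.
      by rewrite add0n leq_addr.
    right; split; first by rewrite /outcome (negbTE r0).
    by move=> n1; apply: lt_le_trans (prec n1); rewrite ltr_nat ltnNge chk.
  exists s => //; split; first exact: rs.
  by rewrite (runs_noflip (noflip_cnorm _ _ _ _ _ _ _ _) rs).
pose t0 : 0.-tuple bool := [tuple].
have [s hs [fls good]] := runP t0.
have fast (t : 0.-tuple bool) : exists2 s, halts NORM F A eps p t s &
    (flops s)%:R <= K * (T_MM eta n * log_n ^+ 2 * log_1).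
  by have [s' hs' [f' _]] := runP t; exists s'.
have log1_0 : 0 <= K * (log_1 / n%:R).
  by rewrite mulr_ge0 ?(ltW K0)// divr_ge0// ln_ge0// ler_pdivlMr// mul1r -/e'; lra.
case: good => [[sigma os acc]|[os prec]].
  have ok : correct.
    rewrite /correct coin_prob0; first by lra.
    by move=> t; rewrite (tuple0 t); exists s, sigma.
  by split=> //; left.
split=> //; last first.
  (* The tape is unique and execution deterministic, so every halting run ends in the error state
     found above. *)
  right=> t s' [rs' _]; rewrite (tuple0 t) in rs'.
  by have [rs _] := hs; rewrite (runs_det rs' rs).
(* For n > 1 the precision assumption contradicts the error. For n = 1 it is satisfied by every p,
   but [K * log_1 >= 1] makes the claimed lower bound nonpositive. *)
move=> hp; have [n1|n1] := ltnP 1 n.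
  by have := prec n1; rewrite ltNge hp.
rewrite /correct; apply: le_trans (coin_prob_ge0 _).
have n1E : n = 1%N by apply/eqP; rewrite eqn_leq n1 n_gt0.
have nE : n%:R = 1 :> R by rewrite n1E.
have h2 : (n0 ^ 2 <= n0 ^ 2 * (2 * n))%N by rewrite leq_pmulr// muln_gt0.
have h8 : 2 ^+ 0 * eps <= 8 by rewrite expr0; lra.
have [_ _ h] := HK n 2%N 0%N eps e' n_gt0 e'0 e'e e1 h2 h8.
by move: h; rewrite nE divr1 -/log_1; lra.
Qed.
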